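(* Let $\mathcal{X}=[0,1]^d$, let $(P,Q)\in\mathcal{P}_{\chi^2}(\mathcal{X})$, let $f_{\chi^2}:=2\big(\frac{dP}{dQ}-1\big)$, and let $X^n=(X_1,\dots,X_n)$ and $Y^n=(Y_1,\dots,Y_n)$ be i.i.d. samples from $P$ and $Q$, respectively. For any $\alpha>0$: (i) If $f_{\chi^2}\in\mathsf{C}(\mathcal{X})$ (continuous on $\mathcal{X}$), then for $\{k_n\}_{n\in\mathbb{N}}$ such that $k_n\to\infty$ and $k_n=O\big(n^{(1-\alpha)/5}\big)$, $$\hat\chi^2_{\mathcal{G}_{k_n}(\mathbf{1})}(X^n,Y^n)\xrightarrow[n\to\infty]{}\chi^2(P\|Q),\quad\mathbb{P}\text{-a.s.}$$ (ii) Suppose there exists an $M$ such that $f_{\chi^2}\in\mathcal{I}(M)$. Then, for $k$ and $n$ such that $\sqrt k\log^2k=O\big(n^{(1-\alpha)/2}\big)$, $$\mathbb{E}\Big[\big|\hat\chi^2_{\mathcal{G}^*_k(0.5\log k)}(X^n,Y^n)-\chi^2(P\|Q)\big|\Big]=O\big(k^{-\frac12}+\sqrt k\,\log^2k\;n^{-\frac12}\big).$$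
   Context: For $P\ll Q$ in $\mathcal{P}(\mathcal{X})$ (Borel probability measures on $\mathcal{X}$), $\chi^2(P\|Q)=\mathbb{E}_Q\big[(\frac{dP}{dQ}-1)^2\big]$. $\mathcal{P}_{\chi^2}(\mathcal{X})$ is the set of pairs $(P,Q)\in\mathcal{P}(\mathcal{X})\times\mathcal{P}(\mathcal{X})$ with $P\ll Q$ and $\chi^2(P\|Q)<\infty$. Neural network class: let $\phi(x)=\frac{1}{1+e^{-x}}$. For $k\in\mathbb{N}$ and $\mathbf{a}=(a_1,a_2,a_3)\in\mathbb{R}^3_{\ge0}$, $\mathcal{G}_k(\mathbf{a})$ is the set of functions $g:\mathbb{R}^d\to\mathbb{R}$ of the form $g(x)=\sum_{i=1}^k\beta_i\phi(w_i\cdot x+b_i)+b_0$ with $w_i\in\mathbb{R}^d$, $b_0,b_i,\beta_i\in\mathbb{R}$, $\max_{i=1,\dots,k,\,j=1,\dots,d}\{|w_{i,j}|,|b_i|\}\le a_1$, $|\beta_i|\le a_2$ for $i=1,\dots,k$, and $|b_0|\le a_3$. $\mathbf{1}=(1,1,1)$, and $\mathcal{G}_k^*(c):=\mathcal{G}_k(\sqrt k\log k,2k^{-1}c,c)$ for $c\ge0$. Neural estimator: $\hat\chi^2_{\mathcal{G}}(X^n,Y^n):=\sup_{g\in\mathcal{G}}\frac1n\sum_{i=1}^n\big[g(X_i)-g(Y_i)-\tfrac14g(Y_i)^2\big]$. Barron class: for $f:\mathbb{R}^d\to\mathbb{R}$ having a Fourier representation $f(x)=\int_{\mathbb{R}^d}e^{i\omega\cdot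 x}\tilde F(d\omega)$, with $\tilde F$ a complex Borel measure on $\mathbb{R}^d$ with magnitude $F$, set $B(f):=\int_{\mathbb{R}^d}\sup_{x\in\mathcal{X}}|\omega\cdot x|\,F(d\omega)$. For $c\ge0$, $\mathcal{B}_c$ is the set of such $f$ with $B(f)\vee|f(0)|\le c$. For $\tilde f:\mathcal{X}\to\mathbb{R}$, $c_B^\star(\tilde f):=\inf\{c:\exists f\in\mathcal{B}_c,\ \tilde f=f|_{\mathcal{X}}\}$ (with $\inf\emptyset=\infty$). $\mathcal{I}(m):=\{f:\mathcal{X}\to\mathbb{R}:\ c_B^\star(f)\vee\|f\|_\infty\le m\}$, with $\|\cdot\|_\infty$ the sup norm on $\mathcal{X}$ and $a\vee b=\max\{a,b\}$. Constants implied by $O(\cdot)$ do not depend on $k,n$. *)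

(* Defs.v *)
From mathcomp Require Import all_boot all_order all_algebra.
From mathcomp Require Import finmap.
From mathcomp Require Import all_classical all_reals all_analysis.

Set Implicit Arguments.
Unset Strict Implicit.
Unset Printing Implicit Defensive.

Import Order.TTheory GRing.Theory Num.Theory.
Import numFieldNormedType.Exports.

Local Open Scope classical_set_scope.
Local Open Scope ring_scope.
Local Open Scope charge_scope.

(* R^d with its Borel sigma-algebra; the carrier is convertible to 'rV[R]_d. *)
Notation borelRd R d := (g_sigma_algebraType (@open 'rV[R]_d)).

Definition dotp (R : realType) (d : nat) (u v : 'rV[R]_d) : R :=
  \sum_(j < d) u 0 j * v 0 j.

Definition unit_cube (R : realType) (d : nat) : set 'rV[R]_d :=
  [set x | forall j, 0 <= x 0 j <= 1].
Arguments unit_cube R d : clear implicits.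

(* The library's derivative may be extended-real valued, but it is finite
   everywhere when P `<< Q, so that `fine` loses nothing. *)
Definition density (R : realType) (d : nat) (P Q : probability (borelRd R d) R)
  (x : borelRd R d) : R := fine (('d (charge_of_finite_measure P) '/d Q) x).

Definition chi2 (R : realType) (d : nat) (P Q : probability (borelRd R d) R) :
  \bar R := 'E_Q[fun x => (density P Q x - 1) ^+ 2].

(* A Borel probability measure on K is encoded as one on R^d giving mass 1 to
   the (Borel) set K. *)
Definition chi2_pair (R : realType) (d : nat) (K : set 'rV[R]_d)
    (P Q : probability (borelRd R d) R) : Prop :=
  [/\ P K = 1%E, Q K = 1%E, P `<< Q & (chi2 P Q < +oo)%E].

(* dP/dQ, hence 2 (dP/dQ - 1), is only determined Q-almost everywhere: this
   says that f (restricted to K) is a version of it. *)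
Definition fchi2_version (R : realType) (d : nat) (K : set 'rV[R]_d)
    (P Q : probability (borelRd R d) R) (f : 'rV[R]_d -> R) : Prop :=
  {ae Q, forall x, K x -> f x = 2 * (density P Q x - 1)}.

Definition mutually_independent (R : realType)
    (d1 d2 : measure_display) (T : measurableType d1) (E : measurableType d2)
    (PP : probability T R) (X : nat -> {RV PP >-> E}) : Prop :=
  forall (J : {fset nat}) (A : nat -> set E), (forall i, measurable (A i)) ->
    PP (\bigcap_(i in [set` J]) (X i @^-1` A i)) =
    (\prod_(i <- J) PP (X i @^-1` A i))%E.

Definition iid_sample (R : realType)
    (d1 d2 : measure_display) (T : measurableType d1) (E : measurableType d2)
    (PP : probability T R) (X : nat -> {RV PP >-> E}) (P : probability E R) :
    Prop :=
  (forall i A, measurable A -> distribution PP (X i) A = P A) /\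
  mutually_independent X.

Definition logistic (R : realType) (x : R) : R := (1 + expR (- x))^-1.

Definition neural_nets (R : realType) (d k : nat) (a1 a2 a3 : R) :
    set ('rV[R]_d -> R) :=
  [set g | exists (w : 'I_k -> 'rV[R]_d) (b beta : 'I_k -> R) (b0 : R),
    [/\ forall i, (forall j, `|w i 0 j| <= a1) /\ `|b i| <= a1,
        forall i, `|beta i| <= a2,
        `|b0| <= a3 &
        forall x, g x =
          \sum_(i < k) beta i * logistic (dotp (w i) x + b i) + b0]].
Arguments neural_nets R d k a1 a2 a3 : clear implicits.

Definition neural_nets_star (R : realType) (d k : nat) (c : R) :
    set ('rV[R]_d -> R) :=
  neural_nets R d k (Num.sqrt k%:R * ln k%:R) (2 * k%:R^-1 * c) c.
Arguments neural_nets_star R d k c : clear implicits.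

Definition chi2_estimator (R : realType) (d : nat) (G : set ('rV[R]_d -> R))
    (n : nat) (x y : 'I_n -> 'rV[R]_d) : \bar R :=
  ereal_sup [set (n%:R^-1 *
    \sum_(i < n) (g (x i) - g (y i) - 4^-1 * g (y i) ^+ 2))%:E | g in G].

Section charge_integral.
Context (R : realType) (dT : measure_display) (T : measurableType dT).
Variable nu : {charge set T -> \bar R}.

Definition hahn_pos : set T := projT1 (cid (Hahn_decomposition nu)).

Definition hahn_neg : set T :=
  projT1 (cid (projT2 (cid (Hahn_decomposition nu)))).

Lemma hahnP : hahn_decomposition nu hahn_pos hahn_neg.
Proof. exact: projT2 (cid (projT2 (cid (Hahn_decomposition nu)))). Qed.

(* Independent of the Hahn decomposition chosen. *)
Definition charge_integral (f : T -> R) : \bar R :=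
  (\int[jordan_pos hahnP]_x (f x)%:E - \int[jordan_neg hahnP]_x (f x)%:E)%E.

End charge_integral.

(* A complex Borel measure is given by its real and imaginary parts. *)
Record complex_measure (R : realType) (d : nat) := ComplexMeasure {
  re_part : {charge set (borelRd R d) -> \bar R} ;
  im_part : {charge set (borelRd R d) -> \bar R} }.

Definition cm_abs (R : realType) (d : nat) (mu : complex_measure R d)
    (A : set (borelRd R d)) : R :=
  Num.sqrt (fine (re_part mu A) ^+ 2 + fine (im_part mu A) ^+ 2).

(* F is the magnitude (total variation measure) of mu. *)
Definition is_magnitude (R : realType) (d : nat) (mu : complex_measure R d)
    (F : {finite_measure set (borelRd R d) -> \bar R}) : Prop :=
  forall A, measurable A ->
    F A = ereal_sup [set (\sum_(0 <= i <oo) (cm_abs mu (E i))%:E)%E | E in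
      [set E : nat -> set (borelRd R d) |
        [/\ forall i, measurable (E i), trivIset setT E &
            \bigcup_i E i = A]]].

(* f(x) is the integral of exp(i w.x) against mu; the second equation is the
   vanishing of the imaginary part of that integral. *)
Definition fourier_representation (R : realType) (d : nat)
    (f : 'rV[R]_d -> R) (mu : complex_measure R d) : Prop :=
  forall x,
    (f x)%:E =
      (charge_integral (re_part mu) (fun w => cos (dotp w x)) -
       charge_integral (im_part mu) (fun w => sin (dotp w x)))%E /\
    (charge_integral (im_part mu) (fun w => cos (dotp w x)) +
     charge_integral (re_part mu) (fun w => sin (dotp w x)))%E = 0%E.

Definition barron_seminorm (R : realType) (d : nat) (K : set 'rV[R]_d)
    (F : {finite_measure set (borelRd R d) -> \bar R}) : \bar R :=
  (\int[F]_w ereal_sup [set `|dotp w x|%:E | x in K])%E.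

(* The Fourier transform is injective on complex measures, so there is at most
   one mu to quantify over. *)
Definition barron_class (R : realType) (d : nat) (K : set 'rV[R]_d) (c : R) :
    set ('rV[R]_d -> R) :=
  [set f | exists (mu : complex_measure R d)
             (F : {finite_measure set (borelRd R d) -> \bar R}),
    [/\ is_magnitude mu F, fourier_representation f mu &
        (maxe (barron_seminorm K F) `|f 0|%:E <= c%:E)%E]].

(* A function on K is encoded as a function on R^d of which only the values on
   K matter. *)
Definition barron_constant (R : realType) (d : nat) (K : set 'rV[R]_d)
    (f : 'rV[R]_d -> R) : \bar R :=
  ereal_inf [set c%:E | c in [set c : R | 0 <= c /\
    exists2 h, barron_class K c h & forall x, K x -> f x = h x]].

Definition sup_norm (R : realType) (d : nat) (K : set 'rV[R]_d)
    (f : 'rV[R]_d -> R) : \bar R :=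
  ereal_sup [set `|f x|%:E | x in K].

Definition barron_ball (R : realType) (d : nat) (K : set 'rV[R]_d) (m : R) :
    set ('rV[R]_d -> R) :=
  [set f | (maxe (barron_constant K f) (sup_norm K f) <= m%:E)%E].

(* Main.v *)
(* Let f0 = 2 (dP/dQ - 1).  Completing the square, the population objective of a
   function g is chi2 (P || Q) - E_Q[(g - f0)^2] / 4, so the error of the
   estimator splits into the uniform deviation of empirical means over the class
   and the squared L2(Q) distance from f0 to the class.

   Deviation.  A network is a combination, of total weight at most
   L = k a2 + 2 a3, of neurons (the bias being a multiple of the neuron with zero
   weights), so it is enough to bound the deviation uniformly over products of
   two neurons, with an error growing like L^2.  These products depend in a
   Lipschitz way on 2 (d + 1) parameters; the high even moments of the deviations
   are controlled by Hoeffding-type exponential moments, and a dyadic chaining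
   over the parameter box collects them in one random variable G with
   E G = O(n^-m) and m as large as we please.

   Approximation, (i).  Differentiating x |-> logistic (v . x + b) in v, one gets
   all monomials times a derivative of the logistic function, which is a nonzero
   polynomial in logistic and hence does not vanish identically; so the networks
   with bounded inner weights are uniformly dense in the continuous functions on
   the cube by Bernstein's theorem.  Repeating a neuron replaces a large outer
   weight by weights at most 1.

   Approximation, (ii).  A Barron function is a mixture of ridge functions
   x |-> cos (w . x), sin (w . x), each being a combination of steep logistic
   neurons up to an error 1 / tau.  So the pairing of any bounded s with the
   target is at most V times the largest pairing of s with a signed neuron, up to
   V ||s|| / tau, and greedily adding the best neuron with equal weights yields
   k neurons at squared distance O(1 / k), with tau = sqrt k. *)

Require Import Defs.
From mathcomp Require Import all_boot all_order all_algebra.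
From mathcomp Require Import finmap.
From mathcomp Require Import all_classical all_reals all_analysis.
From mathcomp Require Import measurable_realfun.
From mathcomp Require Import zify ring lra.

Set Implicit Arguments.
Unset Strict Implicit.
Unset Printing Implicit Defensive.

Import Order.TTheory GRing.Theory Num.Theory.
Import numFieldNormedType.Exports.

Local Open Scope classical_set_scope.
Local Open Scope ring_scope.

(** The supremum over a class of networks is not known to be measurable. No expectation of it is
    therefore transformed: at each sample point the error is compared with a measurable majorant
    indexed by countably many grid points, and the integral of a nonnegative function is monotone
    even without measurability.

    Moments are preferred to tail bounds because they turn this majorant into a sum, integrated term
    by term. The dyadic grid of level [l] has of the order of [2^(l D)] points, [D = 2 (d + 1)], and
    increments of size [2^(-l)]; a moment of order [2 m] with [D < m] beats their number. Since [m]
    is free, the size of the box and the requirement of summability in [n] are both paid by taking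
    [m] large.

    In (ii) the Barron constant controls the first moment of the frequency measure but not its mass;
    hence the value at 0 is split off and the remaining ridge functions vanish at 0. The greedy
    construction uses the target through a scalar duality inequality only, so the target is never
    exhibited as an element of a closed convex hull, and near-optimal atoms suffice. *)

Section disintegration.
Context d1 d2 (T : measurableType d1) (E : measurableType d2) (R : realType).
Variables (mu : {measure set T -> \bar R}) (P : {measure set E -> \bar R}).
Local Open Scope ereal_scope.
Import HBNNSimple.

(** Change of variables for the image under [Y] of the measure with density [W]: the identity on
    sets passes to simple functions by linearity and to [h] by monotone convergence. With [W]
    carrying the other observations, independence of events yields independence at the level of
    functions. *)
Lemma ge0_integral_weighted_comp (W : T -> R) (Y : T -> E) (c : R)
    (h : E -> \bar R) :
  (forall t, 0 <= W t)%R -> measurable_fun setT W -> measurable_fun setT Y ->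
  (0 <= c)%R ->
  (forall B, measurable B ->
     \int[mu]_t (W t * \1_B (Y t))%:E = c%:E * P B) ->
  (forall x, 0 <= h x) -> measurable_fun setT h ->
  \int[mu]_t ((W t)%:E * h (Y t)) = c%:E * \int[P]_x h x.
Proof.
move=> W0 mW mY c0 H h0 mh.
pose f_ := nnsfun_approx measurableT mh.
have hlim x : (fun n => (f_ n x)%:E) @ \oo --> h x.
  by apply: cvg_nnsfun_approx.
have mf n : measurable_fun setT (f_ n) by apply: measurable_funP.
have fge0 n x : (0 <= f_ n x)%R by apply: fun_ge0.
have -> : \int[P]_x h x = limn (fun n => \int[P]_x (f_ n x)%:E).
  rewrite -monotone_convergence//.
  - by apply: eq_integral => y _; apply/esym/cvg_lim.
  - by move=> n; apply/measurable_EFinP.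
  - by move=> n y _; rewrite lee_fin.
  - by move=> y _ m n mn; rewrite lee_fin; exact/lefP/nd_nnsfun_approx.
have nd : nondecreasing_seq (fun n => \int[P]_x (f_ n x)%:E).
  move=> m n mn; apply: ge0_le_integral => //.
  - by move=> x _; rewrite lee_fin.
  - by apply/measurable_EFinP.
  - by apply/measurable_EFinP.
  - by move=> y _; rewrite lee_fin; exact/lefP/nd_nnsfun_approx.
rewrite -limeMl//; last exact: ereal_nondecreasing_is_cvgn.
have -> : (fun n => c%:E * \int[P]_x (f_ n x)%:E) =
    (fun n => \int[mu]_t (W t * f_ n (Y t))%:E).
  apply/funext => n.
  rewrite (_ : \int[P]_x (f_ n x)%:E =
    \sum_(k \in range (f_ n)) \int[P]_x (k * \1_(f_ n @^-1` [set k]) x)%:E); last first.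
    rewrite -ge0_integral_fsum//.
    - by apply: eq_integral => y _; rewrite fsumEFin// -fimfunE.
    - by move=> r; apply/measurable_EFinP/measurable_funM.
    - by move=> r x _; rewrite nnfun_muleindic_ge0.
  rewrite ge0_mule_fsumr; last first.
    by move=> r; apply: integral_ge0 => x _; rewrite nnfun_muleindic_ge0.
  transitivity (\sum_(k \in range (f_ n))
     \int[mu]_t (k * (W t * \1_(f_ n @^-1` [set k]) (Y t)))%:E); last first.
    rewrite -ge0_integral_fsum//.
    - apply: eq_integral => y _; rewrite fsumEFin// [in RHS]fimfunE; congr EFin.
      rewrite mulrC mulr_fsuml//; apply: eq_fsbigr => k _; lra.
    - move=> r; apply/measurable_EFinP/measurable_funM => //.
      apply: measurable_funM => //.
      by apply: (measurableT_comp _ mY); apply: measurable_indic.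
    - move=> r x _.
      have := nnfun_muleindic_ge0 (f_ n) r (Y x); rewrite /= !lee_fin => ?.
      by rewrite mulrCA mulr_ge0.
  apply: eq_fsbigr => k /[!inE] -[x _ <-].
  rewrite integralZl_indic_nnsfun// integral_indic// setIT.
  under [RHS]eq_integral do rewrite EFinM.
  rewrite ge0_integralZl//.
  - by rewrite H// muleCA.
  - apply/measurable_EFinP; apply: measurable_funM => //.
    by apply: (measurableT_comp _ mY); apply: measurable_indic.
  - by move=> t _; rewrite lee_fin mulr_ge0.
  - by rewrite lee_fin.
rewrite -monotone_convergence//.
- apply: eq_integral => t _; apply/esym/cvg_lim => //.
  by under eq_fun do rewrite EFinM; apply: cvgeZl.
- move=> n; apply/measurable_EFinP; apply: measurable_funM => //.
  exact: (measurableT_comp _ mY).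
- by move=> n y _; rewrite lee_fin mulr_ge0.
- by move=> t _ m n mn; rewrite lee_fin ler_wpM2l//; exact/lefP/nd_nnsfun_approx.
Qed.

End disintegration.

(** Everything comes from [1 + t <= expR t] at [t = - x / 2], squared and inverted; the remaining
    polynomial inequality factors with [1 - x >= 0]. *)
Lemma expR_le_quadratic (R : realType) (x : R) :
  `|x| <= 1 -> expR x <= 1 + x + 2 * x ^+ 2.
Proof.
rewrite ler_norml => /andP[x1 x2].
have h1 : 0 < 1 - x / 2 by lra.
have h : 1 - x / 2 <= expR (- (x / 2)) by rewrite expR_ge1Dx.
have -> : expR x = (expR (- (x / 2)) ^+ 2)^-1.
  by rewrite -expRM_natl mulrN expRN invrK; congr expR; lra.
apply: (@le_trans _ _ ((1 - x / 2) ^+ 2)^-1).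
  by rewrite lef_pV2 ?posrE ?exprn_gt0 ?expR_gt0// lerXn2r ?nnegrE ?expR_ge0// ltW.
rewrite -[X in X <= _]mul1r ler_pdivrMr ?exprn_gt0//.
rewrite -subr_ge0.
have -> : (1 + x + 2 * x ^+ 2) * (1 - x / 2) ^+ 2 - 1 =
  x ^+ 2 * ((1 - x) * (5 / 4 - x / 2)) by field.
by rewrite mulr_ge0 ?sqr_ge0// mulr_ge0; lra.
Qed.

(** For [z >= 0], raise [z / (2 m) <= expR (z / (2 m))] to the power [2 m]; evenness covers negative
    [y]. The constant is crude but depends on [m] alone. *)
Lemma even_pow_le_expR (R : realType) (m : nat) (y : R) : (0 < m)%N ->
  y ^+ (2 * m) <= (2 * m)%:R ^+ (2 * m) * (expR y + expR (- y)).
Proof.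
move=> m0.
have key (z : R) : 0 <= z -> z ^+ (2 * m) <= (2 * m)%:R ^+ (2 * m) * expR z.
  move=> z0; have m20 : (0 : R) < (2 * m)%:R by rewrite ltr0n muln_gt0.
  have -> : expR z = expR (z / (2 * m)%:R) ^+ (2 * m).
    by rewrite -expRM_natl mulrCA divff ?mulr1// gt_eqF.
  rewrite -exprMn lerXn2r ?nnegrE ?mulr_ge0 ?expR_ge0//.
  rewrite mulrC -ler_pdivrMr//.
  by apply: le_trans (expR_ge1Dx _); lra.
case: (leP 0 y) => y0.
  by apply: le_trans (key y y0) _; rewrite ler_wpM2l ?exprn_ge0// lerDl expR_ge0.
have := key (- y); rewrite oppr_ge0 exprM sqrrN -exprM.
move=> /(_ (ltW y0)) /le_trans; apply.
by rewrite ler_wpM2l ?exprn_ge0// lerDr expR_ge0.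
Qed.

Section finite_measure_bounded.
Context d (T : measurableType d) (R : realType).
Variable mu : {finite_measure set T -> \bar R}.

Lemma bounded_integrable (f : T -> R) (M : R) :
  measurable_fun setT f -> (forall x, `|f x| <= M) ->
  mu.-integrable setT (EFin \o f).
Proof.
move=> mf fM; apply: measurable_bounded_integrable => //.
  by rewrite -ge0_fin_numE// fin_num_measure.
exists M; split; first by rewrite num_real.
by move=> x Mx y _ /=; apply: le_trans (fM y) (ltW Mx).
Qed.

End finite_measure_bounded.

Lemma Rintegral_cst_probability d (T : measurableType d) (R : realType)
  (P : probability T R) (r : R) : \int[P]_x r = r.
Proof.
rewrite Rintegral_cst//; transitivity (r * 1); last by rewrite mulr1.
by congr *%R; exact: (congr1 fine (probability_setT P)).
Qed.

(** * Deviations of empirical means *)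

Section iid_moments.
Context (R : realType) (dT dE : measure_display) (T : measurableType dT)
  (E : measurableType dE).
Variables (PP : probability T R) (P : probability E R).
Variable X : nat -> {RV PP >-> E}.
Hypothesis X_iid : iid_sample X P.

Lemma integral_prod_indic_iid (n : nat) (A : nat -> set E) :
  (forall i, measurable (A i)) ->
  (\int[PP]_t (\prod_(0 <= i < n) \1_(A i) (X i t))%:E)%E =
  (\prod_(0 <= i < n) fine (P (A i)))%:E.
Proof.
move=> mA; pose J := [fset i in iota 0 n]%fset.
have pJ : perm_eq (enum_fset J) (iota 0 n).
  apply: uniq_perm; [exact: fset_uniq|exact: iota_uniq|].
  by move=> i; rewrite in_fset.
have mXA i : measurable (X i @^-1` A i).
  by rewrite -[_ @^-1` _]setTI; apply: measurable_funP.
pose S := \bigcap_(i in [set` J]) (X i @^-1` A i).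
have mS : measurable S by apply: fin_bigcap_measurable.
have -> : (\int[PP]_t (\prod_(0 <= i < n) \1_(A i) (X i t))%:E)%E =
    (\int[PP]_t (\1_S t)%:E)%E.
  apply: eq_integral => t _; congr EFin.
  have [St|nSt] := pselect (S t).
    rewrite indicE mem_set// big_seq big1// => i.
    rewrite mem_index_iota => /andP[_ iltn].
    rewrite indicE mem_set//; apply: (St i).
    by rewrite /= in_fset/= mem_iota add0n.
  rewrite indicE memNset//.
  have /existsNP[i /not_implyP[iJ nA]] : ~ forall i, [set` J] i -> (X i @^-1` A i) t.
    by move=> h; apply: nSt.
  apply/eqP; rewrite prodf_seq_eq0; apply/hasP; exists i.
    by move: iJ; rewrite /= in_fset/= /index_iota subn0.
  by rewrite /= indicE memNset.
rewrite integral_indic// setIT; transitivity (PP S) => //; rewrite [LHS](X_iid.2 J A mA) (perm_big _ pJ)/=.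
rewrite -prodEFin /index_iota subn0; apply: eq_bigr => i _.
by rewrite -(X_iid.1 i _ (mA i)) fineK// fin_num_measure.
Qed.

(** The factors [h (X i t)] enter one at a time: [gen] treats hybrid products whose first [j]
    factors are [h] and whose others are indicators of arbitrary sets, a form stable under the
    induction. *)
Lemma integral_prod_iid (h : E -> R) (m : R) (n : nat) :
  (forall x, 0 <= h x) -> measurable_fun setT h ->
  (\int[P]_x (h x)%:E)%E = m%:E ->
  (\int[PP]_t (\prod_(0 <= i < n) h (X i t))%:E)%E = (m ^+ n)%:E.
Proof.
move=> h0 mh hm.
have m0 : 0 <= m by rewrite -lee_fin -hm integral_ge0// => x _; rewrite lee_fin.
have gen j : (j <= n)%N -> forall A : nat -> set E, (forall i, measurable (A i)) ->
  (\int[PP]_t ((\prod_(0 <= i < j) h (X i t)) *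
      \prod_(j <= i < n) \1_(A i) (X i t))%:E)%E =
  (m ^+ j * \prod_(j <= i < n) fine (P (A i)))%:E.
  elim: j => [_|j IH jn] A mA.
    rewrite expr0 mul1r -integral_prod_indic_iid//.
    by apply: eq_integral => t _; rewrite big_geq// mul1r.
  have mXi i : measurable_fun setT (X i) by apply: measurable_funP.
  pose W t := (\prod_(0 <= i < j) h (X i t)) *
      \prod_(j.+1 <= i < n) \1_(A i) (X i t).
  have W0 t : 0 <= W t by rewrite mulr_ge0// prodr_ge0.
  have mW : measurable_fun setT W.
    apply: measurable_funM; apply: measurable_prod => i _.
      exact: measurableT_comp.
    by apply: measurableT_comp => //; exact: measurable_indic.
  transitivity (\int[PP]_t ((W t)%:E * (h (X j t))%:E))%E.
    apply: eq_integral => t _; rewrite -EFinM; congr EFin.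
    by rewrite big_nat_recr//= /W; ring.
  rewrite (@ge0_integral_weighted_comp _ _ _ _ _ PP P W (X j)
    (m ^+ j * \prod_(j.+1 <= i < n) fine (P (A i))) (fun x => (h x)%:E))//.
  - by rewrite hm -EFinM exprS; congr EFin; ring.
  - by rewrite mulr_ge0 ?exprn_ge0// prodr_ge0// => i _; rewrite fine_ge0.
  (* The induction hypothesis for the family with [B] at place [j] is exactly the law of [X j]
     weighted by [W]. *)
  - move=> B mB; pose A' i := if i == j then B else A i.
    have mA' i : measurable (A' i) by rewrite /A'; case: ifP.
    have := IH (ltnW jn) A' mA'.
    rewrite big_ltn// /A' eqxx => IHB.
    have fB : P B \is a fin_num by exact: fin_num_measure.
    apply: (@eq_trans _ _ ((m ^+ j * \prod_(j.+1 <= i < n) fine (P (A i)))%:E *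
      (fine (P B))%:E)%E); last by congr (_ * _)%E; exact: fineK.
    rewrite -EFinM.
    transitivity (m ^+ j *
       (fine (P B) * \prod_(j.+1 <= i < n) fine (P (A' i))))%:E; last first.
      congr EFin; rewrite -mulrA; congr *%R; rewrite mulrC; congr *%R.
      apply: eq_big_nat => i /andP[ji _].
      by rewrite /A' gtn_eqF.
    rewrite -IHB; apply: eq_integral => t _; congr EFin.
    rewrite /W (big_ltn jn) eqxx -!mulrA; congr *%R; rewrite mulrC; congr *%R.
    by apply: eq_big_nat => i /andP[ji _]; rewrite gtn_eqF.
  - exact/measurable_EFinP.
have := gen n (leqnn n) (fun=> setT) (fun=> measurableT).
rewrite (big_geq (leqnn n)) mulr1 => <-.
by apply: eq_integral => t _; rewrite (big_geq (leqnn n)) mulr1.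
Qed.

Definition empirical_deviation (n : nat) (f : E -> R) (t : T) : R :=
  n%:R^-1 * (\sum_(i < n) f (X i t)) - \int[P]_x f x.

Lemma measurable_empirical_deviation (n : nat) (f : E -> R) :
  measurable_fun setT f -> measurable_fun setT (empirical_deviation n f).
Proof.
move=> mf; apply: measurable_funB => //; apply: measurable_funM => //.
by apply: measurable_sum => i; apply: measurableT_comp.
Qed.

(** For such [s] the centred variable [s * (f - E f)] has modulus at most [1 / sqrt n]; by the
    quadratic bound its exponential has mean at most [1 + 2 / n], and the [n]-th power of that stays
    below [expR 2]. *)
Lemma mgf_empirical_deviation (n : nat) (f : E -> R) (B s : R) :
  (0 < n)%N -> 0 < B -> measurable_fun setT f -> (forall x, `|f x| <= B) ->
  `|s| <= (2 * B * Num.sqrt n%:R)^-1 ->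
  (\int[PP]_t (expR (s * n%:R * empirical_deviation n f t))%:E <= (expR 2)%:E)%E.
Proof.
move=> n0 B0 mf fB sB.
have n0' : (0 : R) < n%:R by rewrite ltr0n.
have intf : P.-integrable setT (EFin \o f) by apply: bounded_integrable fB.
pose m0 := \int[P]_x f x.
have m0B : `|m0| <= B.
  apply: le_trans (le_normr_Rintegral _ intf) _ => //.
  have -> : B = \int[P]_x B by rewrite Rintegral_cst_probability.
  apply: le_Rintegral => //.
  - exact: integrable_norm.
  - by apply: (@bounded_integrable _ _ _ _ _ `|B|).
pose g x := s * (f x - m0).
have gB x : `|g x| <= (Num.sqrt n%:R)^-1.
  rewrite normrM; apply: (@le_trans _ _ ((2 * B * Num.sqrt n%:R)^-1 * (2 * B))).
    apply: ler_pM => //; apply: le_trans (ler_normB _ _) _.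
    by have := fB x; lra.
  have -> // : (2 * B * Num.sqrt n%:R)^-1 * (2 * B) = (Num.sqrt n%:R)^-1.
  by field; rewrite gt_eqF ?sqrtr_gt0//= gt_eqF.
have g1 x : `|g x| <= 1.
  apply: le_trans (gB x) _; rewrite invf_le1 ?sqrtr_gt0//.
  by rewrite -[leLHS]sqrtr1 ler_wsqrtr// ler1n.
have g2 x : (g x) ^+ 2 <= n%:R^-1.
  rewrite -real_normK ?num_real//.
  apply: (@le_trans _ _ ((Num.sqrt n%:R)^-1 ^+ 2)).
    by rewrite lerXn2r ?nnegrE// invr_ge0 sqrtr_ge0.
  by rewrite exprVn sqr_sqrtr.
have mg : measurable_fun setT g.
  by apply: measurable_funM => //; apply: measurable_funB.
have intg : P.-integrable setT (EFin \o g) by apply: bounded_integrable g1.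
have meg : measurable_fun setT (fun x => expR (g x)).
  exact: measurableT_comp.
have integ : P.-integrable setT (EFin \o (fun x => expR (g x))).
  apply: (@bounded_integrable _ _ _ _ _ (expR 1)) => // x.
  by rewrite ger0_norm ?expR_ge0// ler_expR; have := g1 x; rewrite ler_norml => /andP[].
pose m := \int[P]_x expR (g x).
have hm : (\int[P]_x (expR (g x))%:E)%E = m%:E.
  by rewrite /m /Rintegral fineK//; apply: integrable_fin_num.
have m_le : m <= 1 + 2 / n%:R.
  have int1 : P.-integrable setT (EFin \o cst (1 + 2 / n%:R : R)).
    exact: finite_measure_integrable_cst.
  apply: (@le_trans _ _ (\int[P]_x ((1 + 2 / n%:R) + g x))).
    apply: le_Rintegral => //.
    - exact: (integrableD _ int1 intg).
    - move=> x _; apply: le_trans (expR_le_quadratic (g1 x)) _.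
      have := g2 x; lra.
  rewrite RintegralD// Rintegral_cst_probability.
  rewrite (_ : \int[P]_x g x = 0) ?addr0//.
  have intm0 : P.-integrable setT (EFin \o cst m0).
    exact: finite_measure_integrable_cst.
  rewrite RintegralZl//; last exact: (integrableB _ intf intm0).
  by rewrite RintegralB// Rintegral_cst_probability subrr mulr0.
have m_ge0 : 0 <= m by apply: Rintegral_ge0 => x _; rewrite expR_ge0.
have -> : (\int[PP]_t (expR (s * n%:R * empirical_deviation n f t))%:E)%E =
    (\int[PP]_t (\prod_(0 <= i < n) expR (g (X i t)))%:E)%E.
  apply: eq_integral => t _; congr EFin.
  rewrite -expR_sum big_mkord; congr expR.
  rewrite /empirical_deviation -/m0 /g -mulr_sumr sumrB sumr_const card_ord.
  by rewrite -mulr_natl; field; rewrite gt_eqF.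
rewrite (integral_prod_iid _ _ meg hm)//.
rewrite lee_fin; apply: (@le_trans _ _ (expR (2 / n%:R) ^+ n)).
  rewrite lerXn2r ?nnegrE ?expR_ge0//.
  exact: le_trans m_le (expR_ge1Dx _).
by rewrite -expRM_natl ler_expR mulrCA divff ?mulr1// gt_eqF.
Qed.

(** The even power is dominated by the exponentials at [s = 1 / (2 B sqrt n)] and at its opposite,
    the extreme values allowed. The factor [B ^ (2 m)] is what makes chaining converge: it is small
    for differences of nearby functions. *)
Lemma moment_empirical_deviation (m n : nat) (f : E -> R) (B : R) :
  (0 < m)%N -> (0 < n)%N -> 0 < B ->
  measurable_fun setT f -> (forall x, `|f x| <= B) ->
  (\int[PP]_t ((empirical_deviation n f t) ^+ (2 * m))%:E <=
   ((2 * (2 * m)%:R ^+ (2 * m) * expR 2) * (4 * B ^+ 2 / n%:R) ^+ m)%:E)%E.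
Proof.
move=> m0 n0 B0 mf fB.
have n0' : (0 : R) < n%:R by rewrite ltr0n.
have sn0 : 0 < Num.sqrt n%:R :> R by rewrite sqrtr_gt0.
pose s := (2 * B * Num.sqrt n%:R)^-1.
have s0 : 0 < s by rewrite invr_gt0 !mulr_gt0.
have mD := measurable_empirical_deviation n mf.
pose c := (4 * B ^+ 2 / n%:R) ^+ m * (2 * m)%:R ^+ (2 * m).
have c0 : 0 <= c by rewrite mulr_ge0 ?exprn_ge0// divr_ge0 ?mulr_ge0 ?sqr_ge0// ltW.
have bnd (t : T) : empirical_deviation n f t ^+ (2 * m) <=
    c * (expR (s * n%:R * empirical_deviation n f t) +
         expR (- s * n%:R * empirical_deviation n f t)).
  have key := even_pow_le_expR (s * n%:R * empirical_deviation n f t) m0.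
  have -> : empirical_deviation n f t ^+ (2 * m) = (4 * B ^+ 2 / n%:R) ^+ m *
      (s * n%:R * empirical_deviation n f t) ^+ (2 * m).
    rewrite exprM [in RHS]exprM -exprMn; congr (_ ^+ m).
    rewrite 2!exprMn /s exprVn !exprMn sqr_sqrtr//.
    by field; rewrite !gt_eqF.
  rewrite !mulNr /c -[leRHS]mulrA ler_wpM2l// exprn_ge0//.
  by rewrite divr_ge0 ?mulr_ge0 ?sqr_ge0// ltW.
have mexp u : measurable_fun setT
    (fun t => (expR (u * n%:R * empirical_deviation n f t))%:E).
  apply/measurable_EFinP; apply: measurableT_comp => //.
  exact: measurable_funM.
apply: (@le_trans _ _ (\int[PP]_t (c%:E *
   ((expR (s * n%:R * empirical_deviation n f t))%:E +
    (expR (- s * n%:R * empirical_deviation n f t))%:E)))%E).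
  apply: ge0_le_integral => //.
  - by move=> t _; rewrite lee_fin exprM exprn_ge0// sqr_ge0.
  - by apply/measurable_EFinP; apply: measurable_funX.
  - by apply: measurable_funeM; apply: emeasurable_funD.
  - by move=> t _; rewrite -EFinD -EFinM lee_fin.
rewrite ge0_integralZl//; last 2 first.
- exact: emeasurable_funD.
- by move=> t _; rewrite adde_ge0// lee_fin expR_ge0.
rewrite ge0_integralD//.
apply: (@le_trans _ _ (c%:E * ((expR 2)%:E + (expR 2)%:E))%E).
  by rewrite lee_wpmul2l// leeD// (mgf_empirical_deviation (B := B))// ?normrN ger0_norm// ltW.
by rewrite -EFinD -EFinM lee_fin /c le_eqVlt; apply/orP; left; apply/eqP; ring.
Qed.

End iid_moments.

(** * Dyadic chaining over a parameter box *)

Section chaining.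
Context (R : realType) (J : finType) (A : nat).

Definition grid_point (l : nat) (v : J -> nat) : J -> R :=
  fun j => (v j)%:R / 2 ^+ l - A%:R.

Definition grid_size (l : nat) : nat := (2 * A * 2 ^ l).+1.

(** The bit [e j] selects the half of the dyadic interval. The result is a plain [nat]: a child of
    the last grid point may leave the box, so it need not index a point of the next grid. *)
Definition refine (l : nat) (u : {ffun J -> 'I_(grid_size l)})
    (e : {ffun J -> bool}) : J -> nat := fun j => (2 * u j + e j)%N.

(** The point [x] is approached by its truncated dyadic expansions. The coarse grid contributes 1
    and the steps contribute the sum 4 of the powers of 3/4, whence 5; the Lipschitz bound removes
    the last truncation. A ratio above 1/2 leaves room for the growth of the grids. *)
Lemma chaining (Z : (J -> R) -> R) (a Lam : R) :
  (forall x y dl, (forall j, `|x j - y j| <= dl) -> `|Z x - Z y| <= Lam * dl) ->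
  0 <= a ->
  (forall u : {ffun J -> 'I_(grid_size 0)}, `|Z (grid_point 0 (fun j => u j))| <= a) ->
  (forall l (u : {ffun J -> 'I_(grid_size l)}) (e : {ffun J -> bool}),
     `|Z (grid_point l.+1 (refine u e)) - Z (grid_point l (fun j => u j))|
       <= (3 / 4) ^+ l * a) ->
  forall x, (forall j, `|x j| <= A%:R) -> `|Z x| <= 5 * a.
Proof.
move=> ZL a0 H0 HS x xA.
pose v l j := Num.truncn (2 ^+ l * (x j + A%:R)).
have xA0 j : 0 <= x j + A%:R by have := xA j; rewrite ler_norml; lra.
have xA2 j : x j + A%:R <= (2 * A)%:R.
  by have := xA j; rewrite ler_norml natrM; lra.
have p0 l : (0 : R) < 2 ^+ l by rewrite exprn_gt0.
have vP l j : (v l j)%:R <= 2 ^+ l * (x j + A%:R) < (v l j).+1%:R.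
  by apply: truncn_itv; rewrite mulr_ge0// ltW.
have v_lt l j : (v l j < grid_size l)%N.
  rewrite ltnS -(ler_nat R); have /andP[h _] := vP l j.
  apply: le_trans h _; rewrite natrM natrX mulrC ler_wpM2r//; exact: ltW.
pose u l : {ffun J -> 'I_(grid_size l)} := [ffun j => Ordinal (v_lt l j)].
have v_split l j : (v l.+1 j == 2 * v l j)%N || (v l.+1 j == (2 * v l j).+1)%N.
  have /andP[h1 h2] := vP l j; have /andP[h3 h4] := vP l.+1 j.
  rewrite exprS -mulrA in h3 h4.
  have h5 : (2 * v l j < (v l.+1 j).+1)%N.
    by rewrite -(ltr_nat R) natrM; lra.
  have h6 : (v l.+1 j < 2 * (v l j).+1)%N.
    by rewrite -(ltr_nat R) natrM; lra.
  lia.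
pose e l : {ffun J -> bool} := [ffun j => v l.+1 j != (2 * v l j)%N].
have uE l : (fun j => u l j : nat) = v l by apply/funext => j; rewrite ffunE.
have reE l : refine (u l) (e l) = v l.+1.
  apply/funext => j; rewrite /refine !ffunE /=.
  by case/orP: (v_split l j) => /eqP ->; [rewrite eqxx|
     rewrite (_ : _ != _ = true)]; lia.
have dist l j : `|x j - grid_point l (v l) j| <= 2 ^- l.
  have /andP[h1 h2] := vP l j; rewrite -natr1 in h2.
  have -> : x j - grid_point l (v l) j =
     (2 ^+ l * (x j + A%:R) - (v l j)%:R) / 2 ^+ l.
    by rewrite /grid_point; field; rewrite gt_eqF.
  rewrite ger0_norm; last by rewrite divr_ge0 ?(ltW (p0 l)) ?subr_ge0.
  by rewrite -[leRHS]mul1r ler_wpM2r ?invr_ge0 ?(ltW (p0 l))//; lra.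
(* The factor is the partial sum [1 + \sum_(i < l) (3/4)^i]. *)
have bnd l : `|Z (grid_point l (v l))| <= a * (5 - 4 * (3 / 4) ^+ l).
  elim: l => [|l IH].
    by rewrite expr0 -uE; apply: le_trans (H0 _) _; lra.
  have := HS l (u l) (e l); rewrite uE reE => h.
  have -> : Z (grid_point l.+1 (v l.+1)) = Z (grid_point l (v l)) +
    (Z (grid_point l.+1 (v l.+1)) - Z (grid_point l (v l))) by lra.
  apply: le_trans (ler_normD _ _) _; apply: le_trans (lerD IH h) _.
  by rewrite exprS; lra.
have bnd5 l : `|Z x| <= 5 * a + Lam * 2 ^- l.
  have -> : Z x = Z (grid_point l (v l)) + (Z x - Z (grid_point l (v l))) by lra.
  apply: le_trans (ler_normD _ _) _; apply: lerD; last exact: ZL.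
  apply: le_trans (bnd l) _.
  have : 0 <= a * (3 / 4) ^+ l by rewrite mulr_ge0// exprn_ge0//; lra.
  lra.
apply/ler_addgt0Pr => eps eps0.
have [L0|L0] := eqVneq Lam 0; first by have := bnd5 0%N; rewrite L0 mul0r addr0; lra.
have [L0p|L1] := ltP 0 Lam; last by have := bnd5 0%N; rewrite expr0 invr1; lra.
have [N hN] : exists N : nat, Lam / eps < N%:R.
  have h0 : 0 <= Lam / eps by rewrite divr_ge0// ltW.
  by exists (Num.truncn (Lam / eps)).+1; have /andP[] := truncn_itv h0.
apply: le_trans (bnd5 N) _; rewrite lerD2l.
rewrite ler_pdivrMr//; rewrite ltr_pdivrMr// mulrC in hN.
apply: le_trans (ltW hN) _; rewrite ler_wpM2l// ?(ltW eps0)//.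
by rewrite -natrX ler_nat ltnW// ltn_expl.
Qed.

End chaining.

Lemma normr_le_even_pow (R : realType) (m : nat) (x a : R) :
  (0 < m)%N -> 0 <= a -> x ^+ (2 * m) <= a ^+ (2 * m) -> `|x| <= a.
Proof.
move=> m0 a0; rewrite -[x ^+ _]ger0_norm; last by rewrite exprM exprn_ge0// sqr_ge0.
by rewrite normrX ler_pXn2r ?nnegrE// muln_gt0.
Qed.

Section empirical_deviation_linear.
Context (R : realType) (dT dE : measure_display) (T : measurableType dT)
  (E : measurableType dE).
Variables (PP : probability T R) (P : probability E R).
Variable X : nat -> {RV PP >-> E}.

Lemma Rintegral_le_bound (f : E -> R) (B : R) : measurable_fun setT f ->
  (forall x, `|f x| <= B) -> `|\int[P]_x f x| <= B.
Proof.
move=> mf fB; have intf := @bounded_integrable _ _ _ P _ _ mf fB.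
apply: le_trans (le_normr_Rintegral _ intf) _ => //.
rewrite -[leRHS](Rintegral_cst_probability P).
apply: le_Rintegral => //; first exact: integrable_norm.
by apply: (@bounded_integrable _ _ _ _ _ `|B|).
Qed.

Lemma empirical_deviation_le (n : nat) (f : E -> R) (B : R) (t : T) :
  (0 < n)%N -> measurable_fun setT f -> (forall x, `|f x| <= B) ->
  `|empirical_deviation P X n f t| <= 2 * B.
Proof.
move=> n0 mf fB; rewrite mulr_natl mulr2n.
apply: le_trans (ler_normB _ _) (lerD _ (Rintegral_le_bound mf fB)).
rewrite normrM ger0_norm ?invr_ge0// ler_pdivrMl ?ltr0n//.
apply: le_trans (ler_norm_sum _ _ _) _.
apply: le_trans (_ : \sum_(i < n) B <= _); first exact: ler_sum.
by rewrite sumr_const card_ord mulr_natl.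
Qed.

Lemma empirical_deviationB (n : nat) (f g : E -> R) (B : R) (t : T) :
  measurable_fun setT f -> (forall x, `|f x| <= B) ->
  measurable_fun setT g -> (forall x, `|g x| <= B) ->
  empirical_deviation P X n f t - empirical_deviation P X n g t =
  empirical_deviation P X n (fun x => f x - g x) t.
Proof.
move=> mf fB mg gB; rewrite /empirical_deviation RintegralB//.
- by rewrite sumrB; ring.
- exact: bounded_integrable fB.
- exact: bounded_integrable gB.
Qed.

End empirical_deviation_linear.

Section chaining_functional.
Context (R : realType) (dT dE : measure_display) (T : measurableType dT)
  (E : measurableType dE).
Variables (PP : probability T R) (P : probability E R).
Variable X : nat -> {RV PP >-> E}.
Hypothesis X_iid : iid_sample X P.
Variables (J : finType) (psi : (J -> R) -> E -> R) (L : R) (m : nat).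
Hypothesis L_gt0 : 0 < L.
Hypothesis m_psi : forall x, measurable_fun setT (psi x).
Hypothesis psi_le1 : forall x y, `|psi x y| <= 1.
Hypothesis psi_lip : forall x x' (dl : R) y,
  (forall j, `|x j - x' j| <= dl) -> `|psi x y - psi x' y| <= L * dl.
Hypothesis card_lt : (#|J| < m)%N.

Let Z n t x := empirical_deviation P X n (psi x) t.
Let K : R := 2 * (2 * m)%:R ^+ (2 * m) * expR 2.
Let D := #|J|.

Let m_gt0 : (0 < m)%N. Proof. exact: leq_ltn_trans card_lt. Qed.

Let mDl x x' : measurable_fun setT (fun y => psi x y - psi x' y).
Proof. exact: measurable_funB. Qed.

Let mZ n x : measurable_fun setT ((Z n)^~ x).
Proof. exact: measurable_empirical_deviation. Qed.

Let ZB n t x x' :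
  Z n t x - Z n t x' = empirical_deviation P X n (fun y => psi x y - psi x' y) t.
Proof. exact: (@empirical_deviationB _ _ _ _ _ _ _ _ _ _ _ 1). Qed.

Let coarse (A n : nat) (t : T) : R :=
  \sum_(u : {ffun J -> 'I_(grid_size A 0)})
    Z n t (grid_point R A 0 (fun j => u j)) ^+ (2 * m).

(** The weight encodes the tolerance of the level: if the level is at most [a ^ (2 m)], each of its
    increments is at most [(3/4)^l * a]. *)
Let fine_level (A n l : nat) (t : T) : R :=
  (4 / 3) ^+ (2 * m * l) *
  \sum_(u : {ffun J -> 'I_(grid_size A l)}) \sum_(e : {ffun J -> bool})
    (Z n t (grid_point R A l.+1 (refine u e)) -
     Z n t (grid_point R A l (fun j => u j))) ^+ (2 * m).

(** A single measurable variable that dominates all grid values and increments at once. It may be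
    infinite, hence the extended real values. *)
Definition chaining_functional (A n : nat) (t : T) : \bar R :=
  ((coarse A n t)%:E + \sum_(0 <= l <oo) (fine_level A n l t)%:E)%E.

Let r43 k : 0 <= (4 / 3 : R) ^+ k.
Proof. by rewrite exprn_ge0// divr_ge0. Qed.

Let even_ge0 (x : R) : 0 <= x ^+ (2 * m).
Proof. by rewrite exprM exprn_ge0// sqr_ge0. Qed.

Let coarse_ge0 A n t : 0 <= coarse A n t.
Proof. exact: sumr_ge0. Qed.

Let fine_level_ge0 A n l t : 0 <= fine_level A n l t.
Proof.
rewrite mulr_ge0 ?r43//.
by apply: sumr_ge0 => u _; apply: sumr_ge0.
Qed.

Let mcoarse A n : measurable_fun setT (coarse A n).
Proof. by apply: measurable_sum => u; apply: measurable_funX. Qed.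

Let mfine A n l : measurable_fun setT (fine_level A n l).
Proof.
apply: measurable_funM => //; apply: measurable_sum => u.
by apply: measurable_sum => e; apply: measurable_funX; apply: measurable_funB.
Qed.

Lemma chaining_functional_ge0 A n t : (0 <= chaining_functional A n t)%E.
Proof.
by rewrite adde_ge0 ?lee_fin// nneseries_ge0// => l _ _; rewrite lee_fin.
Qed.

Lemma measurable_chaining_functional A n :
  measurable_fun setT (chaining_functional A n).
Proof.
apply: emeasurable_funD; first exact/measurable_EFinP.
apply: ge0_emeasurable_sum => [l t _ _|l _]; first by rewrite lee_fin.
exact/measurable_EFinP.
Qed.

(** A sum of nonnegative even powers bounds each of its terms, so the hypotheses of [chaining]
    follow by taking roots, separately at each [t]. The Lipschitz constant [2 * L] arises because a
    function bounded by [B] deviates by at most [2 * B]. *)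
Lemma deviation_le_chaining (A n : nat) (t : T) (a : R) : (0 < n)%N ->
  0 <= a -> (chaining_functional A n t <= (a ^+ (2 * m))%:E)%E ->
  forall x, (forall j, `|x j| <= A%:R) -> `|Z n t x| <= 5 * a.
Proof.
move=> n0 a0 Ga; apply: (@chaining _ _ _ (Z n t) a (2 * L)) => //.
- move=> x y dl xy; rewrite ZB -mulrA.
  by apply: empirical_deviation_le => // z; apply: psi_lip.
- move=> u; apply: (normr_le_even_pow m_gt0 a0).
  rewrite -lee_fin; apply: le_trans Ga.
  apply: (@le_trans _ _ (coarse A n t)%:E).
    rewrite lee_fin /coarse (bigD1 u)//= lerDl; exact: sumr_ge0.
  by rewrite leeDl// nneseries_ge0// => l _ _; rewrite lee_fin.
- move=> l u e; apply: (normr_le_even_pow m_gt0).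
    by rewrite mulr_ge0// exprn_ge0//; lra.
  have h : fine_level A n l t <= a ^+ (2 * m).
    rewrite -lee_fin; apply: le_trans Ga.
    apply: (@le_trans _ _ (\sum_(0 <= l <oo) (fine_level A n l t)%:E)%E).
      rewrite (@nneseriesD1 _ _ l)//; last by move=> i _; rewrite lee_fin.
      by rewrite leeDl// nneseries_ge0// => i _ _; rewrite lee_fin.
    by rewrite leeDr// lee_fin.
  have -> : ((3 / 4) ^+ l * a) ^+ (2 * m) =
      ((4 / 3) ^+ (2 * m * l))^-1 * a ^+ (2 * m) :> R.
    rewrite exprMn -exprM mulnC -exprVn; congr (_ ^+ _ * _); by field.
  rewrite ler_pdivlMl ?exprn_gt0 ?divr_gt0//.
  apply: le_trans h; rewrite /fine_level ler_wpM2l ?r43//.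
  rewrite (bigD1 u)//= (bigD1 e)//= -[leRHS]addrA lerDl addr_ge0//; first exact: sumr_ge0.
  by apply: sumr_ge0 => u' _; apply: sumr_ge0.
Qed.

Let grid_le A l : (0 < A)%N ->
  (#|{ffun J -> 'I_(grid_size A l)}|%:R : R) <= (3 * A%:R * 2 ^+ l) ^+ D.
Proof.
move=> A0; rewrite card_ffun card_ord natrX lerXn2r ?nnegrE ?mulr_ge0 ?exprn_ge0//.
rewrite -natrX -!natrM ler_nat /grid_size.
have : (0 < 2 ^ l)%N by rewrite expn_gt0.
nia.
Qed.

(** Level [l] has at most [(6 A 2^l)^D] steps, each with moment of order [(L^2 / (4^l n))^m]; with
    the weight [(16/9)^(m l)] it contributes a multiple of [(2^D (4/9)^m)^l]. Since [4/9 <= 1/2] and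
    [D < m], this is at most [2^(-l)], and the levels add up to a factor 2. *)
Lemma integral_chaining_functional (A n : nat) : (0 < A)%N -> (0 < n)%N ->
  (\int[PP]_t chaining_functional A n t <=
   ((K * 4 ^+ m * (3 ^+ D + 2 * 6 ^+ D * L ^+ (2 * m))) *
     A%:R ^+ D / n%:R ^+ m)%:E)%E.
Proof.
move=> A0 n0.
have n0' : (0 : R) < n%:R by rewrite ltr0n.
have K0 : 0 <= K by rewrite /K mulr_ge0 ?expR_ge0// mulr_ge0// exprn_ge0.
have hcoarse : (\int[PP]_t (coarse A n t)%:E <=
    (K * 4 ^+ m * 3 ^+ D * A%:R ^+ D / n%:R ^+ m)%:E)%E.
  under eq_integral do rewrite -sumEFin.
  rewrite ge0_integral_sum//; last 2 first.
  - by move=> u; apply/measurable_EFinP; apply: measurable_funX.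
  - by move=> u t _; rewrite lee_fin.
  apply: (@le_trans _ _ (\sum_(u : {ffun J -> 'I_(grid_size A 0)})
      (K * (4 * 1 ^+ 2 / n%:R) ^+ m)%:E)%E).
    by apply: lee_sum => u _; apply: moment_empirical_deviation.
  rewrite sumEFin lee_fin sumr_const -[leLHS]mulr_natl.
  have -> : K * 4 ^+ m * 3 ^+ D * A%:R ^+ D / n%:R ^+ m =
     (3 * A%:R * 2 ^+ 0) ^+ D * (K * (4 * 1 ^+ 2 / n%:R) ^+ m).
    rewrite expr0 mulr1 expr1n mulr1 !exprMn exprVn; ring.
  by rewrite ler_wpM2r ?grid_le// mulr_ge0// exprn_ge0//.
pose cst := K * 4 ^+ m * 6 ^+ D * L ^+ (2 * m) * A%:R ^+ D / n%:R ^+ m.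
have cst0 : 0 <= cst.
  by rewrite !mulr_ge0// ?exprn_ge0 ?invr_ge0 ?exprn_ge0//; exact: ltW.
have hfine l : (\int[PP]_t (fine_level A n l t)%:E <= (cst / 2 ^+ l)%:E)%E.
  have L2 : 0 < L / 2 ^+ l by rewrite divr_gt0// exprn_gt0.
  under eq_integral do rewrite EFinM -sumEFin.
  rewrite ge0_integralZl; [|exact: measurableT|..]; last 3 first.
  - apply: emeasurable_sum => u; apply/measurable_EFinP; apply: measurable_sum => e.
    by apply: measurable_funX; apply: measurable_funB.
  - by move=> t _; apply: sume_ge0 => u _; rewrite lee_fin sumr_ge0.
  - by rewrite lee_fin r43.
  rewrite ge0_integral_sum//; last 2 first.
  - move=> u; apply/measurable_EFinP; apply: measurable_sum => e.
    by apply: measurable_funX; apply: measurable_funB.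
  - by move=> u t _; rewrite lee_fin sumr_ge0.
  apply: (@le_trans _ _ (((4 / 3) ^+ (2 * m * l))%:E *
    \sum_(u : {ffun J -> 'I_(grid_size A l)})
      (2 ^+ D * (K * (4 * (L / 2 ^+ l) ^+ 2 / n%:R) ^+ m))%:E)%E).
    rewrite lee_wpmul2l ?lee_fin ?r43//.
    apply: lee_sum => u _.
    under eq_integral do rewrite -sumEFin.
    rewrite ge0_integral_sum//; last 2 first.
    - move=> e; apply/measurable_EFinP; apply: measurable_funX.
      exact: measurable_funB.
    - by move=> e t _; rewrite lee_fin.
    apply: (@le_trans _ _ (\sum_(e : {ffun J -> bool})
      (K * (4 * (L / 2 ^+ l) ^+ 2 / n%:R) ^+ m)%:E)%E).
      apply: lee_sum => e _; under eq_integral do rewrite ZB.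
      apply: moment_empirical_deviation => // y.
      apply: psi_lip => j; rewrite /grid_point /refine.
      have -> : (2 * u j + e j)%:R / 2 ^+ l.+1 - A%:R - ((u j)%:R / 2 ^+ l - A%:R) =
         (e j)%:R / 2 ^+ l.+1 :> R.
        by rewrite natrD natrM exprS; field; rewrite expf_neq0.
      rewrite ger0_norm ?divr_ge0 ?exprn_ge0//.
      rewrite ler_pdivrMr ?exprn_gt0// exprS mulrCA mulVf ?expf_neq0// mulr1.
      by rewrite ler_nat; case: (e j).
    rewrite sumEFin lee_fin sumr_const card_ffun card_bool -[leLHS]mulr_natl natrX.
    by [].
  rewrite sumEFin -EFinM lee_fin sumr_const -[X in _ * X <= _]mulr_natl.
  apply: (@le_trans _ _ ((4 / 3) ^+ (2 * m * l) * ((3 * A%:R * 2 ^+ l) ^+ D *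
    (2 ^+ D * (K * (4 * (L / 2 ^+ l) ^+ 2 / n%:R) ^+ m))))).
    rewrite ler_wpM2l ?r43//.
    rewrite ler_wpM2r ?grid_le// mulr_ge0 ?exprn_ge0// mulr_ge0// exprn_ge0//.
    by rewrite divr_ge0 ?(ltW n0')// mulr_ge0// exprn_ge0// ltW.
  have -> : (4 / 3) ^+ (2 * m * l) * ((3 * A%:R * 2 ^+ l) ^+ D *
    (2 ^+ D * (K * (4 * (L / 2 ^+ l) ^+ 2 / n%:R) ^+ m))) =
    cst * (2 ^+ D * (4 / 9) ^+ m) ^+ l.
    have e1 : (4 / 3) ^+ (2 * m * l) = ((4 / 9) ^+ m) ^+ l * ((2 ^+ l) ^+ 2) ^+ m :> R.
      have q1 : ((2 ^+ l) ^+ 2) ^+ m = 4 ^+ (m * l) :> R.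
        rewrite -!exprM (_ : (l * (2 * m) = 2 * (m * l))%N); last lia.
        by rewrite exprM; congr (_ ^+ _); ring.
      by rewrite q1 -exprM -exprMn -mulnA exprM; congr (_ ^+ _); field.
    have e2 : (2 ^+ l) ^+ D = (2 ^+ D) ^+ l :> R by rewrite exprAC.
    have e3 : (4 * (L / 2 ^+ l) ^+ 2 / n%:R) ^+ m =
        4 ^+ m * L ^+ (2 * m) / ((2 ^+ l) ^+ 2) ^+ m / n%:R ^+ m.
      by rewrite exprM -exprMn -!exprVn -!exprMn; congr (_ ^+ m); field;
        rewrite gt_eqF//= expf_neq0.
    have e4 : 6 ^+ D = 3 ^+ D * 2 ^+ D :> R by rewrite -exprMn; congr (_ ^+ D); ring.
    have t0 : ((2 ^+ l) ^+ 2) ^+ m != 0 :> R by rewrite !expf_neq0.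
    set t := _ ^+ m in t0 e1 e3.
    rewrite e3 e1 /cst e4 !exprMn e2.
    have n1 : n%:R ^+ m != 0 :> R by rewrite expf_neq0// gt_eqF.
    by field; rewrite n1.
  have p49 : 0 <= 4 / 9 :> R by lra.
  have p49' : 4 / 9 <= 2^-1 :> R by lra.
  rewrite ler_wpM2l// -exprVn lerXn2r ?nnegrE ?invr_ge0 ?mulr_ge0 ?exprn_ge0//.
  apply: (@le_trans _ _ (2 ^+ D * 2 ^- m)).
    by rewrite ler_wpM2l ?exprn_ge0// -exprVn lerXn2r ?nnegrE ?invr_ge0.
  rewrite ler_pdivrMr ?exprn_gt0// ler_pdivlMl// -exprS -!natrX ler_nat.
  by rewrite leq_exp2l.
rewrite ge0_integralD//; last 4 first.
- by move=> t _; rewrite lee_fin.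
- exact/measurable_EFinP.
- by move=> t _; apply: nneseries_ge0 => l _ _; rewrite lee_fin.
- apply: ge0_emeasurable_sum => [l t _ _|l _]; first by rewrite lee_fin.
  exact/measurable_EFinP.
rewrite integral_nneseries//; last 2 first.
- by move=> l; apply/measurable_EFinP.
- by move=> l t _; rewrite lee_fin.
have -> : K * 4 ^+ m * (3 ^+ D + 2 * 6 ^+ D * L ^+ (2 * m)) * A%:R ^+ D / n%:R ^+ m =
   K * 4 ^+ m * 3 ^+ D * A%:R ^+ D / n%:R ^+ m + cst * 2 by rewrite /cst; ring.
rewrite EFinD leeD//.
apply: lime_le.
  by apply: is_cvg_nneseries => l _ _; apply: integral_ge0 => t _; rewrite lee_fin.
apply: nearW => N.
apply: (@le_trans _ _ (\sum_(0 <= l < N) (cst / 2 ^+ l)%:E)%E).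
  by apply: lee_sum => l _.
rewrite sumEFin lee_fin big_mkord -mulr_sumr ler_wpM2l//.
have -> : \sum_(i < N) (2 ^+ i)^-1 = 2 - 2 / 2 ^+ N :> R.
  elim: N => [|N IH]; first by rewrite big_ord0 expr0; lra.
  rewrite big_ord_recr/= IH exprS; field; rewrite expf_neq0//.
by rewrite gerBl divr_ge0// exprn_ge0.
Qed.

End chaining_functional.

(** * Neurons and the error of the estimator *)

Section logistic_facts.
Context {R : realType}.
Implicit Types x y : R.

Lemma logistic_gt0 x : 0 < logistic x.
Proof. by rewrite invr_gt0 ltr_pwDl// expR_ge0. Qed.

Lemma logistic_le1 x : logistic x <= 1.
Proof. by rewrite invf_le1 ?lerDl ?expR_ge0// ltr_pwDl// expR_ge0. Qed.

Lemma logistic0 : logistic (0 : R) = 2^-1.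
Proof. by rewrite /logistic oppr0 expR0. Qed.

Lemma logistic_lip x y : `|logistic x - logistic y| <= `|x - y|.
Proof.
wlog xy : x y / y <= x => [h|].
  by have [/h//|/ltW/h] := leP y x; rewrite distrC (distrC y).
have ex := expR_gt0 (- x); have ey := expR_gt0 (- y).
have exy : expR (- x) = expR (- y) * expR (- (x - y)).
  by rewrite -expRD; congr expR; ring.
have h : expR (- y) - expR (- x) <= expR (- y) * (x - y).
  have := expR_ge1Dx (- (x - y)); rewrite exy => h.
  rewrite -[X in X - _]mulr1 -mulrBr ler_wpM2l ?expR_ge0//; lra.
have le_xy : expR (- x) <= expR (- y) by rewrite ler_expR; lra.
have -> : logistic x - logistic y =
    (expR (- y) - expR (- x)) / ((1 + expR (- x)) * (1 + expR (- y))).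
  by rewrite /logistic; field; rewrite !gt_eqF ?addr_gt0.
rewrite !ger0_norm; [|lra|]; last first.
  by rewrite divr_ge0 ?mulr_ge0//; lra.
rewrite ler_pdivrMr ?mulr_gt0//; try lra.
apply: (le_trans h); rewrite mulrC ler_wpM2l//; first lra.
nra.
Qed.

End logistic_facts.

Section borel.
Context {R : realType} {d : nat}.

Lemma continuous_measurable_borelRd (f : 'rV[R]_d -> R) :
  continuous f -> measurable_fun setT (f : borelRd R d -> R).
Proof.
move=> /continuousP cf; apply: (measurability _ (RGenOpens.measurableE R)).
move=> _ [_ [a [b -> <-]]]; rewrite setTI; apply: sub_sigma_algebra.
exact/cf/interval_open.
Qed.

Lemma measurable_coord (j : 'I_d) :
  measurable_fun setT (fun x : borelRd R d => (x : 'rV[R]_d) 0 j).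
Proof.
apply: (@continuous_measurable_borelRd (fun x => x 0 j)).
exact: coord_continuous.
Qed.

Lemma measurable_unit_cube : measurable (unit_cube R d : set (borelRd R d)).
Proof.
have -> : (unit_cube R d : set (borelRd R d)) =
    \bigcap_(j in [set: 'I_d])
      ((fun x : borelRd R d => (x : 'rV[R]_d) 0 j) @^-1` `[0, 1]%classic).
  apply/seteqP; split => x /= h j => [_|]; rewrite ?in_itv/=; first exact: h.
  by have := h j I; rewrite /= in_itv.
apply: fin_bigcap_measurable => // j _.
rewrite -[X in measurable X]setTI; apply: measurable_coord => //.
Qed.

Lemma measurable_indic_cube :
  measurable_fun setT (\1_(unit_cube R d) : borelRd R d -> R).
Proof. by apply: measurable_indic; exact: measurable_unit_cube. Qed.

End borel.

Section neurons.
Context {R : realType} {d : nat}.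

(** Inner weights ([Some j]) and bias ([None]) are gathered in one family, so that a single
    parameter box can be chained over. *)
Definition neuron (v : option 'I_d -> R) (x : 'rV[R]_d) : R :=
  logistic (\sum_(j < d) v (Some j) * x 0 j + v None).

Lemma normr_neuron_le1 v x : `|neuron v x| <= 1.
Proof. by rewrite ger0_norm ?logistic_le1// ltW// logistic_gt0. Qed.

Lemma neuron_cst0 x : neuron (fun=> 0) x = 2^-1.
Proof.
by rewrite /neuron big1 ?addr0 ?logistic0// => j _; rewrite mul0r.
Qed.

Lemma measurable_logistic : measurable_fun setT (@logistic R).
Proof.
apply: nondecreasing_measurable => // x y xy.
rewrite lef_pV2 ?posrE ?ltr_pwDl ?expR_ge0//.
by rewrite lerD2l ler_expR lerN2.
Qed.

Lemma measurable_neuron v : measurable_fun setT (neuron v : borelRd R d -> R).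
Proof.
apply: (measurableT_comp measurable_logistic); apply: measurable_funD => //.
apply: measurable_sum => j; apply: measurable_funM => //; exact: measurable_coord.
Qed.

Lemma neuron_lip (v v' : option 'I_d -> R) (dl : R) (x : 'rV[R]_d) :
  unit_cube R d x -> (forall i, `|v i - v' i| <= dl) ->
  `|neuron v x - neuron v' x| <= d.+1%:R * dl.
Proof.
move=> Kx vv'; apply: le_trans (logistic_lip _ _) _.
rewrite opprD addrACA -sumrB -natr1 mulrDl mul1r.
apply: le_trans (ler_normD _ _) (lerD _ (vv' _)).
apply: le_trans (ler_norm_sum _ _ _) _.
apply: (@le_trans _ _ (\sum_(j < d) dl)); last by rewrite sumr_const card_ord mulr_natl.
apply: ler_sum => j _; rewrite -mulrBl normrM -[leRHS]mulr1 ler_pM//.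
by have /andP[? ?] := Kx j; rewrite ger0_norm.
Qed.

(* Both a network and its square are combinations of these products, the
   neuron with zero weights being the constant 1/2. *)
Definition neuron_pair (th : option 'I_d + option 'I_d -> R) (x : borelRd R d) : R :=
  \1_(unit_cube R d) x * (neuron (th \o inl) x * neuron (th \o inr) x).

Lemma measurable_neuron_pair th : measurable_fun setT (neuron_pair th).
Proof.
apply: measurable_funM; first exact: measurable_indic_cube.
by apply: measurable_funM; apply: measurable_neuron.
Qed.

Lemma neuron_pair_le1 th x : `|neuron_pair th x| <= 1.
Proof.
rewrite !normrM indicE; case: (_ \in _); rewrite ?normr0 ?mul0r// normr1 mul1r.
by rewrite -[leRHS]mulr1 ler_pM// normr_neuron_le1.
Qed.

Lemma neuron_pair_lip th th' (dl : R) x : (forall j, `|th j - th' j| <= dl) ->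
  `|neuron_pair th x - neuron_pair th' x| <= (2 * d.+1%:R) * dl.
Proof.
move=> h; have dl0 : 0 <= dl by apply: le_trans (h (inl None)).
rewrite /neuron_pair indicE; have [/set_mem Kx|_] := boolP (_ \in _); last first.
  by rewrite !mul0r subrr normr0 !mulr_ge0.
rewrite !mul1r; set a := neuron _ x; set b := neuron _ x.
set a' := neuron _ x; set b' := neuron _ x.
have ha : `|a - a'| <= d.+1%:R * dl by apply: neuron_lip => // i; apply: h.
have hb : `|b - b'| <= d.+1%:R * dl by apply: neuron_lip => // i; apply: h.
have -> : a * b - a' * b' = a * (b - b') + (a - a') * b' by ring.
apply: le_trans (ler_normD _ _) _; rewrite !normrM -mulrA mulr_natl mulr2n.
apply: lerD.
  rewrite -[leRHS]mul1r ler_pM//; exact: normr_neuron_le1.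
by rewrite -[leRHS]mulr1 ler_pM//; exact: normr_neuron_le1.
Qed.

End neurons.

Section finite_sums.
Context (R : realType) (dT dE : measure_display) (T : measurableType dT)
  (E : measurableType dE).
Variables (PP : probability T R) (P : probability E R).
Variable X : nat -> {RV PP >-> E}.

Lemma Rintegral_sum_bounded (I : Type) (s : seq I) (c : I -> R) (f : I -> E -> R)
    (B : R) : (forall i, measurable_fun setT (f i)) ->
  (forall i x, `|f i x| <= B) ->
  \int[P]_x (\sum_(i <- s) c i * f i x) = \sum_(i <- s) c i * \int[P]_x f i x.
Proof.
move=> mf fB; elim: s => [|i s IH].
  rewrite big_nil; under eq_Rintegral do rewrite big_nil.
  exact: Rintegral_cst_probability.
have intf j : P.-integrable setT (EFin \o f j) by exact: bounded_integrable (fB j).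
have intcf j : P.-integrable setT (EFin \o (fun x => c j * f j x)).
  exact: (@integrableZl _ _ _ _ _ _ (c j) _ (intf j)).
rewrite big_cons -IH -RintegralZl// -RintegralD//.
  by apply: eq_Rintegral => x _; rewrite big_cons.
under [X in _.-integrable _ X]eq_fun do rewrite /= -sumEFin.
by apply: (@integrable_sum _ _ _ P setT measurableT _ s xpredT (fun j x => (c j * f j x)%:E)) => j _; exact: intcf.
Qed.

Lemma empirical_deviation_sum (I : Type) (s : seq I) (c : I -> R)
    (f : I -> E -> R) (B : R) (n : nat) (t : T) :
  (forall i, measurable_fun setT (f i)) -> (forall i x, `|f i x| <= B) ->
  empirical_deviation P X n (fun x => \sum_(i <- s) c i * f i x) t =
  \sum_(i <- s) c i * empirical_deviation P X n (f i) t.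
Proof.
move=> mf fB; rewrite /empirical_deviation (Rintegral_sum_bounded _ _ mf fB).
rewrite exchange_big/= mulr_sumr -sumrB; apply: eq_bigr => i _.
by rewrite -mulr_sumr; ring.
Qed.

Lemma empirical_deviation_sum_le (I : Type) (s : seq I) (c : I -> R)
    (f : I -> E -> R) (B S : R) (n : nat) (t : T) :
  (forall i, measurable_fun setT (f i)) -> (forall i x, `|f i x| <= B) ->
  (forall i, `|empirical_deviation P X n (f i) t| <= S) ->
  `|empirical_deviation P X n (fun x => \sum_(i <- s) c i * f i x) t| <=
  (\sum_(i <- s) `|c i|) * S.
Proof.
move=> mf fB fS; rewrite (empirical_deviation_sum _ _ _ _ mf fB) mulr_suml.
apply: le_trans (ler_norm_sum _ _ _) _; apply: ler_sum => i _.
by rewrite normrM ler_wpM2l.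
Qed.

End finite_sums.

Section net_deviation.
Context {R : realType} {d : nat}.

Lemma neural_nets_sum (k : nat) (a1 a2 a3 : R) (g : 'rV[R]_d -> R) :
  0 <= a1 -> neural_nets R d k a1 a2 a3 g ->
  exists (c : option 'I_k -> R) (v : option 'I_k -> option 'I_d -> R),
  [/\ forall x, g x = \sum_i c i * neuron (v i) x,
      \sum_i `|c i| <= k%:R * a2 + 2 * a3 & forall i j, `|v i j| <= a1].
Proof.
move=> a10 [w [b [beta [b0 [hw hbeta hb0 gE]]]]].
(* The index [None] is the neuron with zero weights, of constant value 1/2; its coefficient [2 * b0]
   explains [2 * a3]. *)
exists (fun i => if i is Some i then beta i else 2 * b0).
exists (fun i j => if i is Some i then (if j is Some j then w i 0 j else b i) else 0).
have sumE (F : option 'I_k -> R) : \sum_i F i = F None + \sum_(i < k) F (Some i).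
  rewrite (bigD1 None)//= (reindex_omap Some id)/=; last by case.
  by congr (_ + _); apply: eq_bigl => i; rewrite eqxx.
split.
- move=> x; rewrite gE sumE neuron_cst0 addrC; congr (_ + _).
  by rewrite mulrAC divff ?mul1r.
- rewrite sumE addrC lerD//; last by rewrite normrM ger0_norm// ler_wpM2l.
  apply: (@le_trans _ _ (\sum_(i < k) a2)); first exact: ler_sum.
  by rewrite sumr_const card_ord mulr_natl.
- by case=> [i [j|]|j]; rewrite ?normr0//; have [h1 h2] := hw i.
Qed.

(** The Lipschitz dependence of a neuron on its parameters holds on the cube; cutting off outside
    makes the estimates global, while the samples and both laws almost surely see no difference. *)
Definition masked (g : 'rV[R]_d -> R) (x : borelRd R d) : R :=
  \1_(unit_cube R d) x * g x.

Lemma masked_sqr g x : masked g x ^+ 2 = \1_(unit_cube R d) x * g x ^+ 2.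
Proof.
rewrite /masked exprMn indicE; case: (_ \in _); rewrite ?expr1n//.
by rewrite expr0n/= !mul0r.
Qed.

Let pair_of (v v' : option 'I_d -> R) (s : option 'I_d + option 'I_d) :=
  match s with inl i => v i | inr i => v' i end.

(** In the linear case the second neuron of each pair is the constant 1/2, compensated by the factor
    2. One family of pairs thus serves the network and its square. *)
Lemma masked_sumE (I : finType) (c : I -> R) (v : I -> option 'I_d -> R) g :
  (forall x, g x = \sum_i c i * neuron (v i) x) ->
  masked g = (fun x => \sum_i (2 * c i) * neuron_pair (pair_of (v i) (fun=> 0)) x) /\
  (fun x => masked g x ^+ 2) = (fun x => \sum_(ij : I * I)
    (c ij.1 * c ij.2) * neuron_pair (pair_of (v ij.1) (v ij.2)) x).
Proof.
move=> gE; split; apply/funext => x.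
  rewrite /masked gE mulr_sumr; apply: eq_bigr => i _.
  by rewrite /neuron_pair (_ : _ \o inr = fun=> 0)// neuron_cst0; field.
rewrite masked_sqr gE expr2 big_distrlr/= pair_big mulr_sumr.
by apply: eq_bigr => -[i j] _; rewrite /neuron_pair /=; ring.
Qed.

Lemma masked_bounded (I : finType) (c : I -> R) (v : I -> option 'I_d -> R) g :
  (forall x, g x = \sum_i c i * neuron (v i) x) ->
  measurable_fun setT (masked g) /\ exists M, forall x, `|masked g x| <= M.
Proof.
move=> /masked_sumE[-> _]; split.
  apply: measurable_sum => i; apply: measurable_funM => //.
  exact: measurable_neuron_pair.
exists (\sum_i `|2 * c i|) => x; apply: le_trans (ler_norm_sum _ _ _) _.
apply: ler_sum => i _; rewrite normrM -[leRHS]mulr1 ler_wpM2l//.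
exact: neuron_pair_le1.
Qed.

Context (dT : measure_display) (T : measurableType dT) (PP : probability T R).
Variables (P Q : probability (borelRd R d) R).
Variables X Y : nat -> {RV PP >-> borelRd R d}.

Definition population (g : 'rV[R]_d -> R) : R :=
  \int[P]_x masked g x - \int[Q]_x masked g x - 4^-1 * \int[Q]_x masked g x ^+ 2.

(** With [L = k a2 + 2 a3], the network is a combination of pairs of total weight at most [2 L], and
    its square one of total weight at most [L^2]; whatever the network, its outer weights enter
    through [L] alone. *)
Lemma objective_deviation (n k : nat) (t : T) (a1 a2 a3 SP SQ : R) g :
  (forall i : 'I_n, unit_cube R d (X i t)) ->
  (forall i : 'I_n, unit_cube R d (Y i t)) -> 0 <= a1 ->
  (forall th, (forall j, `|th j| <= a1) ->
    `|empirical_deviation P X n (neuron_pair th) t| <= SP) ->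
  (forall th, (forall j, `|th j| <= a1) ->
    `|empirical_deviation Q Y n (neuron_pair th) t| <= SQ) ->
  neural_nets R d k a1 a2 a3 g ->
  `|n%:R^-1 * \sum_(i < n) (g (X i t) - g (Y i t) - 4^-1 * g (Y i t) ^+ 2)
    - population g| <=
  2 * (k%:R * a2 + 2 * a3) * SP + 2 * (k%:R * a2 + 2 * a3) * SQ
    + 4^-1 * (k%:R * a2 + 2 * a3) ^+ 2 * SQ.
Proof.
move=> XK YK a10 hSP hSQ gN.
have [c [v [gE cL v1]]] := neural_nets_sum a10 gN.
set L := _ + 2 * a3 in cL *.
have c0 : 0 <= \sum_i `|c i| by apply: sumr_ge0.
have L0 : 0 <= L by apply: le_trans cL.
have SP0 : 0 <= SP by apply: le_trans (normr_ge0 _) (hSP (fun=> 0) _) => j; rewrite normr0.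
have SQ0 : 0 <= SQ by apply: le_trans (normr_ge0 _) (hSQ (fun=> 0) _) => j; rewrite normr0.
have [mE m2E] := masked_sumE gE.
have mnp I (f : I -> _) i : measurable_fun setT (@neuron_pair R d (f i)) by exact: measurable_neuron_pair.
have devP (PP' : probability (borelRd R d) R) (X' : nat -> {RV PP >-> borelRd R d}) S :
  (forall th, (forall j, `|th j| <= a1) ->
    `|empirical_deviation PP' X' n (neuron_pair th) t| <= S) -> 0 <= S ->
  `|empirical_deviation PP' X' n (masked g) t| <= 2 * L * S.
  move=> hS S0; rewrite mE; apply: le_trans (empirical_deviation_sum_le _ _ (B := 1) (S := S) _ _ _) _.
  - by move=> i; exact: measurable_neuron_pair.
  - by move=> i x; exact: neuron_pair_le1.
  - by move=> i; apply: hS => -[j|j] /=; rewrite ?normr0.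
  - rewrite ler_wpM2r// (eq_bigr (fun i => 2 * `|c i|)); last first.
      by move=> i _; rewrite normrM ger0_norm.
    by rewrite -mulr_sumr ler_wpM2l.
have devQ2 : `|empirical_deviation Q Y n (fun x => masked g x ^+ 2) t| <= L ^+ 2 * SQ.
  rewrite m2E; apply: le_trans (empirical_deviation_sum_le _ _ (B := 1) (S := SQ) _ _ _) _.
  - by move=> i; exact: measurable_neuron_pair.
  - by move=> i x; exact: neuron_pair_le1.
  - by move=> i; apply: hSQ => -[j|j] /=.
  - rewrite ler_wpM2r// (eq_bigr (fun ij => `|c ij.1| * `|c ij.2|)); last first.
      by move=> i _; rewrite normrM.
    by rewrite -(pair_big xpredT xpredT (fun i j => `|c i| * `|c j|))/= -big_distrlr/= expr2 ler_pM.
have -> : n%:R^-1 * \sum_(i < n) (g (X i t) - g (Y i t) - 4^-1 * g (Y i t) ^+ 2)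
    - population g =
    empirical_deviation P X n (masked g) t - empirical_deviation Q Y n (masked g) t
    - 4^-1 * empirical_deviation Q Y n (fun x => masked g x ^+ 2) t.
  have gX i : (i < n)%N -> g (X i t) = masked g (X i t).
    by move=> ni; rewrite /masked indicE mem_set ?mul1r//; exact: (XK (Ordinal ni)).
  have gY i : (i < n)%N -> g (Y i t) = masked g (Y i t).
    by move=> ni; rewrite /masked indicE mem_set ?mul1r//; exact: (YK (Ordinal ni)).
  rewrite (eq_bigr (fun i : 'I_n => masked g (X i t) - masked g (Y i t) -
    4^-1 * masked g (Y i t) ^+ 2)); last by move=> i _; rewrite gX// gY.
  rewrite /empirical_deviation /population !sumrB -mulr_sumr; ring.
apply: le_trans (ler_normB _ _) _; apply: lerD.
  apply: le_trans (ler_normB _ _) _; apply: lerD; exact: devP.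
by rewrite normrM ger0_norm// -mulrA ler_wpM2l.
Qed.

End net_deviation.

(** * Population objective, risk and error of the estimator *)

Section population_risk.
Context {R : realType} {d : nat}.
Variables (P Q : probability (borelRd R d) R).
Hypothesis PQ : chi2_pair (unit_cube R d) P Q.

Let r := density P Q.
Let f0 (x : borelRd R d) : R := 2 * (r x - 1).

Let nu : {charge set (borelRd R d) -> \bar R} := charge_of_finite_measure P.

Let PQd : P `<< Q. Proof. by have [] := PQ. Qed.

Let iRN : Q.-integrable setT (Radon_Nikodym nu Q).
Proof. exact: Radon_Nikodym_integrable. Qed.

Let densityE x : (density P Q x)%:E = Radon_Nikodym nu Q x.
Proof. by rewrite fineK// Radon_Nikodym_fin_num. Qed.

Lemma measurable_density : measurable_fun setT (density P Q).
Proof.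
have mg := measurable_int _ iRN.
exact: (measurableT_comp (fine_measurable measurableT) mg).
Qed.

Lemma integrable_density : Q.-integrable setT (EFin \o density P Q).
Proof.
by apply: eq_integrable iRN => // x _; rewrite /= densityE.
Qed.

Lemma Rintegral_density (h : borelRd R d -> R) (M : R) :
  measurable_fun setT h -> (forall x, `|h x| <= M) ->
  \int[P]_x h x = \int[Q]_x (h x * density P Q x).
Proof.
move=> mh hM; congr fine.
rewrite -(Radon_Nikodym_change_of_variables PQd measurableT); last first.
  exact: bounded_integrable hM.
by apply: eq_integral => x _; rewrite EFinM densityE.
Qed.

Lemma integrable_sqr_density : Q.-integrable setT (EFin \o (fun x => (density P Q x - 1) ^+ 2)).
Proof.
have [_ _ _ fin] := PQ; apply/integrableP; split.
  apply/measurable_EFinP; apply: measurable_funX; apply: measurable_funB => //.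
  exact: measurable_density.
rewrite /chi2 unlock in fin; apply: le_lt_trans fin.
rewrite le_eqVlt; apply/orP; left; apply/eqP; apply: eq_integral => x _.
by rewrite /= ger0_norm// sqr_ge0.
Qed.

Lemma chi2E : chi2 P Q = (\int[Q]_x (density P Q x - 1) ^+ 2)%:E.
Proof.
rewrite /chi2 unlock /Rintegral fineK//.
exact: integrable_fin_num integrable_sqr_density.
Qed.

Definition risk (h : borelRd R d -> R) : R :=
  \int[Q]_x (h x - 2 * (density P Q x - 1)) ^+ 2.

Lemma risk_ge0 h : 0 <= risk h.
Proof. by apply: Rintegral_ge0 => x _; rewrite sqr_ge0. Qed.

(** Once [P] is rewritten as [density * Q], this is the expansion of a square. The terms are
    integrable one by one: those containing [g] by boundedness, the remaining one by finiteness of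
    [chi2]. *)
Lemma population_risk (g : 'rV[R]_d -> R) (M : R) :
  measurable_fun setT (masked g) -> (forall x, `|masked g x| <= M) ->
  population P Q g =
  \int[Q]_x (density P Q x - 1) ^+ 2 - 4^-1 * risk (masked g).
Proof.
move=> mg gM; set h := masked g in mg gM *.
have ih : Q.-integrable setT (EFin \o h) by exact: bounded_integrable gM.
have ih2 : Q.-integrable setT (EFin \o (fun x => h x ^+ 2)).
  apply: (@bounded_integrable _ _ _ _ _ (M ^+ 2)); first exact: measurable_funX.
  by move=> x; rewrite normrX lerXn2r ?nnegrE// (le_trans (normr_ge0 _) (gM x)).
have ihr : Q.-integrable setT (EFin \o (fun x => h x * density P Q x)).
  have bh : [bounded h x | x in [set: borelRd R d]].
    exists M; split; first by rewrite num_real.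
    by move=> y My x _ /=; apply: le_trans (gM x) (ltW My).
  exact: (integrableMr measurableT mg bh integrable_density).
have is2 := integrable_sqr_density.
have ihrm : Q.-integrable setT (EFin \o (fun x => h x * density P Q x - h x)).
  exact: (integrableB _ ihr ih).
have ih4 : Q.-integrable setT
    (EFin \o (fun x => 4 * (h x * density P Q x - h x))).
  exact: (@integrableZl _ _ _ _ _ _ 4 _ ihrm).
have is4 : Q.-integrable setT (EFin \o (fun x => 4 * (density P Q x - 1) ^+ 2)).
  exact: (@integrableZl _ _ _ _ _ _ 4 _ is2).
have ihh : Q.-integrable setT
    (EFin \o (fun x => h x ^+ 2 - 4 * (h x * density P Q x - h x))).
  exact: (integrableB _ ih2 ih4).
rewrite /population -/h (Rintegral_density mg gM) -RintegralB//.
have -> : risk h = \int[Q]_x h x ^+ 2 -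
    4 * \int[Q]_x (h x * density P Q x - h x) +
    4 * \int[Q]_x (density P Q x - 1) ^+ 2.
  rewrite -(RintegralZl _ measurableT is2) -(RintegralZl _ measurableT ihrm).
  rewrite -(RintegralB measurableT ih2 ih4) -(RintegralD measurableT ihh is4).
  by apply: eq_Rintegral => x _; ring.
by field.
Qed.

Context (dT : measure_display) (T : measurableType dT) (PP : probability T R).
Variables X Y : nat -> {RV PP >-> borelRd R d}.

(** The two sides are asymmetric: every network stays below [chi2] plus the deviation because a risk
    is nonnegative, whereas the lower bound needs one network of small risk. Together they also show
    that the estimator is finite. *)
Lemma chi2_estimator_error (k n : nat) (a1 a2 a3 SP SQ eta : R) (t : T) :
  (forall i : 'I_n, unit_cube R d (X i t)) ->
  (forall i : 'I_n, unit_cube R d (Y i t)) -> 0 <= a1 ->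
  (forall th, (forall j, `|th j| <= a1) ->
    `|empirical_deviation P X n (neuron_pair th) t| <= SP) ->
  (forall th, (forall j, `|th j| <= a1) ->
    `|empirical_deviation Q Y n (neuron_pair th) t| <= SQ) ->
  (exists2 g, neural_nets R d k a1 a2 a3 g & risk (masked g) <= eta) ->
  (`| chi2_estimator (neural_nets R d k a1 a2 a3)
       (fun i : 'I_n => X i t) (fun i : 'I_n => Y i t) - chi2 P Q | <=
   (2 * (k%:R * a2 + 2 * a3) * SP + 2 * (k%:R * a2 + 2 * a3) * SQ
     + 4^-1 * (k%:R * a2 + 2 * a3) ^+ 2 * SQ + 4^-1 * eta)%:E)%E.
Proof.
move=> XK YK a10 hSP hSQ [g0 g0N g0eta].
set Dl := _ + 4^-1 * _ ^+ 2 * SQ.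
have dev g : neural_nets R d k a1 a2 a3 g ->
  `|n%:R^-1 * \sum_(i < n) (g (X i t) - g (Y i t) - 4^-1 * g (Y i t) ^+ 2)
    - population P Q g| <= Dl by exact: objective_deviation.
set c2 := \int[Q]_x (density P Q x - 1) ^+ 2.
have popE g : neural_nets R d k a1 a2 a3 g ->
    population P Q g = c2 - 4^-1 * risk (masked g).
  move=> gN; have [c [v [gE _ _]]] := neural_nets_sum a10 gN.
  by have [mg [M gM]] := masked_bounded gE; exact: population_risk gM.
set est := chi2_estimator _ _ _.
have ub : (est <= (c2 + Dl)%:E)%E.
  apply: ge_ereal_sup => _ [g gN <-]; rewrite lee_fin.
  have := dev g gN; rewrite popE// ler_norml => /andP[_].
  by have := risk_ge0 (masked g); lra.
have lb : ((c2 - 4^-1 * eta - Dl)%:E <= est)%E.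
  apply: le_trans (ereal_sup_ubound _); last by exists g0.
  have := dev g0 g0N; rewrite popE// ler_norml lee_fin => /andP[+ _].
  lra.
have eta0 : 0 <= eta by apply: le_trans g0eta; exact: risk_ge0.
have fest : est \is a fin_num.
  by rewrite fin_numElt (lt_le_trans _ lb) ?ltNyr// (le_lt_trans ub) ?ltry.
rewrite chi2E -/c2 -(fineK fest) -EFinB abse_EFin lee_fin ler_norml.
by rewrite -(fineK fest) !lee_fin in ub lb; lra.
Qed.

End population_risk.

(** * Approximation of Barron functions *)

Section sigmoid_staircase.
Context {R : realType}.

(** With truncated subtraction the exponent is the distance between [i] and [q]: the terms before
    [q] add up to at most 1, those from [q] on to at most 2. *)
Lemma sum_half_distn (q m : nat) :
  \sum_(i < m) (2^-1 : R) ^+ ((i - q) + (q - i)) <= 3.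
Proof.
suff : \sum_(i < m) (2^-1 : R) ^+ ((i - q) + (q - i)) <=
   if (m <= q)%N then 2^-1 ^+ (q - m) else 3 - 2^-1 ^+ (m - q.+1).
  move=> /le_trans; apply; case: ifP => _.
    apply: (@le_trans _ _ 1); last lra.
    by rewrite exprn_ile1 ?invr_ge0 ?invf_le1 ?ler1n.
  by rewrite lerBlDr lerDl exprn_ge0 ?invr_ge0.
elim: m => [|m IH]; first by rewrite big_ord0 leq0n exprn_ge0 ?invr_ge0.
rewrite big_ord_recr/=; apply: le_trans (lerD IH (lexx _)) _.
have [mq|mq|mq] := ltngtP m q.
- have -> : (m - q = 0)%N by lia.
  rewrite add0n (_ : q - m = (q - m.+1).+1)%N; last lia.
  by rewrite exprS; lra.
- have -> : (m - q = (m.+1 - q.+1))%N by lia.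
  have -> : (q - m = 0)%N by lia.
  rewrite addn0 (_ : m.+1 - q.+1 = (m - q.+1).+1)%N; last lia.
  by rewrite exprS; lra.
- by rewrite mq !subnn !expr0; lra.
Qed.

Lemma expRN_le_half (n : nat) : expR (- n%:R) <= 2^-1 ^+ n :> R.
Proof.
rewrite expRN exprVn -[n%:R]mulr1.
have -> : expR (n%:R * 1) = expR 1 ^+ n :> R by rewrite expRM_natl.
rewrite lef_pV2 ?posrE ?exprn_gt0 ?expR_gt0// lerXn2r ?nnegrE ?expR_ge0//.
by apply: le_trans (expR_ge1Dx 1); lra.
Qed.

Lemma logistic_step (x : R) :
  `|(0 <= x)%R%:R - logistic x| <= expR (- `|x|).
Proof.
have ex := expR_gt0 (- x); rewrite /logistic; case: (leP 0 x) => x0 /=.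
  rewrite (_ : 1 - (1 + expR (- x))^-1 = expR (- x) / (1 + expR (- x))); last first.
    by field; rewrite gt_eqF// addr_gt0.
  rewrite (ger0_norm x0) ger0_norm; last by apply: divr_ge0; lra.
  by rewrite ler_pdivrMr; nra.
rewrite sub0r normrN (ltr0_norm x0) opprK ger0_norm; last by rewrite invr_ge0; lra.
rewrite -[X in _ <= expR X]opprK [leRHS]expRN lef_pV2 ?posrE; lra.
Qed.

Lemma sum_ltn_minn (m q : nat) (v : nat -> R) :
  \sum_(i < m | (i < q)%N) v i = \sum_(0 <= i < minn q m) v i.
Proof.
rewrite big_mkord; have [mq|qm] := leqP m q.
  by apply: eq_bigl => i; rewrite (leq_trans _ mq).
by rewrite (big_ord_widen m v (ltnW qm)).
Qed.

(** Cut [[-1, 1]] into [m = floor tau + 1] cells and replace [e (N * u)] by a staircase with jumps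
    at most [2 N / m]. The discretization costs [2 N / m]. Since [m <= 2 * tau], a cell has length
    at least 1 on the scale [1 / tau], so smoothing the jumps costs a geometric series, at most
    [12 N / m]; finally [tau < m]. *)
Lemma sigmoid_staircase (e : R -> R) (N tau : R) :
  (forall x y, `|e x - e y| <= `|x - y|) -> 0 <= N -> 1 <= tau ->
  exists (m : nat) (v a : nat -> R),
  [/\ forall i, (i < m)%N -> `|a i| <= 1, \sum_(i < m) `|v i| <= 2 * N &
      forall u, `|u| <= 1 ->
       `|e (N * u) - e (- N) - \sum_(i < m) v i * logistic (tau * (u - a i))|
         <= 14 * N / tau].
Proof.
move=> eL N0 tau1.
pose m := (Num.truncn tau).+1.
have /andP[m1 m2] : (Num.truncn tau)%:R <= tau < m%:R by apply: truncn_itv; lra.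
have m0 : (0 : R) < m%:R by rewrite ltr0n.
have m_le : m%:R <= 2 * tau by rewrite /m -natr1; lra.
pose a i : R := -1 + 2 * i%:R / m%:R.
pose v i := e (N * a i.+1) - e (N * a i).
have aS i : a i.+1 - a i = 2 / m%:R by rewrite /a -natr1; field; rewrite gt_eqF.
have v_le i : `|v i| <= 2 * N / m%:R.
  apply: le_trans (eL _ _) _; rewrite -mulrBr aS ger0_norm; last first.
    by rewrite mulr_ge0// divr_ge0// ltW.
  lra.
exists m, v, a; split.
- move=> i im; rewrite ler_norml /a; apply/andP; split.
    by rewrite lerDl divr_ge0// ?mulr_ge0// ltW.
  rewrite -lerBrDl ler_pdivrMr//.
  by have : i%:R <= m%:R :> R; [rewrite ler_nat ltnW|lra].
- apply: (@le_trans _ _ (\sum_(i < m) (2 * N / m%:R))); first exact: ler_sum.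
  by rewrite sumr_const card_ord -[leLHS]mulr_natr -mulrA mulVf ?mulr1// gt_eqF.
move=> u; rewrite ler_norml => /andP[u1 u2].
pose z := m%:R * (u + 1) / 2; have z0 : 0 <= z.
  by rewrite divr_ge0// mulr_ge0// ?(ltW m0)//; lra.
pose q := Num.truncn z; have /andP[q1 q2] : q%:R <= z < q.+1%:R by apply: truncn_itv.
rewrite -natr1 in q2.
have ua i : u - a i = (z - i%:R) * (2 / m%:R).
  by rewrite /a /z; field; rewrite gt_eqF.
have qm : (q <= m)%N.
  by rewrite -(ler_nat R); apply: le_trans q1 _; rewrite /z ler_pdivrMr//; nra.
have step i : (0 <= tau * (u - a i)) = (i <= q)%N.
  rewrite ua pmulr_rge0; last lra.
  rewrite pmulr_lge0 ?divr_gt0// subr_ge0.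
  have [iq|iq] := leqP i q.
    by apply: le_trans q1; rewrite ler_nat.
  apply/negbTE; rewrite -ltNge; apply: lt_le_trans q2 _.
  by rewrite natr1 ler_nat.
(* The nodes passed are [0] to [q], so the sum telescopes to the node [q + 1], except at [u = 1],
   where [q = m] and the last node is [m]. *)
pose w := minn q.+1 m.
have tele : \sum_(i < m) v i * (0 <= tau * (u - a i))%R%:R = e (N * a w) - e (- N).
  rewrite (eq_bigr (fun i : 'I_m => if (i < q.+1)%N then v i else 0)); last first.
    by move=> i _; rewrite step ltnS; case: ifP => _; rewrite ?mulr1 ?mulr0.
  rewrite -big_mkcond/= sum_ltn_minn -/w.
  rewrite telescope_sumr//; congr (_ - e _).
  by rewrite /a mulr0 mul0r; lra.
have head : `|e (N * u) - e (N * a w)| <= 2 * N / m%:R.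
  apply: le_trans (eL _ _) _; rewrite -mulrBr normrM ger0_norm//.
  rewrite mulrAC mulrC ler_wpM2r// ua normrM [X in _ * X]ger0_norm; last first.
    by rewrite divr_ge0// ltW.
  rewrite -[leRHS]mul1r ler_wpM2r ?divr_ge0 ?(ltW m0)//.
  rewrite ler_norml; have zm : z <= m%:R by rewrite /z ler_pdivrMr//; nra.
  rewrite /w; have [mq|mq] := leqP m q.+1.
    have : m%:R <= q.+1%:R :> R by rewrite ler_nat.
    by rewrite -natr1; lra.
  by rewrite -natr1; lra.
have tail : `|\sum_(i < m) v i * ((0 <= tau * (u - a i))%R%:R - logistic (tau * (u - a i)))|
    <= 12 * N / m%:R.
  apply: le_trans (ler_norm_sum _ _ _) _.
  apply: (@le_trans _ _ (\sum_(i < m) (4 * N / m%:R) * 2^-1 ^+ ((i - q) + (q - i)))).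
    apply: ler_sum => i _; rewrite normrM.
    have -> : 4 * N / m%:R = 2 * N / m%:R * 2 by lra.
    rewrite -mulrA ler_pM//; apply: le_trans (logistic_step _) _.
    pose D := ((i - q) + (q - i))%N; rewrite -/D.
    (* Inside its cell [u] may be closer to node [i] than node [q] is, by at most one cell; this
       loss is paid by the extra factor 2 in [4 * N / m]. *)
    have Dle : D%:R - 1 <= `|tau * (u - a i)|.
      rewrite ua normrM ger0_norm; last lra.
      rewrite normrM [X in _ * (_ * X)]ger0_norm ?divr_ge0 ?(ltW m0)//.
      have h1 : 1 <= tau * (2 / m%:R).
        by rewrite mulrA ler_pdivlMr// mul1r mulrC.
      apply: (@le_trans _ _ `|z - i%:R|); last first.
        by rewrite mulrCA -[leLHS]mulr1 ler_wpM2l.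
      rewrite /D; have [iq|iq] := leqP i q.
        rewrite (eqP (_ : i - q == 0)%N) ?subn_eq0//.
        by rewrite add0n natrB// (le_trans _ (ler_norm _))//; lra.
      rewrite (eqP (_ : q - i == 0)%N) ?subn_eq0 ?(ltnW iq)//.
      by rewrite addn0 natrB ?(ltnW iq)// distrC (le_trans _ (ler_norm _))//; lra.
    case: D Dle => [|D] Dle.
      rewrite expr0 mulr1; apply: (@le_trans _ _ 1); last lra.
      by rewrite -expR0 ler_expR oppr_le0.
    rewrite exprS mulrA divff// mul1r; apply: le_trans (expRN_le_half D).
    by rewrite ler_expR lerN2; apply: le_trans Dle; rewrite -natr1; lra.
  rewrite -mulr_sumr; have -> : 12 * N / m%:R = 4 * N / m%:R * 3 by lra.
  by rewrite ler_wpM2l ?sum_half_distn// divr_ge0 ?(ltW m0)// mulr_ge0.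
have -> : e (N * u) - e (- N) - \sum_(i < m) v i * logistic (tau * (u - a i)) =
  (e (N * u) - e (N * a w)) +
  \sum_(i < m) v i * ((0 <= tau * (u - a i))%R%:R - logistic (tau * (u - a i))).
  under [in RHS]eq_bigr do rewrite mulrBr.
  by rewrite sumrB tele; ring.
apply: le_trans (ler_normD _ _) _; apply: le_trans (lerD head tail) _.
have -> : 2 * N / m%:R + 12 * N / m%:R = 14 * N / m%:R by lra.
by rewrite ler_wpM2l ?mulr_ge0// lef_pV2 ?posrE ?(ltW m2)//; lra.
Qed.

End sigmoid_staircase.

Section lipschitz_trigo.
Context {R : realType}.

Lemma derive_le1_lip (f df : R -> R) :
  (forall x : R, is_derive x (1 : R) f (df x)) -> (forall x, `|df x| <= 1) ->
  forall x y, `|f x - f y| <= `|x - y|.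
Proof.
move=> fd df1 x y; wlog xy : x y / y <= x => [h|].
  by have [/h//|/ltW/h] := leP y x; rewrite distrC (distrC y).
have cf : {within `[y, x], continuous f}.
  apply: continuous_subspaceT => z; apply: differentiable_continuous.
  by apply/derivable1_diffP; have [] := fd z.
have [c _ ->] := MVT_segment xy (fun z _ => fd z) cf.
by rewrite normrM ler_piMl.
Qed.

Lemma sin_lip (x y : R) : `|sin x - sin y| <= `|x - y|.
Proof.
apply: (derive_le1_lip (@is_derive_sin R)) => z.
by rewrite ler_norml cos_geN1 cos_le1.
Qed.

Lemma cos_lip (x y : R) : `|cos x - cos y| <= `|x - y|.
Proof.
apply: (derive_le1_lip (@is_derive_cos R)) => z.
by rewrite normrN ler_norml sin_geN1 sin_le1.
Qed.

End lipschitz_trigo.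

Section bounded_fubini.
Context d1 d2 (T1 : measurableType d1) (T2 : measurableType d2) (R : realType).
Variables (m1 : {finite_measure set T1 -> \bar R}) (m2 : {finite_measure set T2 -> \bar R}).
Variables (f : T1 * T2 -> R) (M : R).
Hypothesis mf : measurable_fun setT f.
Hypothesis fM : forall z, `|f z| <= M.

Let intf : (m1 \x m2)%E.-integrable setT (EFin \o f).
Proof.
apply: measurable_bounded_integrable => //.
  apply: (@le_lt_trans _ _ (m1 setT * m2 setT)%E).
    by rewrite -(product_measure1E m1 m2 measurableT measurableT) setXTT.
  rewrite lte_mul_pinfty ?fin_num_measure//.
  by rewrite -ge0_fin_numE// fin_num_measure.
exists M; split; first by rewrite num_real.
by move=> x Mx y _ /=; apply: le_trans (fM y) (ltW Mx).
Qed.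

Lemma bounded_fubini_inner1 x :
  (\int[m2]_y (f (x, y))%:E)%E = (\int[m2]_y f (x, y))%:E.
Proof.
rewrite /Rintegral fineK//; apply: integrable_fin_num => //.
apply: (@bounded_integrable _ _ _ m2 _ M) => //.
by apply: measurableT_comp => //; exact: pair1_measurable.
Qed.

Lemma bounded_fubini_inner2 y :
  (\int[m1]_x (f (x, y))%:E)%E = (\int[m1]_x f (x, y))%:E.
Proof.
rewrite /Rintegral fineK//; apply: integrable_fin_num => //.
apply: (@bounded_integrable _ _ _ m1 _ M) => //.
by apply: measurableT_comp => //; exact: pair2_measurable.
Qed.

Lemma measurable_Rintegral1 : measurable_fun setT (fun x => \int[m2]_y f (x, y)).
Proof.
apply/measurable_EFinP.
rewrite (_ : _ \o _ = fubini_F m2 (EFin \o f)); first exact: measurable_fubini_F intf.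
by apply/funext => x; rewrite /= -bounded_fubini_inner1.
Qed.

Lemma bounded_fubini :
  \int[m1]_x \int[m2]_y f (x, y) = \int[m2]_y \int[m1]_x f (x, y).
Proof.
congr fine; under eq_integral do rewrite -bounded_fubini_inner1.
under [RHS]eq_integral do rewrite -bounded_fubini_inner2.
exact: Fubini intf.
Qed.

End bounded_fubini.

Section ridge_duality.
Context {R : realType} {d : nat}.
Variable Q : probability (borelRd R d) R.
Variables (s : borelRd R d -> R) (Ms : R).
Hypothesis ms : measurable_fun setT s.
Hypothesis s_le : forall x, `|s x| <= Ms.
Hypothesis s_cube : forall x : borelRd R d, ~ unit_cube R d x -> s x = 0.

(** This norm dominates both [dotp w x] on the cube and each coordinate of [w], so dividing by it
    keeps the weights of the steep neurons in the box of size [tau]. *)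
Definition norm1 (w : 'rV[R]_d) : R := \sum_(j < d) `|w 0 j|.

Lemma measurable_dotpr (w : 'rV[R]_d) :
  measurable_fun setT (fun x : borelRd R d => dotp w x).
Proof.
by apply: measurable_sum => j; apply: measurable_funM => //; exact: measurable_coord.
Qed.

Lemma measurable_norm1 : measurable_fun setT (norm1 : borelRd R d -> R).
Proof.
apply: measurable_sum => j; apply: measurableT_comp => //; exact: measurable_coord.
Qed.

Lemma norm1_ge0 w : 0 <= norm1 w.
Proof. exact: sumr_ge0. Qed.

Lemma dotp_le_norm1 (w x : 'rV[R]_d) : unit_cube R d x -> `|dotp w x| <= norm1 w.
Proof.
move=> Kx; apply: le_trans (ler_norm_sum _ _ _) _; apply: ler_sum => j _.
rewrite normrM -[leRHS]mulr1 ler_wpM2l//.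
by have /andP[? ?] := Kx j; rewrite ger0_norm.
Qed.

Lemma neuron_ridge (w x : 'rV[R]_d) (tau N a : R) :
  neuron (fun j => if j is Some j then tau * w 0 j / N else - tau * a) x =
  logistic (tau * (dotp w x / N - a)).
Proof.
congr logistic; rewrite mulrDr mulrN -mulNr; congr (_ + _).
rewrite mulr_suml mulr_sumr; apply: eq_bigr => j _; ring.
Qed.

Let int_bd (f : borelRd R d -> R) M : measurable_fun setT f ->
  (forall x, `|f x| <= M) -> Q.-integrable setT (EFin \o f).
Proof. exact: bounded_integrable. Qed.

(** On the cube [dotp w x = N * u] with [u] in [[-1, 1]], so the staircase applies. Its jumps, of
    total size [2 N], pair to at most [2 N S]; the constant [e (- N)], at most [N] because
    [e 0 = 0], is a multiple of the neuron of value 1/2 and gives another [2 N S]; the error is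
    integrated against the modulus of [s]. *)
Lemma ridge_duality (tau S : R) (e : R -> R) (w : 'rV[R]_d) :
  1 <= tau ->
  (forall v, (forall j, `|v j| <= tau) -> `|\int[Q]_x (s x * neuron v x)| <= S) ->
  (forall x y, `|e x - e y| <= `|x - y|) -> e 0 = 0 -> measurable_fun setT e ->
  (forall x, `|e x| <= 2) ->
  `|\int[Q]_x (s x * e (dotp w x))| <=
    norm1 w * (4 * S + 14 / tau * \int[Q]_x `|s x|).
Proof.
move=> tau1 hS eL e0 me e2; set N := norm1 w.
have N0 : 0 <= N by exact: norm1_ge0.
have [m [v [a [a1 vN app]]]] := sigmoid_staircase eL N0 tau1.
pose u x := dotp w x / N.
have uE x : unit_cube R d x -> N * u x = dotp w x.
  (* If [N = 0], the convention for division by zero gives [u = 0], which is right because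
     [dotp w x] vanishes on the cube. *)
  move=> Kx; have [NE|Nn0] := eqVneq N 0; last by rewrite /u mulrC divfK.
  have := dotp_le_norm1 w Kx; rewrite -/N NE mul0r normr_le0 => /eqP ->.
  by [].
have u1 x : unit_cube R d x -> `|u x| <= 1.
  move=> Kx; rewrite normrM normfV (ger0_norm N0).
  have [NE|Nn0] := eqVneq N 0; first by rewrite NE invr0 mulr0.
  by rewrite ler_pdivrMr ?lt_def ?Nn0// mul1r dotp_le_norm1.
have wN j : `|w 0 j| <= N.
  by rewrite /N /norm1 (bigD1 j)//= lerDl sumr_ge0.
pose V i (j : option 'I_d) : R := if j is Some j then tau * w 0 j / N else - tau * a i.
have V1 i : (i < m)%N -> forall j, `|V i j| <= tau.
  move=> im [j|] /=; last first.
    rewrite normrM normrN (ger0_norm (_ : 0 <= tau)); last lra.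
    by rewrite ler_piMr ?a1//; lra.
  rewrite -mulrA normrM (ger0_norm (_ : 0 <= tau)); last lra.
  rewrite ler_piMr//; first lra.
  rewrite normrM normfV (ger0_norm N0).
  have [NE|Nn0] := eqVneq N 0; first by rewrite NE invr0 mulr0.
  by rewrite ler_pdivrMr ?lt_def ?Nn0// mul1r.
have VE i x : neuron (V i) x = logistic (tau * (u x - a i)).
  exact: neuron_ridge.
have S0 : 0 <= S.
  by apply: le_trans (normr_ge0 _) (hS (fun=> 0) _) => j; rewrite normr0; lra.
have Ms0 : 0 <= Ms by exact: le_trans (normr_ge0 _) (s_le 0).
have m_sn v' : measurable_fun setT (fun x : borelRd R d => s x * neuron v' x).
  by apply: measurable_funM => //; exact: measurable_neuron.
have b_sn v' x : `|s x * neuron v' x| <= Ms.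
  by rewrite normrM -[leRHS]mulr1 ler_pM// normr_neuron_le1.
have i_sn v' : Q.-integrable setT (EFin \o (fun x => s x * neuron v' x)).
  exact: int_bd (b_sn v').
have m_se : measurable_fun setT (fun x : borelRd R d => s x * e (dotp w x)).
  by apply: measurable_funM => //; apply: (measurableT_comp me (measurable_dotpr w)).
have i_se : Q.-integrable setT (EFin \o (fun x => s x * e (dotp w x))).
  apply: (int_bd (M := Ms * 2) m_se) => x.
  by rewrite normrM ler_pM.
have i_s : Q.-integrable setT (EFin \o (fun x => `|s x|)).
  by apply: (int_bd (M := Ms)) => [|x]; [exact: measurableT_comp|rewrite normr_id].
pose A x := \sum_(i < m) v i * (s x * neuron (V i) x).
pose B x : R := 2 * e (- N) * (s x * neuron (fun=> 0) x).
have i_A : Q.-integrable setT (EFin \o A).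
  rewrite /A; under [X in _.-integrable _ X]eq_fun do rewrite /= -sumEFin.
  apply: (@integrable_sum _ _ _ Q setT measurableT _ _ xpredT
    (fun (i : 'I_m) x => (v i * (s x * neuron (V i) x))%:E)) => i _.
  exact: (@integrableZl _ _ _ _ _ _ (v i) _ (i_sn (V i))).
have i_B : Q.-integrable setT (EFin \o B).
  exact: (@integrableZl _ _ _ _ _ _ (2 * e (- N)) _ (i_sn (fun=> 0))).
have IA : `|\int[Q]_x A x| <= 2 * N * S.
  rewrite /A (Rintegral_sum_bounded _ _ _ (fun i : 'I_m => m_sn (V i)) (fun i : 'I_m => b_sn (V i))).
  apply: le_trans (ler_norm_sum _ _ _) _.
  apply: (@le_trans _ _ (\sum_(i < m) `|v i| * S)).
    by apply: ler_sum => i _; rewrite normrM ler_wpM2l// hS// => j; exact: V1.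
  by rewrite -mulr_suml ler_wpM2r.
have IB : `|\int[Q]_x B x| <= 2 * N * S.
  rewrite /B RintegralZl// normrM ler_pM//.
    rewrite normrM ger0_norm// ler_wpM2l//.
    by have := eL (- N) 0; rewrite e0 !subr0 normrN (ger0_norm N0).
  by apply: hS => j; rewrite normr0; lra.
have i_AB : Q.-integrable setT (EFin \o (fun x => A x + B x)).
  exact: (integrableD _ i_A i_B).
have i_D : Q.-integrable setT (EFin \o (fun x => s x * e (dotp w x) - (A x + B x))).
  exact: (integrableB _ i_se i_AB).
have ID : `|\int[Q]_x (s x * e (dotp w x) - (A x + B x))| <=
    14 * N / tau * \int[Q]_x `|s x|.
  apply: le_trans (le_normr_Rintegral measurableT i_D) _.
  rewrite -RintegralZl//; apply: le_Rintegral => //.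
  - exact: integrable_norm.
  - exact: (@integrableZl _ _ _ _ _ _ (14 * N / tau) _ i_s).
  move=> x _; have [Kx|nKx] := pselect (unit_cube R d x); last first.
    rewrite /A /B s_cube// !mul0r !mulr0 big1 ?addr0 ?subr0 ?normr0 ?mulr0// => i _.
    by rewrite mul0r mulr0.
  have -> : s x * e (dotp w x) - (A x + B x) = s x *
      (e (N * u x) - e (- N) - \sum_(i < m) v i * logistic (tau * (u x - a i))).
    rewrite uE// /A /B neuron_cst0.
    under eq_bigr do rewrite VE mulrCA.
    by rewrite -mulr_sumr; field.
  by rewrite normrM mulrC ler_wpM2r// app// u1.
have -> : \int[Q]_x (s x * e (dotp w x)) =
   \int[Q]_x (s x * e (dotp w x) - (A x + B x)) + (\int[Q]_x A x + \int[Q]_x B x).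
  by rewrite -RintegralD// -RintegralD//; apply: eq_Rintegral => x _; ring.
apply: le_trans (ler_normD _ _) _.
apply: le_trans (lerD ID (ler_normD _ _)) _.
apply: le_trans (lerD (lexx _) (lerD IA IB)) _.
by rewrite le_eqVlt; apply/orP; left; apply/eqP; field; lra.
Qed.

End ridge_duality.

(* Greedy construction with equal weights: each new atom is chosen so that its
   inner product with the current cumulated error [s] is almost nonpositive
   after subtracting [H], so that the squared norm of [s] grows linearly. *)
Section herding.
Context (R : realType) (dE : measure_display) (E : measurableType dE).
Variable Q : probability E R.
Variables (I : Type) (i0 : I) (phi : I -> E -> R) (H : E -> R) (K : set E) (M V tau : R).
Hypothesis m_phi : forall i, measurable_fun setT (phi i).
Hypothesis phi_le1 : forall i x, `|phi i x| <= 1.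
Hypothesis phi_supp : forall i x, ~ K x -> phi i x = 0.
Hypothesis mH : measurable_fun setT H.
Hypothesis H_le : forall x, `|H x| <= M.
Hypothesis H_supp : forall x, ~ K x -> H x = 0.
Hypothesis V_gt0 : 0 < V.
Hypothesis tau_gt0 : 0 < tau.
Hypothesis duality : forall (s : E -> R) (Ms S : R), measurable_fun setT s ->
  (forall x, `|s x| <= Ms) -> (forall x, ~ K x -> s x = 0) ->
  (forall i, `|\int[Q]_x (s x * phi i x)| <= S) ->
  `|\int[Q]_x (s x * H x)| <= V * (S + tau^-1 * \int[Q]_x `|s x|).

Let b := 3 * V + M + 2.

Let int_bd (f : E -> R) B : measurable_fun setT f ->
  (forall x, `|f x| <= B) -> Q.-integrable setT (EFin \o f).
Proof. exact: bounded_integrable. Qed.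

Let M_ge0 : 0 <= M.
Proof. exact: le_trans (normr_ge0 _) (H_le point). Qed.

Let b_gt0 : 0 < b.
Proof. by rewrite /b; have := M_ge0; have := V_gt0; lra. Qed.

(** If every atom failed, [duality] with [S = (A - 1) / V - n1 / tau] would give [A <= A - 1]. The
    slack 1 replaces the attainment of a supremum. *)
Lemma near_optimal_atom (s : E -> R) (Ms : R) : measurable_fun setT s ->
  (forall x, `|s x| <= Ms) -> (forall x, ~ K x -> s x = 0) ->
  exists i, `|\int[Q]_x (s x * H x)| <
    V * `|\int[Q]_x (s x * phi i x)| + V / tau * \int[Q]_x `|s x| + 1.
Proof.
move=> ms sM sK; apply: contrapT => /forallNP h.
set A := `|\int[Q]_x (s x * H x)| in h; set n1 := \int[Q]_x `|s x| in h.
have le i : `|\int[Q]_x (s x * phi i x)| <= (A - 1) / V - tau^-1 * n1.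
  have /negP := h i; rewrite -leNgt => hi.
  have -> : (A - 1) / V - tau^-1 * n1 = (A - 1 - V / tau * n1) / V.
    by field; rewrite !gt_eqF.
  by rewrite ler_pdivlMr// mulrC; lra.
have := duality ms sM sK le; rewrite -/A -/n1 subrK mulrC divfK ?gt_eqF//; lra.
Qed.

(** One step adds [2 <s, dl> + |dl|^2] to the squared norm. With the sign chosen against [z],
    near-optimality bounds [<s, dl>] by [1 + V / tau] times the L1 norm of [s]; that norm is at most
    [b sqrt k <= b tau], so the increment is at most [2 (V b + 1) + (V + M)^2], and [b] is chosen to
    make this at most [b^2]. *)
Lemma herding (k : nat) : (0 < k)%N -> k%:R <= tau ^+ 2 ->
  exists (th : nat -> I) (eps : nat -> R), (forall i, `|eps i| <= 1) /\
    \int[Q]_x (\sum_(i < k) (eps i * V * phi (th i) x - H x)) ^+ 2 <= b ^+ 2 * k%:R.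
Proof.
move=> k0 ktau; have k0' : (0 : R) < k%:R by rewrite ltr0n.
have gen i : (i <= k)%N -> exists (th : nat -> I) (eps : nat -> R),
    (forall i, `|eps i| <= 1) /\
    \int[Q]_x (\sum_(j < i) (eps j * V * phi (th j) x - H x)) ^+ 2 <= b ^+ 2 * i%:R.
  elim: i => [_|i IH ik].
    exists (fun=> i0), (fun=> 0); split; first by move=> _; rewrite normr0.
    rewrite mulr0; under eq_Rintegral do rewrite big_ord0 expr0n.
    by rewrite /= Rintegral_cst_probability.
  have [th [eps [eps1 hi]]] := IH (ltnW ik).
  pose s x := \sum_(j < i) (eps j * V * phi (th j) x - H x).
  have ms : measurable_fun setT s.
    apply: measurable_sum => j; apply: measurable_funB => //.
    exact: measurable_funM.
  pose Ms := \sum_(j < i) (V + M).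
  have at_le e ph x : `|e| <= 1 -> `|e * V * phi ph x - H x| <= V + M.
    move=> e1; apply: le_trans (ler_normB _ _) (lerD _ (H_le x)).
    rewrite -mulrA normrM -[leRHS]mul1r ler_pM//.
    by rewrite normrM (gtr0_norm V_gt0) -[leRHS]mulr1 ler_wpM2l// ltW.
  have sM x : `|s x| <= Ms.
    apply: le_trans (ler_norm_sum _ _ _) _; apply: ler_sum => j _.
    exact: at_le.
  have sK x : ~ K x -> s x = 0.
    move=> nK; rewrite /s big1// => j _.
    by rewrite phi_supp// H_supp// mulr0 subr0.
  have [ph hph] := near_optimal_atom ms sM sK.
  set z := \int[Q]_x (s x * phi ph x) in hph.
  pose e : R := if 0 <= z then -1 else 1.
  have e1 : `|e| <= 1 by rewrite /e; case: ifP; rewrite ?normrN normr1.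
  have ez : e * z = - `|z|.
    rewrite /e; case: (leP 0 z) => z0; first by rewrite (ger0_norm z0) mulN1r.
    by rewrite (ltr0_norm z0) mul1r opprK.
  have int_s : Q.-integrable setT (EFin \o s) by exact: int_bd sM.
  have int_as : Q.-integrable setT (EFin \o (fun x => `|s x|)).
    exact: integrable_norm.
  have bound2 f g (B1 B2 : R) : (forall x, `|f x| <= B1) -> (forall x, `|g x| <= B2) ->
      forall x : E, `|f x * g x| <= B1 * B2 by move=> h1 h2 x; rewrite normrM ler_pM.
  have int_ss : Q.-integrable setT (EFin \o (fun x => s x ^+ 2)).
    apply: (int_bd (B := Ms * Ms)); first exact: measurable_funX.
    by move=> x; rewrite expr2; apply: bound2.
  have int_sp : Q.-integrable setT (EFin \o (fun x => s x * phi ph x)).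
    apply: (int_bd (B := Ms * 1)); first exact: measurable_funM.
    exact: bound2.
  have int_sH : Q.-integrable setT (EFin \o (fun x => s x * H x)).
    apply: (int_bd (B := Ms * M)); first exact: measurable_funM.
    exact: bound2.
  pose dl x := e * V * phi ph x - H x.
  have mdl : measurable_fun setT dl.
    by apply: measurable_funB => //; exact: measurable_funM.
  have int_dl : Q.-integrable setT (EFin \o (fun x => dl x ^+ 2)).
    apply: (int_bd (B := (V + M) * (V + M))); first exact: measurable_funX.
    by move=> x; rewrite expr2; apply: bound2 => y; exact: at_le.
  have int_sdl : Q.-integrable setT (EFin \o (fun x => s x * dl x)).
    apply: (int_bd (B := Ms * (V + M))); first exact: measurable_funM.
    by apply: bound2 => // y; exact: at_le.
  exists (fun j => if j == i then ph else th j), (fun j => if j == i then e else eps j).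
  split; first by move=> j; case: ifP.
  have -> : (fun x => (\sum_(j < i.+1) ((if j == i :> nat then e else eps j) * V *
      phi (if j == i :> nat then ph else th j) x - H x)) ^+ 2) =
      (fun x => (s x ^+ 2 + 2 * (s x * dl x)) + dl x ^+ 2).
    apply/funext => x; rewrite big_ord_recr/= eqxx -/(dl x).
    rewrite (eq_bigr (fun j : 'I_i => eps j * V * phi (th j) x - H x)).
      by rewrite -/(s x); ring.
    by move=> j _; rewrite ltn_eqF.
  have int_2sdl : Q.-integrable setT (EFin \o (fun x => 2 * (s x * dl x))).
    exact: (@integrableZl _ _ _ _ _ _ 2 _ int_sdl).
  rewrite RintegralD//; last exact: (integrableD _ int_ss int_2sdl).
  rewrite RintegralD// RintegralZl//.
  have sdlE : \int[Q]_x (s x * dl x) = V * (e * z) - \int[Q]_x (s x * H x).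
    rewrite mulrA /z -RintegralZl// -RintegralB//.
      by apply: eq_Rintegral => x _; rewrite /dl; ring.
    exact: (@integrableZl _ _ _ _ _ _ (V * e) _ int_sp).
  have dl2 : \int[Q]_x dl x ^+ 2 <= (V + M) ^+ 2.
    rewrite -[leRHS](Rintegral_cst_probability Q); apply: le_Rintegral => //.
      exact: finite_measure_integrable_cst.
    move=> x _; rewrite -[_ ^+ 2]real_normK ?num_real// lerXn2r ?nnegrE ?at_le//.
    by rewrite addr_ge0// ltW.
  (* The L1 norm is bounded through [y <= y^2 / (2 la) + la / 2], in place of the Cauchy-Schwarz
     inequality. *)
  pose la := b * Num.sqrt k%:R.
  have la0 : 0 < la by rewrite mulr_gt0// sqrtr_gt0.
  have n1_le : \int[Q]_x `|s x| <= la.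
    have int_q : Q.-integrable setT (EFin \o (fun x => (2 * la)^-1 * s x ^+ 2)).
      exact: (@integrableZl _ _ _ _ _ _ _ _ int_ss).
    have int_c : Q.-integrable setT (EFin \o cst (la / 2)).
      exact: finite_measure_integrable_cst.
    apply: (@le_trans _ _ (\int[Q]_x ((2 * la)^-1 * s x ^+ 2 + la / 2))).
      apply: le_Rintegral => //.
        exact: (integrableD _ int_q int_c).
      move=> x _; rewrite -[s x ^+ 2]real_normK ?num_real//.
      set y := `|s x|.
      have -> : (2 * la)^-1 * y ^+ 2 + la / 2 = y + (y - la) ^+ 2 / (2 * la).
        by field; rewrite gt_eqF.
      by rewrite lerDl divr_ge0 ?sqr_ge0// mulr_ge0// ltW.
    rewrite RintegralD//.
    rewrite (RintegralZl _ measurableT int_ss) Rintegral_cst_probability.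
    have la2 : la ^+ 2 = b ^+ 2 * k%:R by rewrite exprMn sqr_sqrtr.
    have hi' : \int[Q]_x s x ^+ 2 <= la ^+ 2.
      apply: le_trans hi _; rewrite la2 ler_wpM2l ?sqr_ge0// ler_nat; exact: ltnW.
    apply: (@le_trans _ _ ((2 * la)^-1 * la ^+ 2 + la / 2)).
      by rewrite lerD2r ler_wpM2l// invr_ge0 mulr_ge0// ltW.
    by rewrite le_eqVlt; apply/orP; left; apply/eqP; field; rewrite gt_eqF.
  have tau_k : Num.sqrt k%:R <= tau.
    by rewrite -(ger0_norm (ltW tau_gt0)) -sqrtr_sqr ler_wsqrtr.
  have Vn1 : V / tau * \int[Q]_x `|s x| <= V * b.
    rewrite -mulrA ler_wpM2l ?(ltW V_gt0)// ler_pdivrMl//.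
    apply: le_trans n1_le _; rewrite /la mulrC ler_wpM2r//; exact: ltW.
  rewrite sdlE ez -[i.+1%:R]natr1 [leRHS]mulrDr mulr1; move: hph hi; rewrite ltr_norml.
  move=> /andP[hph _] hi.
  have -> : \int[Q]_x s x ^+ 2 + 2 * (V * - `|z| - \int[Q]_x (s x * H x)) +
    \int[Q]_x dl x ^+ 2 = \int[Q]_x s x ^+ 2 +
    (2 * (V * - `|z| - \int[Q]_x (s x * H x)) + \int[Q]_x dl x ^+ 2) by ring.
  apply: lerD => //; apply: le_trans (lerD (lexx _) dl2) _.
  apply: (@le_trans _ _ (2 * (V * b + 1) + (V + M) ^+ 2)); first lra.
  have -> : b ^+ 2 = 2 * V * b + (3 * V + M + 2) * (V + M + 2) by rewrite /b; ring.
  have := M_ge0; have := V_gt0; nra.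
exact: gen.
Qed.

End herding.

(** * Fourier representations and duality for Barron functions *)

Section magnitude.
Context {R : realType} {d : nat}.
Variables (mu : complex_measure R d) (F : {finite_measure set (borelRd R d) -> \bar R}).
Hypothesis muF : is_magnitude mu F.
Local Open Scope ereal_scope.

Lemma cm_abs_le_magnitude (A : set (borelRd R d)) : measurable A ->
  (cm_abs mu A)%:E <= F A.
Proof.
move=> mA; rewrite (muF mA); apply: ereal_sup_ge.
pose E (i : nat) : set (borelRd R d) := if i == 0%N then A else set0.
exists (\sum_(0 <= i <oo) (cm_abs mu (E i))%:E).
  exists E => //; split.
  - by move=> i; rewrite /E; case: ifP.
  - apply/trivIsetP => i j _ _; rewrite /E.
    by case: ifP => [/eqP ->|_]; case: ifP => [/eqP ->|_]; rewrite ?set0I ?setI0.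
  - apply/seteqP; split => [x [i _]|x Ax]; last by exists 0%N.
    by rewrite /E; case: ifP.
rewrite (@nneseriesD1 _ _ 0%N)//; last by move=> i _; rewrite lee_fin sqrtr_ge0.
by rewrite leeDl// nneseries_ge0// => i _ _; rewrite lee_fin sqrtr_ge0.
Qed.

(** A Jordan part of [A] is, up to sign, the charge of [A] intersected with a Hahn set, hence at
    most the magnitude of that subset. A bound on [F] thus passes to the four positive measures that
    represent the function. *)
Let fine_le_magnitude (nu : {charge set (borelRd R d) -> \bar R}) :
  (forall A, measurable A -> (`|fine (nu A)| <= cm_abs mu A)%R) ->
  (forall A, measurable A -> jordan_pos (hahnP nu) A <= F A) /\
  (forall A, measurable A -> jordan_neg (hahnP nu) A <= F A).
Proof.
move=> nule.
have [[mP _] [mN _] _ _] := hahnP nu.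
have main A B : measurable A -> measurable B ->
    nu (A `&` B) <= F A /\ - nu (A `&` B) <= F A.
  move=> mA mB; have mAB : measurable (A `&` B) by exact: measurableI.
  have fAB : nu (A `&` B) \is a fin_num by exact: fin_num_measure.
  have h : `|fine (nu (A `&` B))|%:E <= F A.
    apply: (@le_trans _ _ (F (A `&` B))).
      by apply: le_trans (cm_abs_le_magnitude mAB); rewrite lee_fin nule.
    by apply: le_measure; rewrite ?inE//; exact: subIsetl.
  rewrite -(fineK fAB); split; apply: le_trans h; rewrite -?EFinN lee_fin.
    exact: ler_norm.
  by rewrite -normrN ler_norm.
split => A mA.
  rewrite jordan_posE cjordan_posE /crestr0 mem_set// /crestr.
  by have [] := main A _ mA mP.
rewrite jordan_negE cjordan_negE /crestr0 mem_set// /crestr.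
by have [] := main A _ mA mN.
Qed.

Lemma jordan_re_le_magnitude :
  (forall A, measurable A -> jordan_pos (hahnP (re_part mu)) A <= F A) /\
  (forall A, measurable A -> jordan_neg (hahnP (re_part mu)) A <= F A).
Proof.
apply: fine_le_magnitude => A mA.
rewrite -sqrtr_sqr /cm_abs ler_wsqrtr// lerDl; exact: sqr_ge0.
Qed.

Lemma jordan_im_le_magnitude :
  (forall A, measurable A -> jordan_pos (hahnP (im_part mu)) A <= F A) /\
  (forall A, measurable A -> jordan_neg (hahnP (im_part mu)) A <= F A).
Proof.
apply: fine_le_magnitude => A mA.
rewrite -sqrtr_sqr /cm_abs ler_wsqrtr// lerDr; exact: sqr_ge0.
Qed.

End magnitude.

(** The integral of a nonnegative function is a supremum over the simple functions below it. This
    serves the error of the estimator and the integrand of the Barron seminorm, both suprema over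
    uncountable sets. *)
Lemma ge0_le_integral_nonmeasurable d (T : measurableType d) (R : realType)
    (mu : {measure set T -> \bar R}) (f g : T -> \bar R) :
  (forall x, (0 <= f x)%E) -> (forall x, (f x <= g x)%E) ->
  (\int[mu]_x f x <= \int[mu]_x g x)%E.
Proof.
move=> f0 fg; have g0 x : (0 <= g x)%E by exact: le_trans (fg x).
rewrite !ge0_integralTE//; apply: le_ereal_sup => _ [h hf <-].
by exists h => // x; apply: le_trans (hf x) _.
Qed.

Lemma Rintegral_signed_sum d (T : measurableType d) (R : realType)
    (mu : {measure set T -> \bar R}) (f0 f1 f2 f3 f4 : T -> R) :
  mu.-integrable setT (EFin \o f0) -> mu.-integrable setT (EFin \o f1) ->
  mu.-integrable setT (EFin \o f2) -> mu.-integrable setT (EFin \o f3) ->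
  mu.-integrable setT (EFin \o f4) ->
  \int[mu]_x (f0 x + ((f1 x - f2 x) - (f3 x - f4 x))) =
  \int[mu]_x f0 x + ((\int[mu]_x f1 x - \int[mu]_x f2 x) -
    (\int[mu]_x f3 x - \int[mu]_x f4 x)).
Proof.
move=> i0 i1 i2 i3 i4.
have i12 : mu.-integrable setT (EFin \o (fun x => f1 x - f2 x)).
  exact: (integrableB _ i1 i2).
have i34 : mu.-integrable setT (EFin \o (fun x => f3 x - f4 x)).
  exact: (integrableB _ i3 i4).
have i14 : mu.-integrable setT (EFin \o (fun x => (f1 x - f2 x) - (f3 x - f4 x))).
  exact: (integrableB _ i12 i34).
by rewrite RintegralD// RintegralB// !RintegralB.
Qed.

Lemma normr_signed_sum_le (R : realDomainType) (a0 a1 a2 a3 a4 b0 b1 b2 b3 b4 : R) :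
  `|a0| <= b0 -> `|a1| <= b1 -> `|a2| <= b2 -> `|a3| <= b3 -> `|a4| <= b4 ->
  `|a0 + ((a1 - a2) - (a3 - a4))| <= b0 + ((b1 + b2) + (b3 + b4)).
Proof.
move=> h0 h1 h2 h3 h4; apply: le_trans (ler_normD _ _) (lerD h0 _).
apply: le_trans (ler_normB _ _) _; apply: lerD.
  exact: le_trans (ler_normB _ _) (lerD _ _).
exact: le_trans (ler_normB _ _) (lerD _ _).
Qed.

Lemma duality_constant (R : realFieldType) (D c S q : R) :
  0 <= D -> 0 <= c -> 0 <= S -> 0 <= q ->
  2 * S * c + ((D * c * (4 * S + 14 * q) + D * c * (4 * S + 14 * q)) +
    (D * c * (4 * S + 14 * q) + D * c * (4 * S + 14 * q))) <=
  (2 + 56 * D) * c * (S + q).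
Proof.
move=> D0 c0 S0 q0; rewrite -subr_ge0.
have -> : (2 + 56 * D) * c * (S + q) - (2 * S * c + ((D * c * (4 * S + 14 * q) +
    D * c * (4 * S + 14 * q)) + (D * c * (4 * S + 14 * q) + D * c * (4 * S + 14 * q)))) =
  2 * (c * q) + 40 * (D * c * S) by ring.
by rewrite addr_ge0 ?mulr_ge0.
Qed.

Section barron.
Context {R : realType} {d : nat}.

(** The cube contains the unit vectors, so each coordinate of [w] is dominated by the supremum in
    the seminorm; there are [d] of them. *)
Lemma integral_norm1_le (F : {finite_measure set (borelRd R d) -> \bar R}) (c : R) :
  (barron_seminorm (unit_cube R d) F <= c%:E)%E ->
  (\int[F]_w (norm1 w)%:E <= (d%:R * c)%:E)%E.
Proof.
move=> Fc; under eq_integral do rewrite -sumEFin.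
rewrite ge0_integral_sum//; last first.
  move=> j; apply/measurable_EFinP; apply: measurableT_comp => //.
  exact: measurable_coord.
apply: (@le_trans _ _ (\sum_(j < d) c%:E)%E); last first.
  by rewrite sumEFin sumr_const card_ord mulr_natl.
apply: lee_sum => j _; apply: le_trans Fc.
apply: ge0_le_integral_nonmeasurable => w; first by rewrite lee_fin.
apply: ereal_sup_ubound; exists (\row_i (i == j)%:R).
  by move=> i; rewrite mxE; case: (_ == _); rewrite lexx ler01.
rewrite /dotp (bigD1 j)//= big1 ?addr0.
  by rewrite mxE eqxx mulr1.
by move=> i ij; rewrite mxE (negbTE ij) mulr0.
Qed.

Variable Q : probability (borelRd R d) R.
Variables (s : borelRd R d -> R) (Ms : R).
Hypothesis ms : measurable_fun setT s.
Hypothesis s_le : forall x, `|s x| <= Ms.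
Hypothesis s_cube : forall x : borelRd R d, ~ unit_cube R d x -> s x = 0.
Variables (tau S : R).
Hypothesis tau1 : 1 <= tau.
Hypothesis hS : forall v, (forall j, `|v j| <= tau) ->
  `|\int[Q]_x (s x * neuron v x)| <= S.

Let n1 := \int[Q]_x `|s x|.

Let tau_ge0 : 0 <= tau. Proof. exact: le_trans ler01 tau1. Qed.

Let S0 : 0 <= S.
Proof.
by apply: le_trans (normr_ge0 _) (hS (v := fun=> 0) _) => j; rewrite normr0 tau_ge0.
Qed.

Let n10 : 0 <= n1. Proof. exact: Rintegral_ge0. Qed.

Let measurable_dotp_swap :
  measurable_fun setT (fun z : borelRd R d * borelRd R d => dotp z.2 z.1).
Proof.
apply: measurable_sum => j; apply: measurable_funM.
  by apply: (measurableT_comp (measurable_coord j)).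
by apply: (measurableT_comp (measurable_coord j)).
Qed.

Section mixture.
Variables (m : {finite_measure set (borelRd R d) -> \bar R}) (e : R -> R) (B : R).
Hypothesis mB : (\int[m]_w (norm1 w)%:E <= B%:E)%E.
Hypothesis eL : forall x y, `|e x - e y| <= `|x - y|.
Hypothesis e0 : e 0 = 0.
Hypothesis me : measurable_fun setT e.
Hypothesis e2 : forall x, `|e x| <= 2.

Lemma measurable_mixture :
  measurable_fun setT (fun x : borelRd R d => \int[m]_w e (dotp w x)).
Proof.
apply: (@measurable_Rintegral1 _ _ _ _ R Q m (fun z => e (dotp z.2 z.1)) 2) => //.
exact: (measurableT_comp me).
Qed.

Lemma mixture_le x : `|\int[m]_w e (dotp w x)| <= 2 * fine (m setT).
Proof.
have me' : measurable_fun setT (fun w : borelRd R d => e (dotp w x)).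
  apply: (measurableT_comp me); apply: measurable_sum => j.
  by apply: measurable_funM => //; exact: measurable_coord.
have i1 : m.-integrable setT (EFin \o (fun w => e (dotp w x))).
  exact: (bounded_integrable _ (M := 2)).
apply: le_trans (le_normr_Rintegral measurableT i1) _.
rewrite -Rintegral_cst//; apply: le_Rintegral => //.
  exact: integrable_norm.
exact: finite_measure_integrable_cst.
Qed.

(** After exchanging the integrals, [ridge_duality] applies at each frequency, and the factor
    [norm1 w] it carries integrates to at most [B]. The bound on [e] is what makes Fubini
    applicable. *)
Lemma mixture_duality :
  `|\int[Q]_x (s x * \int[m]_w e (dotp w x))| <= B * (4 * S + 14 / tau * n1).
Proof.
pose f (z : borelRd R d * borelRd R d) := s z.1 * e (dotp z.2 z.1).
have mf : measurable_fun setT f.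
  apply: measurable_funM; first exact: measurableT_comp.
  exact: (measurableT_comp me).
have Ms0 : 0 <= Ms by exact: le_trans (normr_ge0 _) (s_le 0).
have fM z : `|f z| <= Ms * 2 by rewrite normrM ler_pM.
have C0 : 0 <= 4 * S + 14 / tau * n1.
  by rewrite addr_ge0 ?mulr_ge0// invr_ge0.
have me' x : measurable_fun setT (fun w : borelRd R d => e (dotp w x)).
  apply: (measurableT_comp me); apply: measurable_sum => j.
  by apply: measurable_funM => //; exact: measurable_coord.
have -> : \int[Q]_x (s x * \int[m]_w e (dotp w x)) = \int[Q]_x \int[m]_w f (x, w).
  apply: eq_Rintegral => x _; rewrite -RintegralZl//.
  exact: (bounded_integrable _ (M := 2)).
rewrite (bounded_fubini Q m mf fM).
have bnd w : `|\int[Q]_x f (x, w)| <= norm1 w * (4 * S + 14 / tau * n1).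
  exact: (@ridge_duality _ _ Q s Ms).
have mJ : measurable_fun setT (fun w => \int[Q]_x f (x, w)).
  apply: (@measurable_Rintegral1 _ _ _ _ R m Q (fun z => f (z.2, z.1)) (Ms * 2)) => //.
  by apply: (measurableT_comp mf); exact: measurable_swap.
have iJ : m.-integrable setT (EFin \o (fun w => \int[Q]_x f (x, w))).
  apply: (@bounded_integrable _ _ _ m _ (Ms * 2)) => // w.
  apply: Rintegral_le_bound => //.
  by apply: (measurableT_comp mf); exact: pair2_measurable.
rewrite -lee_fin; apply: (@le_trans _ _ (\int[m]_w `|\int[Q]_x f (x, w)|%:E)%E).
  rewrite EFin_normr_Rintegral//; apply: le_abse_integral => //.
  exact/measurable_EFinP.
apply: (@le_trans _ _ (\int[m]_w ((4 * S + 14 / tau * n1)%:E * (norm1 w)%:E))%E).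
  apply: ge0_le_integral => //.
  - by apply/measurable_EFinP; apply: measurableT_comp.
  - apply: measurable_funeM; apply/measurable_EFinP; exact: measurable_norm1.
  - move=> w _; rewrite -EFinM lee_fin [leRHS]mulrC; exact: bnd.
have mn : measurable_fun setT (EFin \o (norm1 : borelRd R d -> R)).
  by apply/measurable_EFinP; exact: measurable_norm1.
rewrite ge0_integralZl//; last by move=> w _; rewrite lee_fin norm1_ge0.
by rewrite [B * _]mulrC EFinM lee_wpmul2l.
Qed.

End mixture.

Variables (mu : complex_measure R d) (F : {finite_measure set (borelRd R d) -> \bar R}).
Variables (h : 'rV[R]_d -> R) (c : R).
Hypothesis muF : is_magnitude mu F.
Hypothesis hmu : fourier_representation h mu.
Hypothesis hc : (maxe (barron_seminorm (unit_cube R d) F) `|h 0|%:E <= c%:E)%E.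

(** The mass of [F] is not bounded in terms of [c]. Subtracting 1 leaves a 1-Lipschitz function
    vanishing at 0, like the sine, whose mixtures are controlled by the first moment; [h 0] carries
    the constant. *)
Let e1 (x : R) := cos x - 1.

Let e1L x y : `|e1 x - e1 y| <= `|x - y|.
Proof. by rewrite /e1 (_ : _ - _ = cos x - cos y) ?cos_lip//; ring. Qed.

Let me1 : measurable_fun setT e1.
Proof. by apply: measurable_funB => //; apply: continuous_measurable_fun; exact: continuous_cos. Qed.

Let e12 x : `|e1 x| <= 2.
Proof. by rewrite /e1 ler_norml; have := cos_le1 x; have := cos_geN1 x; lra. Qed.

Let e10 : e1 0 = 0. Proof. by rewrite /e1 cos0 subrr. Qed.

Let msin : measurable_fun setT (@sin R).
Proof. by apply: continuous_measurable_fun; exact: continuous_sin. Qed.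

Let sin2 (x : R) : `|sin x| <= 2.
Proof. by rewrite ler_norml; have := sin_le1 x; have := sin_geN1 x; lra. Qed.

Let dotp0 (w : 'rV[R]_d) : dotp w 0 = 0.
Proof. by rewrite /dotp big1// => j _; rewrite mxE mulr0. Qed.

Let rp := jordan_pos (hahnP (re_part mu)).
Let rn := jordan_neg (hahnP (re_part mu)).
Let ip := jordan_pos (hahnP (im_part mu)).
Let iN := jordan_neg (hahnP (im_part mu)).

Let charge_integralE (nu : {charge set (borelRd R d) -> \bar R}) (e : R -> R) x :
  measurable_fun setT e -> (forall y, `|e y| <= 2) ->
  charge_integral nu (fun w => e (dotp w x)) =
  (\int[jordan_pos (hahnP nu)]_w e (dotp w x) -
   \int[jordan_neg (hahnP nu)]_w e (dotp w x))%:E.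
Proof.
move=> me e2.
have me' : measurable_fun setT (fun w : borelRd R d => e (dotp w x)).
  apply: (measurableT_comp me); apply: measurable_sum => j.
  by apply: measurable_funM => //; exact: measurable_coord.
rewrite /charge_integral EFinB /Rintegral !fineK//; apply: integrable_fin_num => //;
  exact: (bounded_integrable _ (M := 2)).
Qed.

Lemma barron_representation x : h x = h 0 +
  (\int[rp]_w e1 (dotp w x) - \int[rn]_w e1 (dotp w x)
   - (\int[ip]_w sin (dotp w x) - \int[iN]_w sin (dotp w x))).
Proof.
have mcos : measurable_fun setT (@cos R).
  by apply: continuous_measurable_fun; exact: continuous_cos.
have cos2 (y : R) : `|cos y| <= 2.
  by rewrite ler_norml; have := cos_le1 y; have := cos_geN1 y; lra.
have main y : h y = \int[rp]_w cos (dotp w y) - \int[rn]_w cos (dotp w y)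
   - (\int[ip]_w sin (dotp w y) - \int[iN]_w sin (dotp w y)).
  have [+ _] := hmu y.
  by rewrite (charge_integralE _ _ mcos cos2) (charge_integralE _ _ msin sin2) -EFinB => -[].
have cosE (m : {finite_measure set (borelRd R d) -> \bar R}) y :
    \int[m]_w e1 (dotp w y) = \int[m]_w cos (dotp w y) - \int[m]_w cos (dotp w 0).
  have mc z : measurable_fun setT (fun w : borelRd R d => cos (dotp w z)).
    apply: (measurableT_comp mcos); apply: measurable_sum => j.
    by apply: measurable_funM => //; exact: measurable_coord.
  rewrite -RintegralB//; try exact: (bounded_integrable _ (M := 2)).
  by apply: eq_Rintegral => w _; rewrite dotp0 cos0.
have sinE (m : {finite_measure set (borelRd R d) -> \bar R}) : \int[m]_w sin (dotp w 0) = 0.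
  under eq_Rintegral do rewrite dotp0 sin0.
  by rewrite Rintegral_cst// mul0r.
rewrite (main x) (main 0) !cosE !sinE; ring.
Qed.

Lemma measurable_barron : measurable_fun setT (h : borelRd R d -> R).
Proof.
rewrite (_ : h = fun x => h 0 +
  (\int[rp]_w e1 (dotp w x) - \int[rn]_w e1 (dotp w x)
   - (\int[ip]_w sin (dotp w x) - \int[iN]_w sin (dotp w x)))); last first.
  by apply/funext => x; exact: barron_representation.
apply: measurable_funD => //; apply: measurable_funB; apply: measurable_funB;
  exact: measurable_mixture.
Qed.

(** Each of the four Jordan parts contributes [d c (4 S + 14 n1 / tau)], and [h 0], again a multiple
    of the neuron of value 1/2, contributes [2 S c]; the 56 is 4 times 14. *)
Lemma barron_duality :
  `|\int[Q]_x (s x * h x)| <= (2 + 56 * d%:R) * c * (S + tau^-1 * n1).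
Proof.
have [semi h0c] : (barron_seminorm (unit_cube R d) F <= c%:E)%E /\ `|h 0| <= c.
  by move: hc; rewrite ge_max lee_fin => /andP[].
have NF := integral_norm1_le semi.
have c0 : 0 <= c by exact: le_trans h0c.
have mle (m : {finite_measure set (borelRd R d) -> \bar R}) :
    (forall A, measurable A -> (m A <= F A)%E) ->
    (\int[m]_w (norm1 w)%:E <= (d%:R * c)%:E)%E.
  move=> mF; apply: le_trans NF; apply: ge0_le_measure_integral => //.
    by move=> w; rewrite lee_fin norm1_ge0.
  by apply/measurable_EFinP; exact: measurable_norm1.
have [rpF rnF] := jordan_re_le_magnitude muF.
have [ipF inF] := jordan_im_le_magnitude muF.
pose C := d%:R * c * (4 * S + 14 / tau * n1).
have D1 : `|\int[Q]_x (s x * \int[rp]_w e1 (dotp w x))| <= C.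
  by apply: mixture_duality => //; exact: mle.
have D2 : `|\int[Q]_x (s x * \int[rn]_w e1 (dotp w x))| <= C.
  by apply: mixture_duality => //; exact: mle.
have D3 : `|\int[Q]_x (s x * \int[ip]_w sin (dotp w x))| <= C.
  by apply: mixture_duality => //; [exact: mle|exact: sin_lip|exact: sin0].
have D4 : `|\int[Q]_x (s x * \int[iN]_w sin (dotp w x))| <= C.
  by apply: mixture_duality => //; [exact: mle|exact: sin_lip|exact: sin0].
have D0 : `|\int[Q]_x (s x * h 0)| <= 2 * S * c.
  have -> : \int[Q]_x (s x * h 0) = 2 * h 0 * \int[Q]_x (s x * neuron (fun=> 0) x).
    rewrite -RintegralZl//.
      by apply: eq_Rintegral => x _; rewrite neuron_cst0; field.
    apply: (@bounded_integrable _ _ _ Q _ (Ms)).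
      by apply: measurable_funM => //; exact: measurable_neuron.
    by move=> x; rewrite normrM -[leRHS]mulr1 ler_pM// normr_neuron_le1.
  have hI : `|\int[Q]_x (s x * neuron (fun=> 0) x)| <= S.
    by apply: hS => j; rewrite normr0 tau_ge0.
  rewrite 2!normrM (ger0_norm (_ : 0 <= 2 :> R))// mulrAC.
  by rewrite ler_pM ?mulr_ge0// ler_wpM2l.
have int_m (m : {finite_measure set (borelRd R d) -> \bar R}) (e : R -> R) :
    measurable_fun setT e -> (forall y, `|e y| <= 2) ->
    Q.-integrable setT (EFin \o (fun x => s x * \int[m]_w e (dotp w x))).
  move=> me e2; apply: (@bounded_integrable _ _ _ Q _ (Ms * (2 * fine (m setT)))).
    by apply: measurable_funM => //; exact: measurable_mixture.
  by move=> x; rewrite normrM ler_pM// mixture_le.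
have i0 : Q.-integrable setT (EFin \o (fun x => s x * h 0)).
  apply: (@bounded_integrable _ _ _ Q _ (Ms * `|h 0|)); first exact: measurable_funM.
  by move=> x; rewrite normrM ler_wpM2r.
have i1 := int_m rp _ me1 e12.
have i2 := int_m rn _ me1 e12.
have i3 := int_m ip _ msin sin2.
have i4 := int_m iN _ msin sin2.
have -> : \int[Q]_x (s x * h x) = \int[Q]_x (s x * h 0) +
  ((\int[Q]_x (s x * \int[rp]_w e1 (dotp w x)) -
    \int[Q]_x (s x * \int[rn]_w e1 (dotp w x))) -
   (\int[Q]_x (s x * \int[ip]_w sin (dotp w x)) -
    \int[Q]_x (s x * \int[iN]_w sin (dotp w x)))).
  rewrite -(Rintegral_signed_sum i0 i1 i2 i3 i4); apply: eq_Rintegral => x _.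
  by rewrite [h x]barron_representation -!mulrBr -mulrDr.
apply: (@le_trans _ _ (2 * S * c + ((C + C) + (C + C)))).
  exact: normr_signed_sum_le D0 D1 D2 D3 D4.
have tn : 0 <= tau^-1 * n1 by rewrite mulr_ge0// invr_ge0.
have En1 : 14 / tau * n1 = 14 * (tau^-1 * n1) by rewrite mulrA.
by rewrite /C En1; exact: duality_constant.
Qed.

End barron.

Section risk_of_versions.
Context {R : realType} {d : nat}.
Variables (P Q : probability (borelRd R d) R).
Hypothesis PQ : chi2_pair (unit_cube R d) P Q.

Lemma ae_unit_cube : {ae Q, forall x, unit_cube R d x}.
Proof.
have [_ QK _ _] := PQ.
exists (~` (unit_cube R d : set (borelRd R d))); split => //.
  by apply: measurableC; exact: measurable_unit_cube.
have := probability_setC Q (measurable_unit_cube (R := R) (d := d)).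
by move=> ->; rewrite QK subee.
Qed.

Lemma risk_ae_eq (f : 'rV[R]_d -> R) (u H : borelRd R d -> R) :
  fchi2_version (unit_cube R d) P Q f ->
  measurable_fun setT u -> measurable_fun setT H ->
  (forall x, unit_cube R d x -> H x = f x) ->
  risk P Q u = \int[Q]_x (u x - H x) ^+ 2.
Proof.
move=> fv mu mH Hf; congr fine; apply: ae_eq_integral => //.
- apply/measurable_EFinP/measurable_funX/measurable_funB => //.
  apply: measurable_funM => //; apply: measurable_funB => //.
  exact: measurable_density PQ.
- by apply/measurable_EFinP/measurable_funX/measurable_funB.
apply: (@filterS2 _ _ (ae_filter_ringOfSetsType Q) _ _ _ _ ae_unit_cube fv) => x Kx h _.
by rewrite Hf// h.
Qed.

End risk_of_versions.

Section barron_risk.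
Context {R : realType} {d : nat}.

Lemma neural_nets0 (k : nat) (a1 a2 a3 : R) : 0 <= a1 -> 0 <= a2 -> 0 <= a3 ->
  neural_nets R d k a1 a2 a3 (fun=> 0).
Proof.
move=> a10 a20 a30; exists (fun=> 0), (fun=> 0), (fun=> 0), 0; split.
- by move=> i; split=> [j|]; rewrite ?mxE normr0.
- by move=> i; rewrite normr0.
- by rewrite normr0.
- by move=> x; rewrite addr0 big1// => i _; rewrite mul0r.
Qed.

Lemma neuron_dotp v (x : 'rV[R]_d) :
  neuron v x = logistic (dotp (\row_j v (Some j)) x + v None).
Proof.
by rewrite /neuron /dotp; under [in RHS]eq_bigr do rewrite mxE.
Qed.

Lemma masked_neuron_le1 v (x : borelRd R d) : `|masked (neuron v) x| <= 1.
Proof.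
by rewrite normrM -[leRHS]mulr1 ler_pM ?normr_neuron_le1// indicE;
  case: (_ \in _); rewrite ?normr0 ?normr1.
Qed.

Lemma masked_supp (g : 'rV[R]_d -> R) x : ~ unit_cube R d x -> masked g x = 0.
Proof. by move=> nK; rewrite /masked indicE memNset// mul0r. Qed.

Lemma masked_in (g : 'rV[R]_d -> R) x : unit_cube R d x -> masked g x = g x.
Proof. by move=> Kx; rewrite /masked indicE mem_set// mul1r. Qed.

Lemma measurable_masked (g : 'rV[R]_d -> R) :
  measurable_fun setT (g : borelRd R d -> R) -> measurable_fun setT (masked g).
Proof. by move=> mg; apply: measurable_funM => //; exact: measurable_indic_cube. Qed.

Variables (P Q : probability (borelRd R d) R).
Hypothesis PQ : chi2_pair (unit_cube R d) P Q.

(** Herding with outer weights [V / k] in modulus at most. The condition [V <= ln k] acts twice: it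
    fits these weights under the allowed [ln k / k], and with [1 <= V] it gives [k <= tau ^ 2], the
    hypothesis of [herding]. *)
Lemma barron_net_risk (f h : 'rV[R]_d -> R) (M c V : R) (k : nat) :
  fchi2_version (unit_cube R d) P Q f ->
  (forall x, unit_cube R d x -> `|f x| <= M) ->
  (forall x, unit_cube R d x -> f x = h x) ->
  barron_class (unit_cube R d) c h -> 0 <= M -> 0 <= c ->
  V = (2 + 56 * d%:R) * c + 1 -> V <= ln k%:R ->
  exists2 g, neural_nets_star R d k (2^-1 * ln k%:R) g &
    risk P Q (masked g) <= (3 * V + M + 2) ^+ 2 / k%:R.
Proof.
move=> fv fM fh [mu [F [muF hmu hc]]] M0 c0 VE Vk.
have V1 : 1 <= V by rewrite VE lerDr !mulr_ge0// addr_ge0// mulr_ge0.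
have V0 : 0 < V by exact: lt_le_trans V1.
have lk1 : 1 <= ln (k%:R : R) by exact: le_trans V1 Vk.
have k0 : (0 < k)%N.
  by case: k lk1 {Vk} => //; rewrite ln0// ler10.
have k0' : (0 : R) < k%:R by rewrite ltr0n.
pose tau : R := Num.sqrt k%:R * ln k%:R.
have sk1 : 1 <= Num.sqrt k%:R :> R.
  by rewrite -[leLHS]sqrtr1 ler_wsqrtr// ler1n.
have tau1 : 1 <= tau by rewrite -[leLHS]mulr1 ler_pM.
have tau0 : 0 < tau by exact: lt_le_trans tau1.
have ktau : k%:R <= tau ^+ 2.
  by rewrite exprMn sqr_sqrtr// ler_peMr// ?ler0n// exprn_ege1.
pose I := {v : option 'I_d -> R | forall j, `|v j| <= tau}.
have P0 : forall j : option 'I_d, `|(0 : R)| <= tau by move=> j; rewrite normr0 ltW.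
pose i0 : I := exist _ (fun=> 0) P0.
pose phi (i : I) : borelRd R d -> R := masked (neuron (sval i)).
have mh : measurable_fun setT (h : borelRd R d -> R) by exact: measurable_barron hmu.
pose H : borelRd R d -> R := masked h.
have mH : measurable_fun setT H by exact: measurable_masked.
have H_le x : `|H x| <= M.
  have [Kx|nK] := pselect (unit_cube R d x); last by rewrite /H masked_supp// normr0.
  by rewrite /H masked_in// -fh// fM.
have s_masked (s : borelRd R d -> R) (g : 'rV[R]_d -> R) x :
    (forall x, ~ unit_cube R d x -> s x = 0) -> s x * masked g x = s x * g x.
  move=> sK; have [Kx|nK] := pselect (unit_cube R d x); first by rewrite masked_in.
  by rewrite sK// !mul0r.
have dual (s : borelRd R d -> R) (Ms S : R) : measurable_fun setT s ->
  (forall x, `|s x| <= Ms) -> (forall x, ~ unit_cube R d x -> s x = 0) ->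
  (forall i, `|\int[Q]_x (s x * phi i x)| <= S) ->
  `|\int[Q]_x (s x * H x)| <= V * (S + tau^-1 * \int[Q]_x `|s x|).
  move=> ms sM sK hS; rewrite (@eq_Rintegral _ _ _ Q setT (fun x => s x * h x)); last first.
    by move=> x _; exact: s_masked.
  have hS' v : (forall j, `|v j| <= tau) -> `|\int[Q]_x (s x * neuron v x)| <= S.
    move=> v1; have := hS (exist _ v v1).
    rewrite (@eq_Rintegral _ _ _ Q setT (fun x => s x * neuron v x))//.
    by move=> x _; exact: s_masked.
  apply: le_trans (barron_duality ms sM sK tau1 hS' muF hmu hc) _.
  rewrite ler_wpM2r//; last by rewrite VE lerDl.
  have S0 : 0 <= S by apply: le_trans (hS i0).
  by rewrite addr_ge0// mulr_ge0 ?invr_ge0 ?(ltW tau0)// Rintegral_ge0.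
have mphi i : measurable_fun setT (phi i).
  by apply: measurable_masked; exact: measurable_neuron.
have phi1 i x : `|phi i x| <= 1 by exact: masked_neuron_le1.
have phiK i x : ~ unit_cube R d x -> phi i x = 0 by exact: masked_supp.
have HK x : ~ unit_cube R d x -> H x = 0 by exact: masked_supp.
have [th [eps [eps1 hb]]] := herding i0 mphi phi1 phiK mH H_le HK V0 tau0 dual k0 ktau.
pose g (x : 'rV[R]_d) := \sum_(i < k) (eps i * V / k%:R) * neuron (sval (th i)) x.
exists g.
  exists (fun i => \row_j sval (th i) (Some j)), (fun i => sval (th i) None),
    (fun i => eps i * V / k%:R), 0; split.
  - by move=> i; split=> [j|]; rewrite ?mxE; exact: (svalP (th i)).
  - move=> i; rewrite !normrM normfV (gtr0_norm V0) (gtr0_norm k0').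
    have -> : 2 * k%:R^-1 * (2^-1 * ln k%:R) = 1 * ln k%:R / k%:R :> R.
      by field; rewrite gt_eqF.
    by rewrite ler_wpM2r ?invr_ge0// ler_pM// ltW.
  - by rewrite normr0 mulr_ge0// ltW// (lt_le_trans _ lk1).
  - by move=> x; rewrite addr0; apply: eq_bigr => i _; rewrite neuron_dotp.
have mg : measurable_fun setT (masked g).
  apply: measurable_masked; apply: measurable_sum => i; apply: measurable_funM => //.
  exact: measurable_neuron.
rewrite (risk_ae_eq PQ fv mg mH); last by move=> x Kx; rewrite /H masked_in// fh.
have -> : (fun x => (masked g x - H x) ^+ 2) = (fun x => k%:R ^- 2 *
    (\sum_(i < k) (eps i * V * phi (th i) x - H x)) ^+ 2).
  apply/funext => x; rewrite -exprVn -exprMn; congr (_ ^+ 2).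
  have -> : \sum_(i < k) (eps i * V * phi (th i) x - H x) =
      \sum_(i < k) eps i * V * phi (th i) x - k%:R * H x.
    by rewrite sumrB sumr_const card_ord mulr_natl.
  rewrite mulrBr mulKf ?gt_eqF//.
  congr (_ - _); rewrite /masked /g !mulr_sumr; apply: eq_bigr => i _.
  by rewrite /phi /masked; ring.
rewrite RintegralZl//; last first.
  apply: (@bounded_integrable _ _ _ Q _ ((\sum_(i < k) (V + M)) ^+ 2)).
    apply: measurable_funX; apply: measurable_sum => i; apply: measurable_funB => //.
    exact: measurable_funM.
  move=> x; rewrite normrX lerXn2r ?nnegrE//.
    by apply: sumr_ge0 => i _; rewrite addr_ge0// ltW.
  apply: le_trans (ler_norm_sum _ _ _) _; apply: ler_sum => i _.
  apply: le_trans (ler_normB _ _) (lerD _ (H_le x)).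
  rewrite normrM -[leRHS]mulr1 ler_pM// normrM (gtr0_norm V0) -[leRHS]mul1r.
  by rewrite ler_wpM2r// ltW.
apply: (@le_trans _ _ (k%:R ^- 2 * ((3 * V + M + 2) ^+ 2 * k%:R))).
  by rewrite ler_wpM2l// invr_ge0 exprn_ge0.
by rewrite le_eqVlt; apply/orP; left; apply/eqP; field; rewrite gt_eqF.
Qed.

(** For large [k] herding gives the rate [1 / k], better than required. When [ln k < V] the zero
    network is used: [k^(-1/2)] then exceeds [expR (- V / 2)], so its fixed risk is absorbed by the
    constant. *)
Lemma barron_ball_risk (f : 'rV[R]_d -> R) (M : R) :
  fchi2_version (unit_cube R d) P Q f -> barron_ball (unit_cube R d) M f ->
  exists2 C : R, 0 <= C & forall k, (0 < k)%N ->
    exists2 g, neural_nets_star R d k (2^-1 * ln k%:R) g &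
      risk P Q (masked g) <= C * k%:R `^ (- 2^-1).
Proof.
move=> fv; rewrite /barron_ball /= ge_max => /andP[hM sM].
have fM x : unit_cube R d x -> `|f x| <= M.
  move=> Kx; rewrite -lee_fin; apply: le_trans sM.
  by apply: ereal_sup_ubound; exists x.
have M0 : 0 <= M.
  apply: le_trans (normr_ge0 _) (fM 0 _) => j.
  by rewrite mxE lexx ler01.
have [c c0 [h hB fh]] : exists2 c : R, 0 <= c &
    exists2 h, barron_class (unit_cube R d) c h &
      forall x, unit_cube R d x -> f x = h x.
  (* The infimum need not be attained, so a strictly larger radius is taken. *)
  have : (barron_constant (unit_cube R d) f < (M + 1)%:E)%E.
    by apply: le_lt_trans hM _; rewrite lte_fin ltrDl.
  by move=> /ereal_inf_lt[_ [c [c0 cP] <-] _]; exists c.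
pose V : R := (2 + 56 * d%:R) * c + 1.
pose r0 := risk P Q (masked (fun=> 0)).
have r00 : 0 <= r0 by exact: risk_ge0.
exists ((3 * V + M + 2) ^+ 2 + r0 * expR (V / 2)).
  by rewrite addr_ge0 ?sqr_ge0// mulr_ge0// expR_ge0.
move=> k k0; have k0' : (0 : R) < k%:R by rewrite ltr0n.
have k1 : (1 : R) <= k%:R by rewrite ler1n.
have lk0 : 0 <= ln (k%:R : R) by rewrite ln_ge0.
have [Vk|kV] := leP V (ln k%:R).
  have [g gN gr] := barron_net_risk fv fM fh hB M0 c0 erefl Vk.
  exists g => //; apply: le_trans gr _.
  rewrite [leRHS]mulrDl -[leLHS]addr0 lerD ?mulr_ge0 ?expR_ge0 ?powR_ge0//.
  rewrite ler_wpM2l ?sqr_ge0//.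
  by rewrite -powR_inv1 ?ler0n// ler_powR//; lra.
exists (fun=> 0).
  by apply: neural_nets0; rewrite ?mulr_ge0 ?sqrtr_ge0 ?invr_ge0.
rewrite -/r0 [leRHS]mulrDl; apply: ler_wpDl.
  by apply: mulr_ge0; [exact: sqr_ge0|exact: powR_ge0].
rewrite -mulrA -[leLHS]mulr1 ler_wpM2l// /powR gt_eqF// -expRD -[leLHS]expR0 ler_expR.
by rewrite mulNr subr_ge0 [leRHS]mulrC ler_wpM2l ?invr_ge0// ltW.
Qed.

End barron_risk.

(** * Uniform deviation and expected error *)

Section uniform_deviation.
Context {R : realType} {d : nat} (dT : measure_display) (T : measurableType dT).
Variables (PP : probability T R) (P : probability (borelRd R d) R).
Variable X : nat -> {RV PP >-> borelRd R d}.
Hypothesis X_iid : iid_sample X P.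

Let J : finType := (option 'I_d + option 'I_d)%type.
Let D := #|J|.
(** Chaining asks for [D < m] and the expected error for [2 * D <= m]. Almost sure convergence asks
    for more: the means, of order [n^(-m)], must leave [n^(-18 D)] after a summation over [n], to be
    compared with [(n^(1/5))^(-4 m) = n^(-16 D)]. *)
Let m := (20 * D)%N.

Let D_gt0 : (0 < D)%N.
Proof. by apply/card_gt0P; exists (inl None). Qed.

Let m_gt0 : (0 < m)%N. Proof. by rewrite muln_gt0. Qed.

Let D_lt_m : (D < m)%N. Proof. by rewrite ltn_Pmull. Qed.

Definition neuron_chaining (A n : nat) : T -> \bar R :=
  chaining_functional P X (@neuron_pair R d) (20 * #|J|) A n.

Definition chaining_constant : R :=
  2 * (2 * m)%:R ^+ (2 * m) * expR 2 * 4 ^+ m *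
    (3 ^+ D + 2 * 6 ^+ D * (2 * d.+1%:R) ^+ (2 * m)).

Lemma chaining_constant_ge0 : 0 <= chaining_constant.
Proof.
apply: mulr_ge0; first by rewrite !mulr_ge0 ?exprn_ge0 ?expR_ge0.
by rewrite addr_ge0 ?exprn_ge0// mulr_ge0 ?mulr_ge0 ?exprn_ge0 ?mulr_ge0.
Qed.

Lemma neuron_chaining_ge0 A n t : (0 <= neuron_chaining A n t)%E.
Proof. exact: chaining_functional_ge0. Qed.

Lemma measurable_neuron_chaining A n : measurable_fun setT (neuron_chaining A n).
Proof.
apply: measurable_chaining_functional; exact: measurable_neuron_pair.
Qed.

Lemma integral_neuron_chaining A n : (0 < A)%N -> (0 < n)%N ->
  (\int[PP]_t neuron_chaining A n t <=
   (chaining_constant * A%:R ^+ D / n%:R ^+ m)%:E)%E.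
Proof.
move=> A0 n0.
by apply: integral_chaining_functional => //; [exact: measurable_neuron_pair|
  exact: neuron_pair_le1|exact: neuron_pair_lip].
Qed.

(** Since [y <= (1 + y) ^ (2 m)], the deviation is bounded by an affine function of the chaining
    functional, measured in units of [a0 ^ (2 m)]. Its mean can then be taken directly, without
    roots. *)
Lemma neuron_deviation_le A n t (a0 y : R) : (0 < n)%N -> 0 < a0 -> 0 <= y ->
  (neuron_chaining A n t <= (y * a0 ^+ (2 * m))%:E)%E ->
  forall th, (forall j, `|th j| <= A%:R) ->
  `|empirical_deviation P X n (neuron_pair th) t| <= 5 * (a0 * (1 + y)).
Proof.
move=> n0 a00 y0 hG.
apply: (deviation_le_chaining (@measurable_neuron_pair R d) (@neuron_pair_le1 R d)
  (@neuron_pair_lip R d) D_lt_m n0).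
  by rewrite mulr_ge0 ?addr_ge0// ltW.
apply: le_trans hG _; rewrite lee_fin exprMn mulrC.
rewrite ler_wpM2l ?exprn_ge0 ?(ltW a00)//.
apply: (@le_trans _ _ (1 + y)); first by rewrite lerDr.
by rewrite ler_eXnr ?muln_gt0 ?m_gt0// lerDl.
Qed.

Lemma sample_in_cube : P (unit_cube R d) = 1%E ->
  exists N : set T, [/\ measurable N, PP N = 0%E &
    forall t i, ~ N t -> unit_cube R d (X i t)].
Proof.
move=> PK; pose N i := X i @^-1` (~` unit_cube R d).
have mK := @measurable_unit_cube R d.
have mKC : measurable (~` unit_cube R d : set (borelRd R d)) by exact: measurableC.
have mN i : measurable (N i).
  by rewrite /N -[_ @^-1` _]setTI; apply: measurable_funP.
have N0 i : PP (N i) = 0%E.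
  rewrite [LHS](X_iid.1 i _ mKC).
  by rewrite [LHS](probability_setC P mK) PK subee.
exists (\bigcup_i N i); split.
- exact: bigcupT_measurable.
- apply: measure_negligible; first exact: bigcupT_measurable.
  by apply: negligible_bigcup => i; exists (N i); split; [exact: mN|exact: N0|].
- move=> t i nN; apply: contrapT => nK; apply: nN.
  by exists i.
Qed.

End uniform_deviation.

Section expected_error.
Context {R : realType} {d : nat} (dT : measure_display) (T : measurableType dT).
Variables (PP : probability T R) (P Q : probability (borelRd R d) R).
Hypothesis PQ : chi2_pair (unit_cube R d) P Q.
Variables X Y : nat -> {RV PP >-> borelRd R d}.
Hypothesis X_iid : iid_sample X P.
Hypothesis Y_iid : iid_sample Y Q.

Let J : finType := (option 'I_d + option 'I_d)%type.
Let D := #|J|.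
Let m := (20 * D)%N.
(** For [k >= 2] one has [ln k <= (ln k)^2 / ln 2], so this constant absorbs the linear term of the
    error. *)
Let c4 : R := 4 / ln 2 + 1.

Let ln2_gt0 : 0 < ln (2 : R). Proof. by rewrite ln_gt0// ltr1n. Qed.

Let c4_gt0 : 0 < c4. Proof. by rewrite addr_gt0// divr_gt0. Qed.

Let ln_sqr_bound k : (1 < k)%N -> 4 * ln k%:R + ln k%:R ^+ 2 <= c4 * ln k%:R ^+ 2 :> R.
Proof.
move=> k1; have l2 : ln 2 <= ln k%:R :> R.
  by rewrite ler_ln ?posrE ?ltr0n ?ler_nat// ltnW.
rewrite /c4 [leRHS]mulrDl [X in _ <= _ + X]mul1r lerD2r.
have -> : 4 / ln 2 * ln k%:R ^+ 2 = 4 * ln k%:R * (ln k%:R / ln 2) :> R by ring.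
rewrite ler_peMr ?ler_pdivlMr// ?mul1r// mulr_ge0//.
exact: le_trans (ltW ln2_gt0) l2.
Qed.

Let err k n t := (`| chi2_estimator (neural_nets_star R d k (2^-1 * ln k%:R))
  (fun i : 'I_n => X i t) (fun i : 'I_n => Y i t) - chi2 P Q |)%E.

Let GX k n := neuron_chaining P X (k ^ 2) n.
Let GY k n := neuron_chaining Q Y (k ^ 2) n.
(** The target rate permits the extra [sqrt k]. Raised to the power [2 m] it becomes [k ^ m], which
    absorbs the [k ^ (2 D)] caused by a box of half-width [k ^ 2], an integer above
    [sqrt k * ln k]. *)
Let a0 (k n : nat) : R := Num.sqrt (k%:R / n%:R).

Variable Cr : R.
Hypothesis Cr0 : 0 <= Cr.
Hypothesis small_risk : forall k, (0 < k)%N ->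
  exists2 g, neural_nets_star R d k (2^-1 * ln k%:R) g &
    risk P Q (masked g) <= Cr * k%:R `^ (- 2^-1).

Let err_bound k n t : \bar R :=
  ((4^-1 * (Cr * k%:R `^ (- 2^-1)))%:E + (c4 * ln k%:R ^+ 2 * (5 * a0 k n))%:E *
    (2%:E + ((a0 k n ^+ (2 * m))^-1)%:E * (GX k n t + GY k n t)))%E.

Let a0_gt0 k n : (0 < k)%N -> (0 < n)%N -> 0 < a0 k n.
Proof. by move=> k0 n0; rewrite sqrtr_gt0 divr_gt0// ltr0n. Qed.

Lemma pointwise_error k n t : (0 < k)%N -> (0 < n)%N ->
  (forall i, unit_cube R d (X i t)) -> (forall i, unit_cube R d (Y i t)) ->
  (err k n t <= err_bound k n t)%E.
Proof.
move=> k0 n0 XK YK.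
have k0' : (0 : R) < k%:R by rewrite ltr0n.
have lk0 : 0 <= ln k%:R :> R by rewrite ln_ge0// ler1n.
have a1 : 0 <= Num.sqrt k%:R * ln k%:R :> R by rewrite mulr_ge0 ?sqrtr_ge0.
have lk : ln k%:R <= k%:R :> R.
  exact: ltW (ln_sublinear k0').
have box : Num.sqrt k%:R * ln k%:R <= (k ^ 2)%:R :> R.
  rewrite natrX expr2 ler_pM ?sqrtr_ge0//.
  rewrite -[leRHS]ger0_norm ?(ltW k0')// -sqrtr_sqr ler_wsqrtr//.
  by rewrite expr2 ler_peMr ?(ltW k0')// ler1n.
have main SP SQ := @chi2_estimator_error _ _ _ _ PQ _ _ _ X Y k n
  (Num.sqrt k%:R * ln k%:R) (2 * k%:R^-1 * (2^-1 * ln k%:R)) (2^-1 * ln k%:R)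
  SP SQ _ t (fun i => XK i) (fun i => YK i) a1.
have LE : k%:R * (2 * k%:R^-1 * (2^-1 * ln k%:R)) + 2 * (2^-1 * ln k%:R) =
    2 * ln k%:R :> R by field; rewrite gt_eqF.
rewrite LE in main.
have aa := a0_gt0 k0 n0.
have am : 0 < a0 k n ^+ (2 * m) by rewrite exprn_gt0.
have GX0 : (0 <= GX k n t)%E by exact: neuron_chaining_ge0.
have GY0 : (0 <= GY k n t)%E by exact: neuron_chaining_ge0.
have w0 : 0 <= c4 * ln k%:R ^+ 2 * (5 * a0 k n).
  by rewrite !mulr_ge0 ?sqr_ge0// ltW.
(* At [k = 1] the logarithm vanishes, all outer weights are zero and any bound on the pairs will
   do. *)
have [k1|k1] := leqP k 1.
  have k1' : k = 1%N by apply/eqP; rewrite eqn_leq k1.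
  have lE : ln k%:R = 0 :> R by rewrite k1' ln1.
  have triv PP' X' : forall th, (forall j, `|th j| <= Num.sqrt k%:R * ln k%:R) ->
      `|@empirical_deviation R dT _ T _ PP PP' X' n (@neuron_pair R d th) t| <= 2 * 1.
    move=> th _; apply: empirical_deviation_le => //.
      exact: measurable_neuron_pair.
    by move=> x; exact: neuron_pair_le1.
  apply: le_trans (main _ _ _ (triv P X) (triv Q Y) (small_risk k0)) _.
  rewrite [X in (X%:E <= _)%E](_ : _ = 4^-1 * (Cr * k%:R `^ (- 2^-1))); last first.
    by rewrite lE; ring.
  rewrite /err_bound leeDl//; apply: mule_ge0; first by rewrite lee_fin.
  apply: adde_ge0; first by rewrite lee_fin.
  by apply: mule_ge0; [rewrite lee_fin invr_ge0 ltW|exact: adde_ge0].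
have lpos : 0 < ln k%:R :> R by rewrite ln_gt0// ltr1n.
(* Now [ln k > 0], so the coefficient of the functionals is positive and an infinite functional
   makes the bound infinite. *)
have [Gfin|Ginf] := boolP ((GX k n t + GY k n t)%E \is a fin_num); last first.
  have Goo : (GX k n t + GY k n t = +oo)%E.
    by move: Ginf (adde_ge0 GX0 GY0); case: (GX k n t + GY k n t)%E.
  have wp : (0 < (c4 * ln k%:R ^+ 2 * (5 * a0 k n))%:E)%E.
    by rewrite lte_fin mulr_gt0// mulr_gt0// exprn_gt0.
  rewrite /err_bound Goo gt0_muley ?lte_fin ?invr_gt0// [(2%:E + _)%E]addey//.
  by rewrite gt0_muley// addey// leey.
move: Gfin; rewrite fin_numD => /andP[GXf GYf].
set gx := fine (GX k n t); set gy := fine (GY k n t).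
have gx0 : 0 <= gx by rewrite fine_ge0.
have gy0 : 0 <= gy by rewrite fine_ge0.
pose b := (a0 k n ^+ (2 * m))^-1.
have b0 : 0 <= b by rewrite invr_ge0 ltW.
have dX th : (forall j, `|th j| <= Num.sqrt k%:R * ln k%:R) ->
    `|empirical_deviation P X n (neuron_pair th) t| <= 5 * (a0 k n * (1 + b * gx)).
  move=> hth; apply: (neuron_deviation_le (A := k ^ 2) n0 aa) => //.
  - by rewrite mulr_ge0.
  - by rewrite mulrAC mulVf ?gt_eqF// mul1r fineK.
  - by move=> j; exact: le_trans (hth j) box.
have dY th : (forall j, `|th j| <= Num.sqrt k%:R * ln k%:R) ->
    `|empirical_deviation Q Y n (neuron_pair th) t| <= 5 * (a0 k n * (1 + b * gy)).
  move=> hth; apply: (neuron_deviation_le (A := k ^ 2) n0 aa) => //.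
  - by rewrite mulr_ge0.
  - by rewrite mulrAC mulVf ?gt_eqF// mul1r fineK.
  - by move=> j; exact: le_trans (hth j) box.
apply: le_trans (main _ _ _ dX dY (small_risk k0)) _.
have -> : err_bound k n t = (4^-1 * (Cr * k%:R `^ (- 2^-1)) +
    c4 * ln k%:R ^+ 2 * (5 * a0 k n) * (2 + b * (gx + gy)))%:E.
  by rewrite EFinD (EFinM _ (2 + _)) (EFinD 2) (EFinM b) (EFinD gx) !fineK.
rewrite lee_fin.
rewrite addrC lerD2l.
set SP := 5 * (a0 k n * (1 + b * gx)); set SQ := 5 * (a0 k n * (1 + b * gy)).
have SP0 : 0 <= SP by rewrite !mulr_ge0 ?addr_ge0 ?mulr_ge0// ltW.
have SQ0 : 0 <= SQ by rewrite !mulr_ge0 ?addr_ge0 ?mulr_ge0// ltW.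
have -> : c4 * ln k%:R ^+ 2 * (5 * a0 k n) * (2 + b * (gx + gy)) =
   c4 * ln k%:R ^+ 2 * (SP + SQ) by rewrite /SP /SQ; ring.
apply: (@le_trans _ _ ((4 * ln k%:R + ln k%:R ^+ 2) * (SP + SQ))); last first.
  by rewrite ler_wpM2r ?ln_sqr_bound// addr_ge0.
rewrite -subr_ge0 (_ : _ - _ = ln k%:R ^+ 2 * SP); last by field.
by rewrite mulr_ge0 ?sqr_ge0.
Qed.

Lemma expected_error : exists C : R, forall k n, (0 < k)%N -> (0 < n)%N ->
  (\int[PP]_t err k n t <=
   (C * (k%:R `^ (- 2^-1) +
      Num.sqrt k%:R * ln k%:R ^+ 2 * n%:R `^ (- 2^-1)))%:E)%E.
Proof.
pose Cch : R := @chaining_constant R d.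
have Cch0 : 0 <= Cch by exact: chaining_constant_ge0.
exists (4^-1 * Cr + c4 * 5 * (2 + 2 * Cch)) => k n k0 n0.
have k0' : (0 : R) < k%:R by rewrite ltr0n.
have n0' : (0 : R) < n%:R by rewrite ltr0n.
have lk0 : 0 <= ln k%:R :> R by rewrite ln_ge0// ler1n.
have [PK QK _ _] := PQ.
have [NX [mNX NX0 hNX]] := sample_in_cube X_iid PK.
have [NY [mNY NY0 hNY]] := sample_in_cube Y_iid QK.
have aa := a0_gt0 k0 n0.
have am : 0 < a0 k n ^+ (2 * m) by rewrite exprn_gt0.
have GX0 t : (0 <= GX k n t)%E by exact: neuron_chaining_ge0.
have GY0 t : (0 <= GY k n t)%E by exact: neuron_chaining_ge0.
have mGX : measurable_fun setT (GX k n) by exact: measurable_neuron_chaining.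
have mGY : measurable_fun setT (GY k n) by exact: measurable_neuron_chaining.
have w0 : 0 <= c4 * ln k%:R ^+ 2 * (5 * a0 k n).
  by rewrite !mulr_ge0 ?sqr_ge0// ltW.
have c0 : 0 <= 4^-1 * (Cr * k%:R `^ (- 2^-1)) by rewrite !mulr_ge0 ?powR_ge0.
pose G t := (GX k n t + GY k n t)%E.
have G0 t : (0 <= G t)%E by rewrite adde_ge0.
have mG : measurable_fun setT G by exact: emeasurable_funD.
have b0 : 0 <= (a0 k n ^+ (2 * m))^-1 by rewrite invr_ge0 ltW.
pose U t := (2%:E + ((a0 k n ^+ (2 * m))^-1)%:E * G t)%E.
have U0 t : (0 <= U t)%E by rewrite adde_ge0// mule_ge0.
have mbG : measurable_fun setT (fun t => (((a0 k n ^+ (2 * m))^-1)%:E * G t)%E).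
  exact: measurable_funeM.
have mU : measurable_fun setT U by exact: emeasurable_funD.
have eb0 t : (0 <= err_bound k n t)%E.
  apply: adde_ge0; first by rewrite lee_fin.
  by apply: mule_ge0; [rewrite lee_fin|exact: U0].
have mwU : measurable_fun setT (fun t => ((c4 * ln k%:R ^+ 2 * (5 * a0 k n))%:E * U t)%E).
  exact: measurable_funeM.
have meb : measurable_fun setT (err_bound k n) by exact: emeasurable_funD.
pose N := NX `|` NY.
have mN : measurable N by exact: measurableU.
have N0 : PP N = 0%E.
  by apply: null_set_setU.
(* The pointwise bound requires all observations in the cube; the value [+oo] on the null set [N]
   makes the majorant valid everywhere and adds nothing to its integral. *)
apply: (@le_trans _ _ (\int[PP]_t (err_bound k n t + +oo * (\1_N t)%:E))%E).
  apply: ge0_le_integral_nonmeasurable => t; first exact: abse_ge0.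
  have [Nt|nNt] := pselect (N t).
    by rewrite indicE mem_set// mule1 addey ?leey// gt_eqF// (lt_le_trans _ (eb0 t)) ?ltNyr.
  rewrite indicE memNset// mule0 adde0; apply: pointwise_error => // i.
    by apply: hNX => h; apply: nNt; left.
  by apply: hNY => h; apply: nNt; right.
have mI : measurable_fun setT (fun t => (+oo * (\1_N t)%:E : \bar R)%E).
  by apply: measurable_funeM; apply/measurable_EFinP; exact: measurable_indic.
rewrite ge0_integralD//.
have -> : (\int[PP]_t (+oo * (\1_N t)%:E) = 0 :> \bar R)%E.
  rewrite ge0_integralZl//; last by apply/measurable_EFinP; exact: measurable_indic.
  by rewrite integral_indic// setIT [X in (_ * X)%E](_ : _ = 0%E) ?mule0.
rewrite adde0 /err_bound ge0_integralD//; last first.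
  by move=> t _; apply: mule_ge0; [rewrite lee_fin|exact: U0].
rewrite integral_cst// [X in (_ * X)%E](_ : _ = 1%E) ?mule1; last exact: probability_setT.
rewrite ge0_integralZl//; last by move=> t _; exact: U0.
have hG : (\int[PP]_t G t <= (2 * (Cch * (k ^ 2)%:R ^+ D / n%:R ^+ m))%:E)%E.
  rewrite ge0_integralD// mulr_natl mulr2n EFinD.
  by apply: leeD; apply: integral_neuron_chaining => //; rewrite expn_gt0 k0.
have hU : (\int[PP]_t U t <= (2 + 2 * Cch)%:E)%E.
  rewrite ge0_integralD//; last by move=> t _; rewrite mule_ge0.
  rewrite integral_cst// [X in (_ * X)%E](_ : _ = 1%E) ?mule1; last exact: probability_setT.
  rewrite [X in (_ <= X)%E]EFinD leeD2l// ge0_integralZl//.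
  apply: (@le_trans _ _ (((a0 k n ^+ (2 * m))^-1)%:E *
      (2 * (Cch * (k ^ 2)%:R ^+ D / n%:R ^+ m))%:E)%E).
    by rewrite lee_wpmul2l.
  rewrite -EFinM lee_fin.
  have -> : a0 k n ^+ (2 * m) = k%:R ^+ m / n%:R ^+ m.
    by rewrite exprM sqr_sqrtr ?divr_ge0// exprMn exprVn.
  have -> : (k%:R ^+ m / n%:R ^+ m)^-1 * (2 * (Cch * (k ^ 2)%:R ^+ D / n%:R ^+ m)) =
      2 * Cch * (k%:R ^+ (2 * D) / k%:R ^+ m).
    have km : k%:R ^+ m != 0 :> R by rewrite expf_neq0// gt_eqF.
    have nm : n%:R ^+ m != 0 :> R by rewrite expf_neq0// gt_eqF.
    rewrite natrX -exprM; move: (k%:R ^+ m) (n%:R ^+ m) (k%:R ^+ (2 * D)) km nm.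
    by move=> x y z x0 y0; field; rewrite x0.
  rewrite -[leRHS]mulr1 ler_wpM2l ?mulr_ge0// ler_pdivrMr ?exprn_gt0// mul1r.
  by rewrite ler_weXn2l ?ler1n// /m leq_mul2r orbT.
apply: (@le_trans _ _ ((4^-1 * (Cr * k%:R `^ (- 2^-1)))%:E +
    (c4 * ln k%:R ^+ 2 * (5 * a0 k n))%:E * (2 + 2 * Cch)%:E)%E).
  by rewrite leeD2l// lee_wpmul2l// lee_fin.
rewrite -EFinM -EFinD lee_fin.
have -> : a0 k n = Num.sqrt k%:R * n%:R `^ (- 2^-1).
  by rewrite /a0 sqrtrM// sqrtrV// powRN powR12_sqrt.
set x := k%:R `^ _; set y := n%:R `^ _.
have x0 : 0 <= x by exact: powR_ge0.
have z0 : 0 <= Num.sqrt k%:R * ln k%:R ^+ 2 * y.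
  by rewrite mulr_ge0 ?powR_ge0// mulr_ge0 ?sqrtr_ge0 ?sqr_ge0.
set z := Num.sqrt k%:R * ln k%:R ^+ 2 * y in z0 *.
have -> : c4 * ln k%:R ^+ 2 * (5 * (Num.sqrt k%:R * y)) = c4 * 5 * z by rewrite /z; ring.
have e0 : 0 <= c4 * 5 * (2 + 2 * Cch).
  by apply: mulr_ge0; [rewrite mulr_ge0// ltW|rewrite addr_ge0// mulr_ge0].
have Cr40 : 0 <= 4^-1 * Cr by rewrite mulr_ge0.
rewrite -subr_ge0.
have -> : (4^-1 * Cr + c4 * 5 * (2 + 2 * Cch)) * (x + z) -
  (4^-1 * (Cr * x) + c4 * 5 * z * (2 + 2 * Cch)) =
  4^-1 * Cr * z + c4 * 5 * (2 + 2 * Cch) * x by ring.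
by rewrite addr_ge0// mulr_ge0.
Qed.

End expected_error.

(** * Uniform approximation of continuous functions *)

Section logistic_polynomials.
Context {R : realType}.
Implicit Types (p : {poly R}) (x y u eta : R).

(** The derivative of [logistic] is [logistic - logistic ^ 2]. The remainder splits exactly into
    multiples of [1 - q - eta] and [eta * (1 - q)] with coefficients at most 1, costing [2 eta^2]
    and [3 eta^2]. *)
Lemma logistic_taylor (y eta : R) : `|eta| <= 1 ->
  `|logistic (y + eta) - logistic y - eta * (logistic y - logistic y ^+ 2)|
  <= 5 * eta ^+ 2.
Proof.
move=> eta1; set E := expR (- y); set q := expR (- eta).
have E0 : 0 < E by exact: expR_gt0.
have q0 : 0 < q by exact: expR_gt0.
have h1 : `|1 - q - eta| <= 2 * eta ^+ 2.
  have := expR_ge1Dx (- eta); have := @expR_le_quadratic R (- eta).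
  rewrite normrN sqrrN -/q => /(_ eta1) h2 h3; rewrite ler_norml.
  by have := sqr_ge0 eta; lra.
have h2 : `|1 - q| <= 3 * `|eta|.
  have -> : 1 - q = (1 - q - eta) + eta by ring.
  apply: le_trans (ler_normD _ _) _; apply: (@le_trans _ _ (2 * eta ^+ 2 + `|eta|)).
    by rewrite lerD2r.
  have : eta ^+ 2 <= `|eta|; last by lra.
  by rewrite -[eta ^+ 2]real_normK ?num_real// expr2 ler_piMr.
have -> : logistic (y + eta) - logistic y - eta * (logistic y - logistic y ^+ 2) =
   (E / ((1 + E) * (1 + E * q))) * (1 - q - eta) +
   (E ^+ 2 / ((1 + E) ^+ 2 * (1 + E * q))) * (eta * (1 - q)).
  rewrite /logistic (_ : expR (- (y + eta)) = E * q); last first.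
    by rewrite -expRD; congr expR; ring.
  rewrite -/E; have Eq0 : 0 < E * q by exact: mulr_gt0.
  by field; rewrite !gt_eqF ?addr_gt0.
have Eq0 : 0 < E * q by exact: mulr_gt0.
have c1 : `|E / ((1 + E) * (1 + E * q))| <= 1.
  rewrite ger0_norm; last by rewrite divr_ge0 ?mulr_ge0 ?addr_ge0// ltW.
  rewrite ler_pdivrMr; last by rewrite mulr_gt0 ?addr_gt0.
  nra.
have c2 : `|E ^+ 2 / ((1 + E) ^+ 2 * (1 + E * q))| <= 1.
  rewrite ger0_norm; last by rewrite divr_ge0 ?mulr_ge0 ?exprn_ge0 ?addr_ge0// ltW.
  rewrite ler_pdivrMr; last by rewrite mulr_gt0 ?exprn_gt0 ?addr_gt0.
  have e2 : 0 < E ^+ 2 by rewrite exprn_gt0.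
  have : 0 <= (1 + E) ^+ 2 * (E * q) by rewrite mulr_ge0 ?sqr_ge0 ?ltW.
  nra.
apply: le_trans (ler_normD _ _) _; rewrite [X in X + _]normrM [X in _ + X]normrM.
have h3 : `|eta * (1 - q)| <= 3 * eta ^+ 2.
  rewrite normrM -[eta ^+ 2]real_normK ?num_real// expr2 mulrCA ler_wpM2l//.
have := ler_pM (normr_ge0 _) (normr_ge0 _) c1 h1.
have := ler_pM (normr_ge0 _) (normr_ge0 _) c2 h3.
lra.
Qed.

Lemma poly_logistic_bounded p : exists2 B : R, 0 <= B & forall y, `|p.[logistic y]| <= B.
Proof.
exists (\sum_(i < size p) `|p`_i|); first exact: sumr_ge0.
move=> y; rewrite horner_coef; apply: le_trans (ler_norm_sum _ _ _) _.
apply: ler_sum => i _; rewrite normrM ler_piMr// normrX.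
by rewrite exprn_ile1// ger0_norm ?logistic_le1// ltW// logistic_gt0.
Qed.

(** By the Leibniz rule a first-order expansion uniform in [y] survives multiplication by
    [logistic]; hence an induction along the Horner form. *)
Lemma poly_logistic_taylor p : exists2 C : R, 0 <= C & forall y eta, `|eta| <= 1 ->
  `|p.[logistic (y + eta)] - p.[logistic y] -
    eta * (p^`() * ('X - 'X^2)).[logistic y]| <= C * eta ^+ 2.
Proof.
elim/poly_ind: p => [|p c [C C0 hC]].
  exists 0 => // y eta _.
  by rewrite linear0 mul0r !horner0 subrr mulr0 subrr normr0 mul0r.
have [B1 B10 hB1] := poly_logistic_bounded p.
have [B2 B20 hB2] := poly_logistic_bounded (p^`() * ('X - 'X^2)).
exists (C + (B1 + B2) * 5 + B2) => [|y eta eta1]; first by rewrite !addr_ge0// mulr_ge0// addr_ge0.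
have hl := logistic_taylor y eta1.
have hp := hC y eta eta1.
have hf := hB1 y; have hf' := hB2 y.
have q'E : ((p * 'X + c%:P)^`() * ('X - 'X^2)).[logistic y] =
    (p^`() * ('X - 'X^2)).[logistic y] * logistic y +
    p.[logistic y] * (logistic y - logistic y ^+ 2).
  by rewrite derivD derivM derivX derivC addr0 mulr1 !hornerE; ring.
rewrite q'E !hornerMXaddC.
move: hp hl hf hf'; move: (_ * _).[_] p.[logistic y] p.[logistic (y + eta)] => f' f f1.
set g := logistic y; set g1 := logistic (y + eta) => hp hl hf hf'.
have -> : f1 * g1 + c - (f * g + c) - eta * (f' * g + f * (g - g ^+ 2)) =
  (f1 - f - eta * f') * g1 + (f + eta * f') * (g1 - g - eta * (g - g ^+ 2)) +
  eta ^+ 2 * (f' * (g - g ^+ 2)) by ring.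
have g1_1 : `|g1| <= 1 by rewrite ger0_norm ?logistic_le1// ltW// logistic_gt0.
have gg : `|g - g ^+ 2| <= 1.
  have := logistic_gt0 y; have := logistic_le1 y; rewrite -/g => ? ?.
  by rewrite ler_norml; apply/andP; split; nra.
apply: le_trans (ler_normD _ _) _; rewrite (mulrDl (C + _)) (mulrDl C).
apply: lerD; first (apply: le_trans (ler_normD _ _) _; apply: lerD).
- by rewrite normrM -[leRHS]mulr1 ler_pM.
- rewrite normrM -mulrA ler_pM//.
  apply: le_trans (ler_normD _ _) (lerD hf _).
  by rewrite normrM -[leRHS]mul1r ler_pM.
- rewrite normrM [X in X * _]ger0_norm ?sqr_ge0// mulrC ler_wpM2r ?sqr_ge0//.
  by rewrite normrM -[leRHS]mulr1 ler_pM.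
Qed.

(** Evaluated at [logistic y], this polynomial is the [n]-th derivative of [logistic] at [y]. *)
Fixpoint logistic_deriv_poly (n : nat) : {poly R} :=
  if n is n'.+1 then (logistic_deriv_poly n')^`() * ('X - 'X^2) else 'X.

Lemma size_deriv_succ (p : {poly R}) n : size p = n.+2 -> size p^`() = n.+1.
Proof.
move=> sp; apply/eqP; rewrite eqn_leq -ltnS -{1}sp lt_size_deriv; last first.
  by rewrite -size_poly_eq0 sp.
rewrite ltnNge; apply/negP => /leq_sizeP/(_ n (leqnn n))/eqP.
have pn : p`_n.+1 = lead_coef p by rewrite lead_coefE sp.
by rewrite coef_deriv mulrn_eq0 pn lead_coef_eq0 -size_poly_eq0 sp.
Qed.

Lemma size_logistic_deriv_poly n : size (logistic_deriv_poly n) = n.+2.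
Proof.
have sX : size ('X - 'X^2 : {poly R}) = 3%N.
  by rewrite addrC size_polyDl size_polyN ?size_polyXn ?size_polyX.
elim: n => [|n IH] /=; first by rewrite size_polyX.
rewrite size_mul; last 2 first.
- by rewrite -size_poly_eq0 (size_deriv_succ IH).
- by rewrite -size_poly_eq0 sX.
by rewrite (size_deriv_succ IH) sX addn3.
Qed.

Lemma logistic_inj : injective (@logistic R).
Proof.
move=> x y /(congr1 GRing.inv); rewrite !invrK => /addrI /expR_inj /oppr_inj.
by [].
Qed.

(** A polynomial of degree [n + 1] cannot vanish at the [n + 2] distinct values of [logistic] at
    [i / (n + 3)]. These points lie strictly inside the unit interval, which leaves room for
    difference quotients. *)
Lemma logistic_deriv_neq0 n :
  exists2 b : R, `|b| < 1 & (logistic_deriv_poly n).[logistic b] != 0.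
Proof.
pose s := [seq logistic (i%:R / (n.+3)%:R : R) | i <- iota 0 n.+2].
apply: contrapT => h.
have n30 : (0 : R) < n.+3%:R by rewrite ltr0n.
have us : uniq s.
  rewrite map_inj_uniq ?iota_uniq// => i j /logistic_inj /(mulIf _).
  move=> /(_ _)/eqP; rewrite invr_eq0 gt_eqF// => /(_ isT).
  by rewrite eqr_nat => /eqP.
have rs : all (root (logistic_deriv_poly n)) s.
  apply/allP => x /mapP[i]; rewrite mem_iota => /andP[_ i2] ->.
  apply/negPn/negP => nr; apply: h; exists (i%:R / n.+3%:R) => //.
  rewrite ger0_norm ?divr_ge0// ltr_pdivrMr// mul1r ltr_nat; lia.
have p0 : logistic_deriv_poly n != 0 by rewrite -size_poly_eq0 size_logistic_deriv_poly.
have := max_poly_roots p0 rs us.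
by rewrite size_logistic_deriv_poly size_map size_iota ltnn.
Qed.

End logistic_polynomials.

Section uniform_approximation.
Context {R : realType} {d : nat}.
Implicit Types (f g : 'rV[R]_d -> R) (l : seq 'I_d).

(** Inner weights already satisfy the bound 1 of the class; the outer weights and the number of
    neurons are left free. *)
Definition net_approximable f := forall eps : R, 0 < eps ->
  exists (N : nat) (c : nat -> R) (v : nat -> option 'I_d -> R),
    (forall i j, `|v i j| <= 1) /\
    forall x, unit_cube R d x ->
      `|f x - \sum_(0 <= i < N) c i * neuron (v i) x| <= eps.

Lemma net_approximable_closed f :
  (forall eps, 0 < eps -> exists2 g, net_approximable g &
     forall x, unit_cube R d x -> `|f x - g x| <= eps) -> net_approximable f.
Proof.
move=> h eps eps0; have e2 : 0 < eps / 2 by rewrite divr_gt0.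
have [g hg fg] := h _ e2; have [N [c [v [v1 hv]]]] := hg _ e2.
exists N, c, v; split=> // x Kx.
rewrite -(subrK (g x) (f x)) -addrA (splitr eps).
exact: le_trans (ler_normD _ _) (lerD (fg x Kx) (hv x Kx)).
Qed.

Lemma net_approximable_ext f g : (forall x, unit_cube R d x -> f x = g x) ->
  net_approximable g -> net_approximable f.
Proof.
move=> fg hg; apply: net_approximable_closed => eps eps0; exists g => // x Kx.
by rewrite fg// subrr normr0 ltW.
Qed.

Lemma net_approximableD f g : net_approximable f -> net_approximable g ->
  net_approximable (fun x => f x + g x).
Proof.
move=> hf hg eps eps0; have e2 : 0 < eps / 2 by rewrite divr_gt0.
have [N1 [c1 [v1 [v11 h1]]]] := hf _ e2; have [N2 [c2 [v2 [v21 h2]]]] := hg _ e2.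
exists (N1 + N2)%N, (fun i => if (i < N1)%N then c1 i else c2 (i - N1)%N),
  (fun i => if (i < N1)%N then v1 i else v2 (i - N1)%N); split.
  by move=> i j; case: ifP.
move=> x Kx; rewrite (big_cat_nat _ (n := N1))/=; [|by []|exact: leq_addr].
have -> : \sum_(N1 <= i < N1 + N2) (if (i < N1)%N then c1 i else c2 (i - N1)%N) *
    neuron (if (i < N1)%N then v1 i else v2 (i - N1)%N) x =
    \sum_(0 <= i < N2) c2 i * neuron (v2 i) x.
  rewrite -{1}[N1]add0n big_addn [(N1 + N2)%N]addnC addnK; apply: eq_bigr => i _.
  by rewrite addnK ltnNge leq_addl.
rewrite (eq_big_nat _ _ (F2 := fun i => c1 i * neuron (v1 i) x)); last first.
  by move=> i /andP[_ ->].
rewrite opprD addrACA (splitr eps).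
exact: le_trans (ler_normD _ _) (lerD (h1 x Kx) (h2 x Kx)).
Qed.

Lemma net_approximableZ f (a : R) : net_approximable f ->
  net_approximable (fun x => a * f x).
Proof.
move=> hf eps eps0; have e2 : 0 < eps / (1 + `|a|) by rewrite divr_gt0// ltr_pwDl.
have [N [c [v [v1 h]]]] := hf _ e2; exists N, (fun i => a * c i), v; split=> // x Kx.
under eq_bigr do rewrite -mulrA.
rewrite -mulr_sumr -mulrBr normrM.
apply: le_trans (ler_wpM2l (normr_ge0 a) (h x Kx)) _.
rewrite mulrA ler_pdivrMr; last by rewrite ltr_pwDl.
by rewrite mulrC ler_wpM2l ?(ltW eps0)// lerDr.
Qed.

Definition monomial l (x : 'rV[R]_d) : R := \prod_(j <- l) x 0 j.

Lemma monomial_le1 l x : unit_cube R d x -> `|monomial l x| <= 1.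
Proof.
move=> Kx; rewrite normr_prod; elim: l => [|j l IH]; first by rewrite big_nil.
rewrite big_cons -[leRHS]mulr1 ler_pM//; first exact: prodr_ge0.
by have /andP[h0 h1] := Kx j; rewrite ger0_norm.
Qed.

(** A difference quotient in the weight of coordinate [j] produces the factor [x 0 j] and the next
    derivative, uniformly on the cube. The strict bound on [v] makes room for the increment. *)
Lemma net_approximable_deriv l (v : option 'I_d -> R) : (forall j, `|v j| < 1) ->
  net_approximable (fun x => monomial l x *
    (logistic_deriv_poly (size l)).[neuron v x]).
Proof.
elim: l v => [|j l IH] v v1.
  move=> eps eps0; exists 1%N, (fun=> 1), (fun=> v); split.
    by move=> _ j; exact: ltW.
  move=> x Kx; rewrite big_nat1 /monomial big_nil /= hornerX !mul1r subrr normr0.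
  exact: ltW.
apply: net_approximable_closed => eps eps0.
have [C C0 hC] := poly_logistic_taylor (logistic_deriv_poly (size l) : {poly R}).
(* Half of the minimum keeps the shifted weight strictly inside the box and the Taylor error [C * h]
   below [eps]. *)
pose h := Num.min (1 - `|v (Some j)|) (eps / (C + 1)) / 2.
have C1 : 0 < C + 1 by rewrite ltr_pwDr.
have m0 : 0 < Num.min (1 - `|v (Some j)|) (eps / (C + 1)).
  by rewrite lt_min subr_gt0 v1 divr_gt0.
have h0 : 0 < h by rewrite divr_gt0.
have h2 : h < Num.min (1 - `|v (Some j)|) (eps / (C + 1)) by rewrite /h; lra.
have /andP[hv he] : (h < 1 - `|v (Some j)|) && (h < eps / (C + 1)) by rewrite -lt_min.
have h1 : h <= 1 by have := normr_ge0 (v (Some j)); lra.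
pose v' i : R := if i == Some j then v i + h else v i.
have v'1 i : `|v' i| < 1.
  rewrite /v'; case: eqP => [->|_//].
  by apply: le_lt_trans (ler_normD _ _) _; rewrite (gtr0_norm h0); lra.
exists (fun x => h^-1 * (monomial l x * (logistic_deriv_poly (size l)).[neuron v' x] +
    - 1 * (monomial l x * (logistic_deriv_poly (size l)).[neuron v x]))).
  by apply: net_approximableZ; apply: net_approximableD; [|apply: net_approximableZ]; exact: IH.
move=> x Kx; have /andP[x0 x1] := Kx j.
set y := \sum_(i < d) v (Some i) * x 0 i + v None.
have nE : neuron v x = logistic y by [].
have nE' : neuron v' x = logistic (y + h * x 0 j).
  rewrite /neuron; congr logistic; rewrite /y /v' /= addrAC; congr (_ + _).
  rewrite (bigD1 j)//= [in RHS](bigD1 j)//= eqxx mulrDl -!addrA; congr (_ + _).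
  rewrite addrC; congr (_ + _); apply: eq_bigr => i ij.
  by case: eqP => // -[] /eqP; rewrite (negbTE ij).
rewrite nE nE' /monomial big_cons -/(monomial l x) /=.
set P := logistic_deriv_poly (size l); set Mx := monomial l x.
have hx1 : `|h * x 0 j| <= 1.
  rewrite normrM (gtr0_norm h0) (ger0_norm x0) -[leRHS]mulr1.
  by apply: ler_pM => //; exact: ltW.
have := hC y (h * x 0 j) hx1; rewrite -/P; set P1 := (P^`() * ('X - 'X^2)).[logistic y].
move=> hP.
have -> : x 0 j * Mx * P1 - h^-1 * (Mx * P.[logistic (y + h * x 0 j)] +
    -1 * (Mx * P.[logistic y])) =
  - (Mx / h) * (P.[logistic (y + h * x 0 j)] - P.[logistic y] - h * x 0 j * P1).
  by field; rewrite gt_eqF.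
rewrite normrM normrN normrM normfV (gtr0_norm h0).
apply: (@le_trans _ _ (1 / h * (C * (h * x 0 j) ^+ 2))).
  apply: ler_pM => //; first by rewrite mulr_ge0 ?invr_ge0 ?(ltW h0).
  by rewrite ler_wpM2r ?invr_ge0 ?(ltW h0)// monomial_le1.
have -> : 1 / h * (C * (h * x 0 j) ^+ 2) = C * h * x 0 j ^+ 2 by field; rewrite gt_eqF.
apply: (@le_trans _ _ (C * h)).
  by apply: ler_piMr; [exact: mulr_ge0 C0 (ltW h0)|exact: exprn_ile1].
rewrite ltr_pdivlMr// in he; apply: le_trans (ltW he); rewrite mulrC ler_wpM2l ?(ltW h0)//.
by rewrite lerDl.
Qed.

(** With zero weights and bias [b] the derivative factor is a nonzero constant, which can be divided
    out. *)
Lemma net_approximable_monomial l : net_approximable (monomial l).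
Proof.
have [b b1 bn0] := @logistic_deriv_neq0 R (size l).
pose v (i : option 'I_d) : R := if i is Some _ then 0 else b.
have v1 i : `|v i| < 1 by case: i => [i|] //=; rewrite normr0.
apply: (net_approximable_ext (g := fun x => ((logistic_deriv_poly (size l)).[logistic b])^-1 *
  (monomial l x * (logistic_deriv_poly (size l)).[neuron v x]))).
  move=> x _; rewrite /neuron /v big1 ?add0r => [|i _]; last by rewrite mul0r.
  by rewrite mulrCA mulVf// mulr1.
by apply: net_approximableZ; exact: net_approximable_deriv.
Qed.

(** This property is stable under products, so Bernstein polynomials need not be expanded into
    monomials. *)
Definition approximable_multiplier g := forall f,
  (forall l, net_approximable (fun x => monomial l x * f x)) ->
  forall l, net_approximable (fun x => monomial l x * (g x * f x)).

Lemma multiplier_coord (j : 'I_d) : approximable_multiplier (fun x => x 0 j).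
Proof.
move=> f hf l; apply: net_approximable_ext (hf (j :: l)) => x _.
by rewrite /monomial big_cons; ring.
Qed.

Lemma multiplier_onem_coord (j : 'I_d) : approximable_multiplier (fun x => 1 - x 0 j).
Proof.
move=> f hf l.
apply: (net_approximable_ext (g := fun x => monomial l x * f x + -1 * (monomial (j :: l) x * f x))).
  by move=> x _; rewrite /monomial big_cons; ring.
by apply: net_approximableD => //; exact: net_approximableZ.
Qed.

Lemma multiplier_prod (I : Type) (s : seq I) (g : I -> 'rV[R]_d -> R) :
  (forall i, approximable_multiplier (g i)) ->
  approximable_multiplier (fun x => \prod_(i <- s) g i x).
Proof.
move=> hg; elim: s => [|i s IH] f hf l.
  by apply: net_approximable_ext (hf l) => x _; rewrite big_nil mul1r.
apply: (net_approximable_ext _ (hg i _ (IH f hf) l)) => x _.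
by rewrite big_cons -(mulrA (g i x)).
Qed.

Lemma multiplier_approximable g : approximable_multiplier g -> net_approximable g.
Proof.
move=> hg; apply: (net_approximable_ext (g := fun x => monomial [::] x * (g x * 1))).
  by move=> x _; rewrite /monomial big_nil mul1r mulr1.
apply: (hg (fun=> 1)) => l; apply: net_approximable_ext (net_approximable_monomial l) => x _.
by rewrite mulr1.
Qed.

Lemma net_approximable_sum (I : Type) (s : seq I) (g : I -> 'rV[R]_d -> R) :
  (forall i, net_approximable (g i)) -> net_approximable (fun x => \sum_(i <- s) g i x).
Proof.
move=> hg; elim: s => [|i s IH].
  apply: (net_approximable_ext (g := fun x => 0 * monomial [::] x)).
    by move=> x _; rewrite big_nil mul0r.
  by apply: net_approximableZ; exact: net_approximable_monomial.
apply: (net_approximable_ext (g := fun x => g i x + \sum_(i <- s) g i x)).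
  by move=> x _; rewrite big_cons.
exact: net_approximableD.
Qed.

End uniform_approximation.


(** * Bernstein approximation on the cube *)

Section continuous_on_cube.
Context {R : realType} {d : nat}.

Lemma compact_unit_cube : compact (unit_cube R d).
Proof.
have -> : unit_cube R d = [set v : 'rV[R]_d | forall i, `[0, 1]%classic (v ord0 i)].
  by apply/seteqP; split=> v /= h i; have := h i; rewrite /= in_itv.
apply: (@rV_compact R d (fun=> `[0, 1]%classic)) => i; exact: segment_compact.
Qed.

Lemma uniform_continuity_cube (f : 'rV[R]_d -> R) :
  {within unit_cube R d, continuous f} -> forall eps, 0 < eps ->
  exists2 delta, 0 < delta & forall u x, unit_cube R d u -> unit_cube R d x ->
    (forall j, `|u 0 j - x 0 j| < delta) -> `|f u - f x| <= eps.
Proof.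
move=> cf eps eps0; have e2 : 0 < eps / 2 by rewrite divr_gt0.
have := compact_unit_cube => /compact_near_coveringP.
move=> /(_ R (0^'+)%R (fun r u => unit_cube R d u -> forall x, unit_cube R d x ->
    (forall j, `|u 0 j - x 0 j| < r) -> `|f u - f x| <= eps) (within_filter _ (nbhs_filter 0))) h.
have {h} : \forall r \near 0^'+, unit_cube R d `<=` (fun u => unit_cube R d u ->
    forall x, unit_cube R d x -> (forall j, `|u 0 j - x 0 j| < r) -> `|f u - f x| <= eps).
  apply: h => z Kz.
  have : f y @[y --> within (unit_cube R d) (nbhs z)] --> f z.
    by move/subspace_continuousP : cf; apply.
  move=> /cvgrPdist_lt /(_ _ e2); rewrite near_withinE => /nbhs_ballP[r /= r0 hr].
  have r2 : 0 < r / 2 by rewrite divr_gt0.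
  exists (ball z (r / 2), [set s | s < r / 2]); first split => /=.
  - exact: nbhsx_ballx.
  - exact: nbhs_right_lt.
  move=> [u s] /= [hu hs] Ku x Kx ux.
  have zu : ball z r u.
    by apply: le_ball hu; rewrite ler_pdivrMr// ler_peMr ?(ltW r0)// ler1n.
  have zx : ball z r x.
    rewrite (splitr r); apply: ball_triangle hu _; split=> // i j.
    rewrite (ord1 i) /ball/=; exact: lt_trans (ux j) hs.
  rewrite -(subrK (f z) (f u)) -addrA (splitr eps).
  apply: le_trans (ler_normD _ _) (lerD _ _); apply/ltW.
    by rewrite distrC; exact: hr.
  exact: hr.
case=> r /= r0 hr; have r2 : 0 < r / 2 by rewrite divr_gt0.
exists (r / 2) => // u x Ku Kx ux.
refine (hr (r / 2) _ r2 u Ku Ku x Kx ux) => /=.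
by rewrite distrC subr0 gtr0_norm// ltr_pdivrMr// ltr_pMr// ltr1n.
Qed.

(** When all coordinates are within [delta], uniform continuity suffices; otherwise the squared
    distance is at least [delta ^ 2] and pays for the full oscillation. In this form averages over
    random nodes involve variances only. *)
Lemma quadratic_modulus_cube (f : 'rV[R]_d -> R) :
  {within unit_cube R d, continuous f} -> forall eps, 0 < eps ->
  exists2 C, 0 <= C & forall u x, unit_cube R d u -> unit_cube R d x ->
    `|f u - f x| <= eps + C * \sum_j (u 0 j - x 0 j) ^+ 2.
Proof.
move=> cf eps eps0; have [delta delta0 hd] := uniform_continuity_cube cf eps0.
have [M [_ hM]] := compact_bounded (continuous_compact cf compact_unit_cube).
have {}hM x : unit_cube R d x -> `|f x| <= `|M| + 1.
  move=> Kx; apply: (hM (`|M| + 1)); last by exists x.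
  by rewrite (le_lt_trans (ler_norm _))// ltrDl.
have C0 : 0 <= 2 * (`|M| + 1) / delta ^+ 2.
  by rewrite divr_ge0 ?sqr_ge0// mulr_ge0// addr_ge0.
exists (2 * (`|M| + 1) / delta ^+ 2) => // u x Ku Kx.
have [h|/existsNP[j /negP]] := pselect (forall j, `|u 0 j - x 0 j| < delta).
  apply: le_trans (hd _ _ Ku Kx h) _; rewrite lerDl mulr_ge0// sumr_ge0// => j _.
  exact: sqr_ge0.
rewrite -leNgt => uxj.
apply: (@le_trans _ _ (2 * (`|M| + 1))).
  apply: le_trans (ler_normB _ _) _; rewrite mulr_natl mulr2n.
  by apply: lerD; exact: hM.
apply: (@le_trans _ _ (2 * (`|M| + 1) / delta ^+ 2 * delta ^+ 2)).
  by rewrite divfK// expf_neq0// gt_eqF.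
apply: ler_wpDl (ltW eps0) _; apply: ler_wpM2l => //.
rewrite (bigD1 j)//=; apply: ler_wpDr; first by apply: sumr_ge0 => *; exact: sqr_ge0.
by rewrite -[leRHS]real_normK ?num_real// lerXn2r// nnegrE// ltW.
Qed.

End continuous_on_cube.

Section bernstein.
Context {R : realType} {d : nat}.
Implicit Types (x : 'rV[R]_d) (N : nat).

Definition bernoulli_factor x (j : 'I_d) (b : bool) : R :=
  if b then x 0 j else 1 - x 0 j.

(** The probability of the outcome [e] of independent Bernoulli draws, [N] for each coordinate [j]
    with parameter [x 0 j]. Keeping single draws rather than counts avoids binomial coefficients. *)
Definition bernstein_weight N (e : {ffun 'I_d * 'I_N -> bool}) x : R :=
  \prod_p bernoulli_factor x p.1 (e p).

Definition bernstein_node N (e : {ffun 'I_d * 'I_N -> bool}) : 'rV[R]_d :=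
  \row_j (N%:R^-1 * \sum_i (e (j, i))%:R).

Lemma bernoulli_factor_ge0 x j b : unit_cube R d x -> 0 <= bernoulli_factor x j b.
Proof. by move=> /(_ j)/andP[x0 x1]; rewrite /bernoulli_factor; case: b => //; rewrite subr_ge0. Qed.

Lemma bernstein_weight_ge0 N (e : {ffun 'I_d * 'I_N -> bool}) x :
  unit_cube R d x -> 0 <= bernstein_weight e x.
Proof. by move=> Kx; apply: prodr_ge0 => p _; exact: bernoulli_factor_ge0. Qed.

Lemma normr_natb_sub_le1 (b : bool) (y : R) : 0 <= y <= 1 -> `|b%:R - y| <= 1.
Proof.
move=> /andP[y0 y1]; case: b; rewrite ?sub0r ?normrN ger0_norm ?subr_ge0//.
by rewrite gerBl.
Qed.

Lemma sum_bernstein_weight N x :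
  \sum_(e : {ffun 'I_d * 'I_N -> bool}) bernstein_weight e x = 1.
Proof.
rewrite /bernstein_weight -(bigA_distr_bigA (fun p => bernoulli_factor x p.1)) big1// => p _.
by rewrite big_bool /= /bernoulli_factor addrC subrK.
Qed.

(** The sum factors over the draws, and the factor at [p] is [x (1 - x) + (1 - x) (- x) = 0]. *)
Lemma bernstein_covariance N x (p q : 'I_d * 'I_N) : p != q ->
  \sum_e bernstein_weight e x * (((e p)%:R - x 0 p.1) * ((e q)%:R - x 0 q.1)) = 0.
Proof.
move=> pq.
pose G r b := bernoulli_factor x r.1 b *
  ((if r == p then b%:R - x 0 p.1 else 1) * (if r == q then b%:R - x 0 q.1 else 1)).
transitivity (\sum_(e : {ffun 'I_d * 'I_N -> bool}) \prod_r G r (e r)).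
  apply: eq_bigr => e _; rewrite /G big_split big_split/=; congr (_ * (_ * _)).
    by rewrite -big_mkcond big_pred1_eq.
  by rewrite -big_mkcond big_pred1_eq.
rewrite -(bigA_distr_bigA G) (bigD1 p)//= big_bool /G /bernoulli_factor eqxx (negbTE pq)/=.
by rewrite [X in X * _](_ : _ = 0) ?mul0r//; ring.
Qed.

Lemma bernstein_variance N x j : unit_cube R d x ->
  \sum_e bernstein_weight e x * (bernstein_node (N := N.+1) e 0 j - x 0 j) ^+ 2 <= N.+1%:R^-1.
Proof.
move=> Kx; have N0 : (0 : R) < N.+1%:R by [].
have nodeE (e : {ffun 'I_d * 'I_N.+1 -> bool}) : bernstein_node e 0 j - x 0 j =
    N.+1%:R^-1 * \sum_i ((e (j, i))%:R - x 0 j).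
  rewrite mxE sumrB sumr_const card_ord mulrBr -[x 0 j *+ _]mulr_natl mulrA mulVf ?mul1r//.
have -> : \sum_e bernstein_weight e x * (bernstein_node (N := N.+1) e 0 j - x 0 j) ^+ 2 =
    N.+1%:R^-1 ^+ 2 * \sum_i \sum_i' \sum_(e : {ffun 'I_d * 'I_N.+1 -> bool})
      bernstein_weight e x * (((e (j, i))%:R - x 0 j) * ((e (j, i'))%:R - x 0 j)).
  under eq_bigr do rewrite nodeE exprMn mulrCA.
  rewrite -mulr_sumr; congr (_ * _).
  under [RHS]eq_bigr do rewrite exchange_big/=.
  rewrite [RHS]exchange_big/=; apply: eq_bigr => e _.
  rewrite expr2 big_distrlr/= mulr_sumr; apply: eq_bigr => i _.
  by rewrite mulr_sumr.
apply: (@le_trans _ _ (N.+1%:R^-1 ^+ 2 * \sum_(i < N.+1) 1)); last first.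
  by rewrite sumr_const card_ord expr2 -mulrA mulVf ?mulr1// gt_eqF.
apply: ler_wpM2l; first exact: sqr_ge0.
apply: ler_sum => i _; rewrite (bigD1 i)//= [X in _ + X]big1 ?addr0 => [|i' i'i]; last first.
  apply: (@bernstein_covariance _ x (j, i) (j, i')).
  by rewrite xpair_eqE eqxx/= eq_sym.
rewrite -[leRHS](sum_bernstein_weight N.+1 x); apply: ler_sum => e _.
rewrite -[leRHS]mulr1; apply: ler_wpM2l; first exact: bernstein_weight_ge0.
rewrite -expr2 -real_normK ?num_real// exprn_ile1//.
by apply: normr_natb_sub_le1; exact: Kx.
Qed.

Lemma net_approximable_continuous (f : 'rV[R]_d -> R) :
  {within unit_cube R d, continuous f} -> net_approximable f.
Proof.
move=> cf; apply: net_approximable_closed => eps eps0.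
have e2 : 0 < eps / 2 by rewrite divr_gt0.
have [C C0 hC] := quadratic_modulus_cube cf e2.
(* [N + 1] exceeds [d C / (eps / 2)], so [C] times the sum of the [d] variances is at most
   [eps / 2]. *)
pose N := Num.truncn (d%:R * C / (eps / 2)).
exists (fun x => \sum_(e : {ffun 'I_d * 'I_N.+1 -> bool})
    f (bernstein_node e) * bernstein_weight e x).
  apply: net_approximable_sum => e; apply: net_approximableZ.
  apply: multiplier_approximable; apply: multiplier_prod => p.
  rewrite /bernoulli_factor; case: (e p); [exact: multiplier_coord|exact: multiplier_onem_coord].
move=> x Kx.
have Kn (e : {ffun 'I_d * 'I_N.+1 -> bool}) : unit_cube R d (bernstein_node e).
  move=> j; rewrite mxE; apply/andP; split.
    by apply: mulr_ge0 => //; apply: sumr_ge0.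
  rewrite mulrC ler_pdivrMr// mul1r; apply: (@le_trans _ _ (\sum_(i < N.+1) 1)).
    by apply: ler_sum => i _; case: (e _).
  by rewrite sumr_const card_ord.
have -> : f x - \sum_(e : {ffun 'I_d * 'I_N.+1 -> bool}) f (bernstein_node e) * bernstein_weight e x =
    \sum_(e : {ffun 'I_d * 'I_N.+1 -> bool}) bernstein_weight e x * (f x - f (bernstein_node e)).
  under [RHS]eq_bigr do rewrite mulrBr.
  rewrite [RHS]sumrB -mulr_suml sum_bernstein_weight mul1r; congr (_ - _).
  by apply: eq_bigr => e _; rewrite mulrC.
apply: le_trans (ler_norm_sum _ _ _) _.
apply: (@le_trans _ _ (\sum_(e : {ffun 'I_d * 'I_N.+1 -> bool})
    (bernstein_weight e x * (eps / 2) +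
     C * \sum_j bernstein_weight e x * (bernstein_node e 0 j - x 0 j) ^+ 2))).
  apply: ler_sum => e _; have w0 := bernstein_weight_ge0 e Kx.
  rewrite -mulr_sumr [C * _]mulrCA -mulrDr normrM (ger0_norm w0) ler_wpM2l// distrC.
  exact: hC.
rewrite big_split/= -mulr_suml sum_bernstein_weight mul1r [leRHS]splitr lerD2l.
rewrite -mulr_sumr exchange_big/=.
apply: (@le_trans _ _ (C * \sum_(j < d) N.+1%:R^-1)).
  by apply: ler_wpM2l => //; apply: ler_sum => j _; exact: bernstein_variance.
rewrite sumr_const card_ord -[_ *+ d]mulr_natl mulrA ler_pdivrMr// mulrC [leRHS]mulrC -ler_pdivrMr//.
exact/ltW/truncnS_gt.
Qed.

End bernstein.

Section bounded_weights.
Context {R : realType} {d : nat}.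

Lemma net_approximable_neural_nets (f : 'rV[R]_d -> R) : net_approximable f ->
  forall eps, 0 < eps -> exists K0, forall k, (K0 <= k)%N ->
  exists2 g, neural_nets R d k 1 1 1 g &
    forall x, unit_cube R d x -> `|f x - g x| <= eps.
Proof.
move=> hf eps eps0; have [N [c [v [v1 hv]]]] := hf _ eps0.
pose m := (Num.truncn (\sum_(0 <= i < N) `|c i|)).+1.
have m0 : (0 : R) < m%:R by rewrite ltr0n.
have cm i : (i < N)%N -> `|c i| <= m%:R.
  move=> iN; apply: le_trans (ltW (truncnS_gt _)).
  rewrite big_mkord (bigD1 (Ordinal iN))//= lerDl.
  by apply: sumr_ge0.
(* Neuron [i %/ m] of the old network is repeated [m] times; indices from [N * m] on get weight
   zero, so every larger [k] is served. *)
pose beta i := if (i < N * m)%N then c (i %/ m)%N / m%:R else 0.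
exists (N * m)%N => k Nk.
exists (fun x => \sum_(i < k) beta i * neuron (v (i %/ m)%N) x).
  exists (fun i => \row_j v (i %/ m)%N (Some j)), (fun i => v (i %/ m)%N None), beta, 0.
  split=> [i|i||x].
  - by split=> [j|]; rewrite ?mxE.
  - rewrite /beta; case: ifP => iN; last by rewrite normr0.
    rewrite normrM normfV (gtr0_norm m0) ler_pdivrMr// mul1r; apply: cm.
    by rewrite ltn_divLR.
  - by rewrite normr0.
  - by rewrite addr0; apply: eq_bigr => i _; rewrite neuron_dotp.
move=> x Kx; apply: le_trans (hv x Kx); rewrite le_eqVlt; apply/orP; left; apply/eqP.
congr (`|_ - _|).
rewrite -(big_mkord xpredT (fun i => beta i * neuron (v (i %/ m)%N) x)).
rewrite (big_cat_nat _ (n := (N * m)%N))//= [X in _ + X]big_nat_cond [X in _ + X]big1; last first.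
  by move=> i /andP[/andP[iN _] _]; rewrite /beta ltnNge iN mul0r.
rewrite addr0 big_nat_mul; apply: eq_big_nat => i /andP[_ iN].
rewrite (eq_big_nat _ _ (F2 := fun=> c i / m%:R * neuron (v i) x)); last first.
  move=> j /andP[ij ji]; have jE : (j %/ m)%N = i.
    by apply/eqP; rewrite eqn_leq -ltnS ltn_divLR// ji leq_divRL.
  rewrite /beta jE (leq_trans ji)// leq_mul2r iN orbT//.
rewrite sumr_const_nat mulSn addnK -[_ *+ m]mulr_natl.
by field; rewrite gt_eqF.
Qed.

Lemma risk_le_uniform (P Q : probability (borelRd R d) R)
    (PQ : chi2_pair (unit_cube R d) P Q) (f : 'rV[R]_d -> R)
    (fv : fchi2_version (unit_cube R d) P Q f) (u : borelRd R d -> R) (e : R) :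
  measurable_fun setT u -> 0 <= e ->
  (forall x, unit_cube R d x -> `|f x - u x| <= e) -> risk P Q u <= e ^+ 2.
Proof.
move=> mu e0 ue; have mdens := measurable_density PQ.
have le : (\int[Q]_x ((u x - 2 * (density P Q x - 1)) ^+ 2)%:E <=
    \int[Q]_x (cst (e ^+ 2)%:E x))%E.
  apply: ae_ge0_le_integral => //.
  - by move=> x _; rewrite lee_fin sqr_ge0.
  - apply/measurable_EFinP/measurable_funX/measurable_funB => //.
    by apply: measurable_funM => //; exact: measurable_funB.
  - by move=> x _; rewrite lee_fin sqr_ge0.
  apply: (@filterS2 _ _ (ae_filter_ringOfSetsType Q) _ _ _ _ fv (ae_unit_cube PQ)) => x fx Kx _.
  rewrite lee_fin -fx// -real_normK ?num_real// lerXn2r// ?nnegrE//.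
  by rewrite distrC ue.
rewrite integral_cst// [X in (_ * X)%E]probability_setT mule1 in le.
rewrite /risk /Rintegral -lee_fin fineK//.
rewrite ge0_fin_numE; first exact: le_lt_trans le (ltry _).
by apply: integral_ge0 => x _; rewrite lee_fin sqr_ge0.
Qed.

Lemma continuous_small_risk (P Q : probability (borelRd R d) R)
    (PQ : chi2_pair (unit_cube R d) P Q) (f : 'rV[R]_d -> R) :
  fchi2_version (unit_cube R d) P Q f -> {within unit_cube R d, continuous f} ->
  forall eps, 0 < eps -> exists K0, forall k, (K0 <= k)%N ->
  exists2 g, neural_nets R d k 1 1 1 g & risk P Q (masked g) <= eps.
Proof.
move=> fv cf eps eps0.
have e0 : 0 < Num.sqrt eps by rewrite sqrtr_gt0.
have [K0 hK] := net_approximable_neural_nets (net_approximable_continuous cf) e0.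
exists K0 => k /hK[g gk fg]; exists g => //.
rewrite -[leRHS]sqr_sqrtr ?(ltW eps0)//.
apply: (risk_le_uniform PQ fv) => //; last by move=> x Kx; rewrite masked_in// fg.
have [c [v [gE _ _]]] := neural_nets_sum ler01 gk.
by have [] := masked_bounded gE.
Qed.

End bounded_weights.

(** * Almost sure convergence *)

Section almost_sure_convergence.
Context {R : realType}.

(** Telescoping, since [1 / y^2 <= 2 (1 / y - 1 / (y + 1))] for [y >= 1]. *)
Lemma nneseries_invn_sqr : (\sum_(0 <= n <oo) (n.+1%:R ^+ 2 : R)^-1%:E <= 2%:E)%E.
Proof.
apply: lime_le.
  by apply: is_cvg_nneseries => n _ _; rewrite lee_fin invr_ge0 sqr_ge0.
apply: nearW => N; rewrite sumEFin lee_fin.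
apply: (@le_trans _ _ (2 * \sum_(0 <= n < N) (- n.+2%:R^-1 - - n.+1%:R^-1))).
  rewrite mulr_sumr; apply: ler_sum => n _.
  have n1 : (1 : R) <= n.+1%:R by rewrite ler1n.
  rewrite -[n.+2%:R]natr1; move: n.+1%:R n1 => y y1.
  rewrite opprK -subr_ge0.
  have -> : 2 * (- (y + 1)^-1 + y^-1) - (y ^+ 2)^-1 = (y - 1) / (y ^+ 2 * (y + 1)).
    by field; apply/andP; split; lra.
  apply: divr_ge0; first by rewrite subr_ge0.
  by apply: mulr_ge0; [exact: sqr_ge0|lra].
rewrite (telescope_sumr (fun n => - (n.+1%:R : R)^-1))// opprK -[leRHS]mulr1 ler_pM2l//.
by rewrite invr1 addrC gerBl invr_ge0.
Qed.

Lemma cvg_EFin_distance (u : nat -> \bar R) (c : R) :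
  (forall eps, 0 < eps -> \forall n \near \oo, (`|u n - c%:E| <= eps%:E)%E) ->
  u n @[n --> \oo] --> c%:E.
Proof.
move=> h; apply/fine_cvgP.
have fin eps : 0 < eps -> \forall n \near \oo, u n \is a fin_num /\ `|c - fine (u n)| <= eps.
  move=> /h; apply: filterS => n; case: (u n) => [r| |]//=.
  by rewrite lee_fin distrC => rc; split.
split; first by apply: filterS (fin 1 ltr01) => n [].
by apply/cvgrPdist_le => eps /fin; apply: filterS => n [].
Qed.

(** The power [(L^2)^(40 p)] equals [(L^5)^(16 p)], at most [(C N)^(16 p)]. Against [N ^ (18 p)] a
    surplus of at least one factor [N] remains and absorbs the constants. *)
Lemma rate_bound (p : nat) (N L C B eps : R) : (0 < p)%N -> 0 < eps -> 1 <= N ->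
  1 <= L -> 0 <= B -> L ^+ 5 <= C * N -> B * C ^+ (16 * p) / eps ^+ (40 * p) <= N ->
  B / N ^+ (18 * p) <= (eps / L ^+ 2) ^+ (2 * (20 * p)).
Proof.
move=> p0 eps0 N1 L1 B0 LN BN.
have N0 : 0 < N by exact: lt_le_trans N1.
have L0 : 0 < L by exact: lt_le_trans L1.
have e0 : 0 < eps ^+ (40 * p) by exact: exprn_gt0.
have l0 : 0 < (L ^+ 5) ^+ (16 * p) by rewrite !exprn_gt0.
have C0 : 0 <= C.
  by rewrite -(pmulr_lge0 _ N0); apply: le_trans LN; rewrite exprn_ge0// ltW.
have -> : (eps / L ^+ 2) ^+ (2 * (20 * p)) = eps ^+ (40 * p) / (L ^+ 5) ^+ (16 * p).
  by rewrite expr_div_n -!exprM; congr (_ ^+ _ / _ ^+ _); lia.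
rewrite ler_pdivrMr ?exprn_gt0// mulrAC ler_pdivlMr//.
apply: (@le_trans _ _ (B * (C ^+ (16 * p) * N ^+ (16 * p)))).
  rewrite ler_wpM2l// -exprMn lerXn2r// nnegrE ?exprn_ge0 ?(ltW L0)//.
  exact: mulr_ge0 C0 (ltW N0).
rewrite mulrA; rewrite ler_pdivrMr// in BN.
apply: (@le_trans _ _ (N * eps ^+ (40 * p) * N ^+ (16 * p))).
  by rewrite ler_wpM2r// exprn_ge0// ltW.
rewrite [N * _]mulrC -mulrA -exprS; apply: ler_wpM2l; first exact: ltW.
by apply: ler_weXn2l => //; lia.
Qed.

Lemma error_terms_le (L e : R) : 2 <= L -> 0 < e ->
  2 * L * (10 * (e / L ^+ 2)) + 2 * L * (10 * (e / L ^+ 2)) +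
   4^-1 * L ^+ 2 * (10 * (e / L ^+ 2)) + 4^-1 * e <= 32 * e.
Proof.
move=> L2 e0; have L0 : 0 < L by lra.
rewrite [leLHS](_ : _ = (40 / L + 11 / 4) * e); last by field; rewrite gt_eqF.
rewrite ler_pM2r// -lerBrDr ler_pdivrMr//; lra.
Qed.

Context {d : nat} {dT : measure_display} {T : measurableType dT}.
Variable PP : probability T R.

Let J : finType := (option 'I_d + option 'I_d)%type.
Let D := #|J|.

Let D0 : (0 < D)%N.
Proof. by apply/card_gt0P; exists (inl None). Qed.

(** In place of Borel-Cantelli: the means are of order [n^(-20 D)], so after weighting by [n^(18 D)]
    they are dominated by [n^(-2)]. The weighted series has finite mean, hence is almost surely
    finite, and its sum serves as [B]. *)
Lemma ae_neuron_chaining_le (P : probability (borelRd R d) R)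
    (X : nat -> {RV PP >-> borelRd R d}) : iid_sample X P ->
  {ae PP, forall t, exists2 B : R, 0 <= B & forall n, (0 < n)%N ->
    (neuron_chaining P X 1 n t <= (B / n%:R ^+ (18 * D))%:E)%E}.
Proof.
move=> X_iid.
pose w (n : nat) : R := n.+1%:R ^+ (18 * D).
have w0 n : 0 < w n by rewrite exprn_gt0.
pose F n t := ((w n)%:E * neuron_chaining P X 1 n.+1 t)%E.
have F0 n t : (0 <= F n t)%E.
  by apply: mule_ge0; [rewrite lee_fin ltW|exact: neuron_chaining_ge0].
have mF n : measurable_fun setT (F n).
  by apply: measurable_funeM; exact: measurable_neuron_chaining.
have sF : (\int[PP]_t \sum_(0 <= n <oo) F n t < +oo)%E.
  rewrite integral_nneseries//.
  have c0 : 0 <= chaining_constant (R := R) (d := d) by exact: chaining_constant_ge0.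
  apply: (@le_lt_trans _ _ (\sum_(0 <= n <oo)
      (chaining_constant (R := R) (d := d))%:E * (n.+1%:R ^+ 2 : R)^-1%:E)%E).
    apply: lee_nneseries => [n _ _|n _]; first by apply: integral_ge0.
    rewrite ge0_integralZl_EFin//; last 3 first.
    - by move=> t _; exact: neuron_chaining_ge0.
    - exact: measurable_neuron_chaining.
    - exact: ltW.
    apply: le_trans (lee_wpmul2l _ (integral_neuron_chaining X_iid _ _)) _ => //.
      by rewrite lee_fin ltW.
    rewrite expr1n mulr1 -!EFinM lee_fin mulrCA ler_wpM2l// -/D.
    have n0 : (0 : R) < n.+1%:R by [].
    rewrite ler_pdivrMr ?exprn_gt0// mulrC ler_pdivlMr ?exprn_gt0// -exprD.
    by rewrite ler_weXn2l ?ler1n//; lia.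
  rewrite nneseriesZl => [|n _]; last by rewrite lee_fin invr_ge0 sqr_ge0.
  apply: le_lt_trans (lee_wpmul2l _ nneseries_invn_sqr) _; first by rewrite lee_fin.
  by rewrite -EFinM ltry.
have iF : PP.-integrable setT (fun t => \sum_(0 <= n <oo) F n t)%E.
  apply/integrableP; split; first exact: ge0_emeasurable_sum.
  under eq_integral do rewrite gee0_abs ?nneseries_ge0//.
  exact: sF.
apply: filterS (integrable_ae measurableT iF) => t /(_ I) fin.
exists (fine (\sum_(0 <= n <oo) F n t)%E); first by apply: fine_ge0; exact: nneseries_ge0.
case=> // n _.
have : (F n t <= \sum_(0 <= n <oo) F n t)%E.
  apply: le_trans (@nneseries_lim_ge _ (F ^~ t) xpredT 0 n.+1 (fun n _ _ => F0 n t)).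
  rewrite big_nat_recr//= leeDr// sume_ge0//.
rewrite -(fineK fin); move: (neuron_chaining_ge0 P X 1 n.+1 t); rewrite /F.
case: (neuron_chaining P X 1 n.+1 t) => [r| |]//.
  by rewrite -EFinM !lee_fin ler_pdivlMr// mulrC.
by rewrite mulry gtr0_sg// mul1e leye_eq.
Qed.

(** The inner weights stay in a fixed box, hence [A = 1], and the total weight is [k n + 2]. On an
    almost sure event [B / n^(18 D)] eventually falls below the level that forces deviations of
    order [e / (k n + 2)^2]. *)
Lemma chi2_estimator_cvg (P Q : probability (borelRd R d) R)
    (PQ : chi2_pair (unit_cube R d) P Q) (X Y : nat -> {RV PP >-> borelRd R d})
    (k : nat -> nat) (C : R) :
  iid_sample X P -> iid_sample Y Q ->
  (forall eps, 0 < eps -> \forall n \near \oo,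
     exists2 g, neural_nets R d (k n) 1 1 1 g & risk P Q (masked g) <= eps) ->
  (\forall n \near \oo, ((k n)%:R + 2) ^+ 5 <= C * n%:R) ->
  {ae PP, forall t,
    chi2_estimator (neural_nets R d (k n) 1 1 1)
      (fun i : 'I_n => X i t) (fun i : 'I_n => Y i t) @[n --> \oo] --> chi2 P Q}.
Proof.
move=> X_iid Y_iid small_risk kC; have [PK QK _ _] := PQ.
have ae_cube (Z : nat -> {RV PP >-> borelRd R d}) (S : probability (borelRd R d) R) : iid_sample Z S -> S (unit_cube R d) = 1%E ->
    {ae PP, forall t, forall i : nat, unit_cube R d (Z i t)}.
  move=> Z_iid /(sample_in_cube Z_iid)[N [mN N0 hN]]; exists N; split; [exact: mN|exact: N0|] => t /=.
  by apply: contra_notP => nN i; exact: hN.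
have := ae_neuron_chaining_le X_iid; have := ae_neuron_chaining_le Y_iid.
have := ae_cube _ _ X_iid PK; have := ae_cube _ _ Y_iid QK.
move=> hY hX hQ hP.
have FF := ae_filter_ringOfSetsType PP.
apply: (@filterS2 _ _ FF _ _ _ _ (@filterI _ _ FF _ _ hX hY) (@filterI _ _ FF _ _ hP hQ)).
move=> t [Xt Yt] [[BP BP0 hBP] [BQ BQ0 hBQ]].
rewrite (chi2E PQ); apply: cvg_EFin_distance => eps eps0; rewrite -(chi2E PQ).
pose e := eps / 32; have e0 : 0 < e by rewrite divr_gt0.
near=> n.
have n0 : (0 < n)%N by near: n; exact: nbhs_infty_gt.
have n1 : (1 : R) <= n%:R by rewrite ler1n.
have hk : ((k n)%:R + 2) ^+ 5 <= C * n%:R by near: n.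
have [g gk gr] : exists2 g, neural_nets R d (k n) 1 1 1 g & risk P Q (masked g) <= e.
  by near: n; exact: small_risk.
have L2 : (2 : R) <= (k n)%:R + 2 by rewrite lerDr.
have L1 : (1 : R) <= (k n)%:R + 2 by apply: le_trans L2; rewrite ler1n.
have dev (Z : nat -> {RV PP >-> borelRd R d}) (S : probability (borelRd R d) R) B : iid_sample Z S -> 0 <= B ->
    (forall n, (0 < n)%N -> (neuron_chaining S Z 1 n t <= (B / n%:R ^+ (18 * D))%:E)%E) ->
    B * C ^+ (16 * D) / e ^+ (40 * D) <= n%:R ->
    forall th : J -> R, (forall j, `|th j| <= 1) ->
    `|empirical_deviation S Z n (neuron_pair th) t| <= 10 * (e / ((k n)%:R + 2) ^+ 2).
  move=> Z_iid B0 hB Bn th th1.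
  have a0 : 0 < e / ((k n)%:R + 2) ^+ 2 by rewrite divr_gt0// exprn_gt0// (lt_le_trans ltr01).
  (* Tolerance [e / (k n + 2)^2] with [y = 1], so 10 is 5 times 2. *)
  have -> : 10 * (e / ((k n)%:R + 2) ^+ 2) = 5 * (e / ((k n)%:R + 2) ^+ 2 * (1 + 1)) by ring.
  apply: (neuron_deviation_le (A := 1)) => //.
  by rewrite mul1r; apply: le_trans (hB n n0) _; rewrite lee_fin; exact: (rate_bound D0 e0 n1 L1 B0 hk Bn).
have devP := dev X P BP X_iid BP0 hBP; have devQ := dev Y Q BQ Y_iid BQ0 hBQ.
have nP : BP * C ^+ (16 * D) / e ^+ (40 * D) <= n%:R by near: n; exact: nbhs_infty_ger.
have nQ : BQ * C ^+ (16 * D) / e ^+ (40 * D) <= n%:R by near: n; exact: nbhs_infty_ger.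
have := chi2_estimator_error PQ (fun i : 'I_n => Xt i) (fun i : 'I_n => Yt i) ler01
  (devP nP) (devQ nQ) (ex_intro2 _ _ g gk gr).
move=> /le_trans; apply; rewrite lee_fin !mulr1.
have -> : eps = 32 * e by rewrite mulrC divfK.
exact: error_terms_le.
Unshelve. all: by end_near. Qed.

End almost_sure_convergence.

Theorem theorem5 (R : realType) (d : nat) (d_gt0 : (0 < d)%N)
    (P Q : probability (borelRd R d) R)
    (PQ : chi2_pair (unit_cube R d) P Q)
    (dT : measure_display) (T : measurableType dT) (PP : probability T R)
    (X Y : nat -> {RV PP >-> borelRd R d})
    (X_iid : iid_sample X P) (Y_iid : iid_sample Y Q)
    (alpha : R) (alpha_gt0 : 0 < alpha) :
  ((exists f : 'rV[R]_d -> R,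
      fchi2_version (unit_cube R d) P Q f /\
      {within unit_cube R d, continuous f}) ->
    forall k : nat -> nat,
      k n @[n --> \oo] --> \oo ->
      (fun n => (k n)%:R : R^o) =O_\oo
        (fun n => n%:R `^ ((1 - alpha) / 5) : R^o) ->
      {ae PP, forall t,
        chi2_estimator (neural_nets R d (k n) 1 1 1)
          (fun i : 'I_n => X i t) (fun i : 'I_n => Y i t)
          @[n --> \oo] --> chi2 P Q})
  /\
  ((exists (M : R) (f : 'rV[R]_d -> R),
      fchi2_version (unit_cube R d) P Q f /\
      barron_ball (unit_cube R d) M f) ->
    forall C0 : R, exists C : R, forall k n : nat,
      (0 < k)%N -> (0 < n)%N ->
      Num.sqrt k%:R * ln k%:R ^+ 2 <= C0 * n%:R `^ ((1 - alpha) / 2) ->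
      (\int[PP]_t
         `| chi2_estimator (neural_nets_star R d k (2^-1 * ln k%:R))
              (fun i : 'I_n => X i t) (fun i : 'I_n => Y i t) - chi2 P Q |
       <= (C * (k%:R `^ (- 2^-1) +
                Num.sqrt k%:R * ln k%:R ^+ 2 * n%:R `^ (- 2^-1)))%:E)%E).
Proof.
split=> [[f [fv cf]] k kinfty kO|[M [f [fv fb]]] C0]; last first.
  have [Cr Cr0 small_risk] := barron_ball_risk PQ fv fb.
  have [C hC] := expected_error PQ X_iid Y_iid Cr0 small_risk.
  by exists C => n m n0 m0 _; exact: hC.
have /eqO_exP[C C0 kC] := kO.
(* Eventually [k n <= C n^(1/5)] and [1 <= n^(1/5)], so [k n + 2 <= (C + 2) n^(1/5)]; the constant
   is the fifth power. *)
apply: (chi2_estimator_cvg PQ (C := (C + 2) ^+ 5)) => //.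
  move=> eps /(continuous_small_risk PQ fv cf)[K0 hK].
  have /cvgnyPge/(_ K0) := kinfty; apply: filterS => n; exact: hK.
near=> n; have n1 : (1 : R) <= n%:R by rewrite ler1n; near: n; exact: nbhs_infty_gt.
have s1 : 1 <= n%:R `^ 5^-1 :> R.
  by rewrite -[leLHS](powRr0 (n%:R : R)) ler_powR// invr_ge0.
have kn : (k n)%:R <= C * n%:R `^ 5^-1.
  apply: (@le_trans _ _ (C * n%:R `^ ((1 - alpha) / 5))).
    have : `|(k n)%:R : R^o| <= C * `|n%:R `^ ((1 - alpha) / 5) : R^o| by near: n.
    by rewrite ger0_norm// ger0_norm// powR_ge0.
  rewrite ler_wpM2l ?(ltW C0)// ler_powR// ler_piMl ?invr_ge0// gerBl ltW//.
have nE : n%:R = (n%:R `^ 5^-1) ^+ 5 :> R.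
  by rewrite -powR_mulrn ?powR_ge0// -powRrM mulVf ?pnatr_eq0// powRr1.
rewrite [in leRHS]nE -exprMn lerXn2r// ?nnegrE.
- by rewrite addr_ge0.
- by rewrite mulr_ge0 ?powR_ge0// addr_ge0// ltW.
- by rewrite mulrDl lerD// ler_peMr.
Unshelve. all: by end_near. Qed.
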